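(* Let $a\le p$. For each $N$ label the elements of $\mathcal V_N=\{-1,1\}^N$ as $\sigma(i)=(\sigma_1(i),\sigma_2(i))$, $i=1,\dots,2^N$, so that $\Xi_{\sigma(1)}>\Xi_{\sigma(2)}>\cdots>\Xi_{\sigma(2^N)}$ (this is well defined almost surely). Let $\mathcal P=\{\xi_i,\ i\ge1\}$, $\xi_1>\xi_2>\cdots$, be the ranked points of a Poisson point process on $\mathbb R$ with intensity measure $Ke^{-x}\,dx$. Then for every $k\ge1$ the random vector $$\left(u_N^{-1}(\Xi_{\sigma(1)}),\ \Xi^{(1)}_{\sigma_1(1)}-\sqrt{aN}\,\beta_*;\ \dots;\ u_N^{-1}(\Xi_{\sigma(k)}),\ \Xi^{(1)}_{\sigma_1(k)}-\sqrt{aN}\,\beta_*\right)$$ converges in distribution, as $N\to\infty$, to $(\xi_1,W_1;\dots;\xi_k,W_k)$, where: - if $a<p$, then $K=1$ and $W_1,\dots,W_k$ are independent Gaussian variables with mean zero and variance $1-a$, which are also independent of $\mathcal P$; - if $a=p$, then $K=\tfrac12$ and $W_1,\dots,W_k$ are independent, independent of $\mathcal P$, and each distributed as a Gaussian variable with mean zero and variance $1-a$ conditioned on being negative.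
   Context: Fix $p\in(0,1)$ and $a\in(0,1)$. For $N\in\mathbb N$ put $N_1=[pN]$ (integer part), $N_2=N-N_1$, $\mathcal V_n=\{-1,1\}^n$, and write $\sigma\in\mathcal V_N$ as $\sigma=\sigma_1\sigma_2$ with $\sigma_1\in\mathcal V_{N_1}$, $\sigma_2\in\mathcal V_{N_2}$. Let $\{\Xi^{(1)}_{\sigma_1},\Xi^{(2)}_{\sigma_1\sigma_2}:\sigma_1\in\mathcal V_{N_1},\sigma_2\in\mathcal V_{N_2}\}$ be independent standard Gaussian random variables and set $$\Xi_\sigma=\sqrt a\,\Xi^{(1)}_{\sigma_1}+\sqrt{1-a}\,\Xi^{(2)}_{\sigma_1\sigma_2}.$$ Let $\beta_*=\sqrt{2\log2}$, $\kappa=\log\log2+\log4\pi$, and $$u_N(x)=\frac{x}{\beta_*\sqrt N}+\beta_*\sqrt N-\frac{\log N+\kappa}{2\beta_*\sqrt N},$$ with inverse function $u_N^{-1}$. *)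

(* Defs.v *)
From HB Require Import structures.
From mathcomp Require Import all_boot all_order all_algebra.
From mathcomp Require Import all_classical all_reals all_analysis measurable_realfun.

Set Implicit Arguments.
Unset Strict Implicit.
Unset Printing Implicit Defensive.

Import Order.TTheory GRing.Theory Num.Theory.
Import numFieldNormedType.Exports.

Local Open Scope classical_set_scope.
Local Open Scope ring_scope.

Section probability_notions.
Context d (T : measurableType d) (R : realType) (P : probability T R).

Definition independent_systems (I : eqType) (F : I -> set_system T) : Prop :=
  forall s : seq I, uniq s ->
  forall E : I -> set T, (forall i, i \in s -> F i (E i)) ->
  (P (\bigcap_(i in [set` s]) E i) = \prod_(i <- s) P (E i))%E.

Definition independent_family (I : eqType) d' (U : measurableType d')
    (X : I -> T -> U) : Prop :=
  independent_systems (fun i => preimage_set_system setT (X i) measurable).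

Definition sigma_of_process (I : Type) d' (U : measurableType d')
    (X : I -> T -> U) : set_system T :=
  <<s \bigcup_i preimage_set_system setT (X i) measurable >>.

(* The W j are mutually independent, and independent of the whole process xi. *)
Definition independent_marks (k : nat) (xi : nat -> T -> R)
    (W : 'I_k -> T -> R) : Prop :=
  independent_systems (fun o : option 'I_k =>
    if o is Some j then preimage_set_system setT (W j) measurable
    else sigma_of_process xi).

Definition has_law (X : {RV P >-> R}) (nu : set R -> \bar R) : Prop :=
  forall A : set R, measurable A -> distribution P X A = nu A.

Definition point_count (xi : nat -> T -> R) (A : set R) (w : T) : \bar R :=
  counting [set i | A (xi i w)].

(* [poisson_prob] ignores its second argument; unlike [poisson_pmf], it is the
   Dirac mass at 0 when the rate is 0. *)
Definition poisson_point_process (mu : set R -> \bar R)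
    (xi : nat -> T -> R) : Prop :=
  [/\ forall (A : set R) (n : nat), measurable A -> mu A \is a fin_num ->
        P [set w | point_count xi A w = n%:R%:E] =
        poisson_prob (fine (mu A)) 0%N [set n],
      forall A : set R, measurable A -> mu A = +oo%E ->
        {ae P, forall w, point_count xi A w = +oo%E}
    & forall (m : nat) (A : 'I_m -> set R), (forall j, measurable (A j)) ->
        trivIset setT A -> 
          independent_family (fun j => point_count xi (A j))].

Definition ranked_poisson_process (mu : set R -> \bar R)
    (xi : nat -> {RV P >-> R}) : Prop :=
  {ae P, forall w, forall i, xi i.+1 w < xi i w} /\
  poisson_point_process mu (fun i => xi i).

End probability_notions.

Definition exp_intensity (R : realType) (K : R) (A : set R) : \bar R :=
  (\int[lebesgue_measure]_(x in A) (K * expR (- x))%:E)%E.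

Definition conditioned (R : realType) (nu : set R -> \bar R) (B A : set R) :
    \bar R := (nu (A `&` B) / nu B)%E.

(* The variables X N may live on different probability spaces. *)
Definition cvg_in_distribution (R : realType) (E : topologicalType)
    (d : nat -> measure_display) (T : forall N, measurableType (d N))
    (P : forall N, probability (T N) R) (X : forall N, T N -> E)
    (d' : measure_display) (T' : measurableType d') (Q : probability T' R)
    (Y : T' -> E) : Prop :=
  forall f : E -> R, continuous f -> bounded_fun f ->
    ('E_(P N)[f \o X N] @[N --> \oo] --> 'E_Q[f \o Y])%E.

Section scaling.
Context (R : realType).

Definition beta_star : R := Num.sqrt (2 * ln 2).

Definition kappa : R := ln (ln 2) + ln (4 * pi).

Definition u_N (N : nat) (x : R) : R :=
  x / (beta_star * Num.sqrt N%:R) + beta_star * Num.sqrt N%:R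
  - (ln N%:R + kappa) / (2 * beta_star * Num.sqrt N%:R).

Definition u_N_inv (N : nat) (y : R) : R :=
  beta_star * Num.sqrt N%:R *
  (y - beta_star * Num.sqrt N%:R
   + (ln N%:R + kappa) / (2 * beta_star * Num.sqrt N%:R)).

Lemma beta_star_sqrt_neq0 (N : nat) :
  (0 < N)%N -> beta_star * Num.sqrt N%:R != 0.
Proof.
move=> N0; apply: lt0r_neq0; rewrite mulr_gt0// sqrtr_gt0 ?ltr0n//.
by rewrite mulr_gt0// ln_gt0// ltr1n.
Qed.

Lemma u_NK (N : nat) : (0 < N)%N -> cancel (u_N N) (u_N_inv N).
Proof.
move=> /beta_star_sqrt_neq0 b0 x; rewrite /u_N_inv /u_N.
by rewrite addrAC subrK addrK mulrC divfK.
Qed.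

Lemma u_N_invK (N : nat) : (0 < N)%N -> cancel (u_N_inv N) (u_N N).
Proof.
move=> /beta_star_sqrt_neq0 b0 y; rewrite /u_N /u_N_inv.
by rewrite [_ * (_ + _)]mulrC mulfK// addrAC addrK subrK.
Qed.

End scaling.

Section grem.
Context (R : realType) (p : R).

(* Spin configurations; [true] and [false] stand for 1 and -1. *)
Definition spins (n : nat) := {ffun 'I_n -> bool}.

Definition N1 (N : nat) : nat := Num.truncn (p * N%:R).
Definition N2 (N : nat) : nat := N - N1 N.

(* The pairs (sigma_1, sigma_2), identified with their concatenation. *)
Definition config (N : nat) : finType := (spins (N1 N) * spins (N2 N))%type.

Definition config0 (N : nat) : config N := ([ffun=> true], [ffun=> true]).

Definition Xi (a : R) (N : nat) (T : Type) (X1 : spins (N1 N) -> T -> R)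
    (X2 : config N -> T -> R) (s : config N) (w : T) : R :=
  Num.sqrt a * X1 s.1 w + Num.sqrt (1 - a) * X2 s w.

Definition joint_family (N : nat) (T : Type) (X1 : spins (N1 N) -> T -> R)
    (X2 : config N -> T -> R) (i : spins (N1 N) + config N) : T -> R :=
  match i with inl s1 => X1 s1 | inr s => X2 s end.

Definition is_ranking (N : nat) (x : config N -> R) (s : seq (config N)) :
    bool := perm_eq s (enum (config N)) && sorted (fun t v => x v < x t) s.

End grem.

Definition pairs_mx (R : realType) (k : nat) (x y : 'I_k -> R) : 'M[R]_(k, 2) :=
  \matrix_(i < k, j < 2) if j == ord0 then x i else y i.

(* Ranks start at 0. The default [config0] is only reached when 2 ^ N < k. *)
Definition top_vector (R : realType) (p a : R) (N k : nat) (T : Type)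
    (X1 : spins (N1 p N) -> T -> R) (X2 : config p N -> T -> R)
    (sigma : T -> seq (config p N)) (w : T) : 'M[R]_(k, 2) :=
  let s i := nth (config0 p N) (sigma w) i in
  pairs_mx (fun i : 'I_k => u_N_inv N (Xi a X1 X2 (s i) w))
           (fun i : 'I_k => X1 (s i).1 w - Num.sqrt (a * N%:R) * beta_star R).

(* Main.v *)
(* Cut R^(2k) into small boxes, a box prescribing for each rank l a cell I_l for
   the rescaled energy and a cell J_l for the first-level variable, with
   I_1 > ... > I_k. It suffices to bound the probability that the top vector
   lies in a box from below, up to a factor tending to 1 with the mesh: applied
   to C + f and C - f these lower bounds give both inequalities between limits
   of expectations.

   For fixed N, sum over k configurations with distinct first halves, asking
   the l-th one to lie in its cell and all others to lie below I_k. The blocks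
   of configurations with a common first half are independent, so the
   probability is a product. With m = beta_* sqrt N, the variable
   X1 - sqrt a * Xi is independent of Xi, of law N(0, 1 - a), and Xi = m + o(1)
   on the cell; hence X1 - sqrt a * m is asymptotically N(0, 1 - a) and
   independent of u_N^-1(Xi), and the cell masses follow from
   2^N phi(u_N(x)) / m -> exp(-x). A union bound shows that, given one
   high configuration, no other one of its block is high. The void probability
   gives exp(-K exp(-x)); when a = p it is bounded after discarding the
   first-level variables above sqrt a * m, which halves the intensity.

   On the Poisson side, "every I_l contains a point and the rest of the ray
   above I_k is void" only involves void probabilities of disjoint sets. *)

Require Import Defs.
From HB Require Import structures.
From mathcomp Require Import all_boot all_order all_algebra.
From mathcomp Require Import all_classical all_reals all_analysis measurable_realfun.
From mathcomp Require Import ring lra.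

Set Implicit Arguments.
Unset Strict Implicit.
Unset Printing Implicit Defensive.

Import Order.TTheory GRing.Theory Num.Theory.
Import numFieldNormedType.Exports.

Local Open Scope classical_set_scope.
Local Open Scope ring_scope.

(** * Gaussian measures *)

(** Lower bounds suffice since the limit is a probability law: the admissible boxes already carry
    its whole mass, so tightness comes for free, and restricting to distinct first halves only
    discards probability.

    The condition [(a < p) || (d < 0)] found throughout comes from a count. Write [m] for the
    leading level, [c] and [t] for the square roots of [a] and [1 - a]. If a configuration has
    energy near [m] and first-level variable [c * m + d], a companion in its block is high only if
    its second-level variable exceeds about [t * m - c * d / t]. There are about
    [exp((1 - p) * m^2 / 2)] companions, so about [exp(- m * ((p - a) * m / 2 - c * d))] of them are
    high. For [a < p] this vanishes whatever [d] is; for [a = p] the quadratic terms balance and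
    only [d < 0] makes it vanish. Hence marks conditioned to be negative.

    Both regimes share one computation because [K] times the law of a mark agrees with N(0, 1 - a)
    on every admissible cell: for [a = p] the conditioning doubles the mass and [K = 1/2] undoes
    this. *)

Section gaussian_measure.
Context {R : realType}.
Local Notation mu := (@lebesgue_measure R).

(** Pushing Lebesgue measure forward along the affine map and multiplying by the slope preserves the
    length of half-open intervals, which determines the measure. *)
Lemma ge0_integral_affine (c b : R) (h : R -> \bar R) : 0 < c ->
  measurable_fun [set: R] h -> (forall x, 0 <= h x)%E ->
  (c%:E * \int[mu]_y h (c * y + b)%R = \int[mu]_x h x)%E.
Proof.
move=> c0 mh h0.
pose phi : measurableTypeR R -> measurableTypeR R := fun y => c * y + b.
have mphi : measurable_fun setT phi.
  by apply: measurable_funD => //; exact: measurable_funM.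
have -> : (\int[mu]_y h (c * y + b)%R = \int[pushforward mu phi]_x h x)%E.
  by rewrite ge0_integral_pushforward.
rewrite -(@ge0_integral_mscale _ _ _ (pushforward mu phi) _ measurableT
  (NngNum (ltW c0)))//.
apply: eq_measure_integral => A mA _; apply/esym.
apply: lebesgue_measure_unique => // _ [[x y]] _ <-.
rewrite /= /mscale /= /pushforward.
have -> : phi @^-1` `]x, y] = `](x - b) / c, (y - b) / c]%classic.
  apply/seteqP; split => z; rewrite /= !in_itv/= /phi ltr_pdivrMr// ler_pdivlMr//;
    by rewrite ltrBlDr lerBrDr mulrC.
rewrite !lebesgue_measure_itv/= !lte_fin ltr_pM2r ?invr_gt0// ltrD2r.
case: ifPn => _; last by rewrite mule0.
by rewrite -!EFinD -EFinM; congr EFin; field; rewrite gt_eqF.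
Qed.

(** The Radon-Nikodym derivative of [normal_prob] agrees almost everywhere with [normal_pdf], as
    both have the same integral over every measurable set. The bound by 1 supplies integrability. *)
Lemma integral_normal_prob (m s : R) (f : R -> \bar R) : s != 0 ->
  measurable_fun [set: R] f -> (forall x, 0 <= f x <= 1)%E ->
  (\int[normal_prob m s]_x f x = \int[mu]_x (f x * (normal_pdf m s x)%:E))%E.
Proof.
move=> s0 mf f01.
have dom := @normal_prob_dominates R m s.
have intf : (normal_prob m s).-integrable setT f.
  apply/integrableP; split => //.
  apply: (@le_lt_trans _ _ (\int[normal_prob m s]_x cst 1 x)%E).
    apply: ge0_le_integral => //=; first exact: measurableT_comp.
    by move=> x _; have /andP[? ?] := f01 x; rewrite gee0_abs.
  rewrite integral_cst//= mul1e.
  by rewrite (@probability_setT _ _ _ (normal_prob m s)) ltry.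
have mpdf : measurable_fun setT (fun x => (normal_pdf m s x)%:E).
  by apply/measurable_EFinP; exact: measurable_normal_pdf.
rewrite -(Radon_Nikodym_change_of_variables dom)//=.
apply: ae_eq_integral => //.
- exact: emeasurable_funM.

- exact: emeasurable_funM.
- apply: ae_eqe_mul2l => /=.
  rewrite Radon_NikodymE//=.
  case: cid => /= h [h1 h2 h3].
  apply: integral_ae_eq => //=.
  by move=> E E01 mE; rewrite -h3.
Qed.

End gaussian_measure.

(** * Rotation of two independent Gaussian variables *)

Section gaussian_rotation.
Context {R : realType}.
Local Notation mu := (@lebesgue_measure R).

Lemma normal_prob_indic (m s : R) (A : set R) : measurable A ->
  (normal_prob m s A = \int[mu]_x (\1_A x * normal_pdf m s x)%:E)%E.
Proof.
move=> mA; rewrite /normal_prob integral_mkcond; apply: eq_integral => x _.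
rewrite patchE indicE; case: ifPn => _; first by rewrite mul1r.
by rewrite mul0r.
Qed.

(** With [w = v / s] the arguments on the left are [c * u + s * w] and [s * u - c * w], a rotation
    of [(u, w)], so the quadratic exponents agree. The factor [s^-1] turns the density of [w] into
    that of [v]. *)
Lemma normal_pdf_rotation (c s u v : R) : 0 < s -> c ^+ 2 + s ^+ 2 = 1 ->
  normal_pdf 0 1 (v + c * u) * (s^-1 * normal_pdf 0 1 (s^-1 * u - c / s * (v + c * u)))
  = normal_pdf 0 1 u * normal_pdf 0 s v.
Proof.
move=> s0 cs1; rewrite !normal_pdfE ?oner_eq0 ?gt_eqF//.
have -> : normal_peak s = s^-1 * normal_peak 1.
  rewrite /normal_peak expr1n mul1r -mulrnAr sqrtrM ?sqr_ge0// invfM.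
  by rewrite sqrtr_sqr gtr0_norm.
rewrite /normal_fun !subr0 !expr1n.
have -> : forall a b d e : R, a * b * (d * (a * e)) = a * a * d * (b * e).
  by move=> *; ring.
have -> : forall a b d e : R, a * b * (d * a * e) = a * a * d * (b * e).
  by move=> *; ring.
congr (_ * _); rewrite -!expRD; congr expR.
have sn0 : s != 0 by rewrite gt_eqF.
pose w := v / s; have -> : v = s * w by rewrite /w mulrC divfK.
have -> : s^-1 * u - c / s * (s * w + c * u) = s * u - c * w.
  have -> : s^-1 * u - c / s * (s * w + c * u) =
    s^-1 * ((1 - c ^+ 2) * u) - s^-1 * s * (c * w) by ring.
  by rewrite -{1}cs1 addrAC subrr add0r mulVf// mul1r mulrA expr2 mulKf.
rewrite !mulNr.
have -> : (s * w) ^+ 2 / (s ^+ 2 *+ 2) = w ^+ 2 / 2.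
  by rewrite exprMn -mulr_natr -mulf_div divff ?mul1r// expf_neq0.
rewrite -!opprD -!mulrDl; congr (- (_ / _)).
by rewrite -[RHS]mul1r -cs1; ring.
Qed.

(** The planar rotation is split into two one-dimensional substitutions separated by Tonelli:
    [u = c * x + s * y] for fixed [x], then [v = x - c * u] for fixed [u]. The remainder [v] has
    variance [s ^+ 2] because it equals [s * (s * x - c * y)]. *)
Lemma gaussian_rotation (c s : R) (A B : set R) : 0 < s -> c ^+ 2 + s ^+ 2 = 1 ->
  measurable A -> measurable B ->
  ((normal_prob 0 1 \x normal_prob 0 1)
     [set z | A (c * z.1 + s * z.2)%R /\ B (z.1 - c * (c * z.1 + s * z.2))%R] =
   normal_prob 0%R 1%R A * normal_prob 0%R s B)%E.
Proof.
move=> s0 cs1 mA mB; set S := [set z | _].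
have mS : measurable S.
  have -> : S = (fun z : R * R => c * z.1 + s * z.2) @^-1` A `&`
     (fun z : R * R => z.1 - c * (c * z.1 + s * z.2)) @^-1` B by [].
  have m1 : measurable_fun setT (fun z : R * R => c * z.1 + s * z.2).
    by apply: measurable_funD; apply: measurable_funM.
  apply: measurableI; rewrite -[X in measurable X]setTI; first exact: m1.
  have m2 : measurable_fun setT (fun z : R * R => z.1 - c * (c * z.1 + s * z.2)).
    by apply: measurable_funB => //; apply: measurable_funM.
  exact: m2.
(* The joint density in the variables [x] and [u = c * x + s * y], cut to [S]; [s^-1] is the
   Jacobian. *)
pose G (z : R * R) : \bar R := (normal_pdf 0 1 z.1 * (s^-1 *
   (\1_S (z.1, s^-1 * z.2 - c / s * z.1) * normal_pdf 0 1 (s^-1 * z.2 - c / s * z.1))))%:E.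
have pdf0 := @normal_pdf_ge0 R.
have mpdf m t := @measurable_normal_pdf R m t.
have mlin : measurable_fun setT (fun z : R * R => s^-1 * z.2 - c / s * z.1).
  by apply: measurable_funB; apply: measurable_funM.
have mind (m t : R) (E : set R) (mE : measurable E) :
    measurable_fun setT (fun x => (\1_E x * normal_pdf m t x)%:E).
  by apply/measurable_EFinP; apply: measurable_funM => //; exact: measurable_indic.
have mG : measurable_fun setT G.
  apply/measurable_EFinP; apply: measurable_funM; first exact: measurableT_comp.
  apply: measurable_funM => //; apply: measurable_funM.
    apply: (@measurableT_comp _ _ _ _ _ _ (\1_S : R * R -> R)) => //.
    exact: measurable_fun_pair.
  exact: (measurableT_comp (mpdf _ _)).
have G0 z : (0 <= G z)%E.
  by rewrite lee_fin !mulr_ge0// ?invr_ge0 ?(ltW s0)// indicE ler0n.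
transitivity (\int[mu]_x \int[mu]_u G (x, u))%E.
  rewrite /product_measure1 integral_normal_prob ?oner_eq0//; last 2 first.
  - exact: measurable_fun_xsection.
  - move=> x; rewrite measure_ge0/=.
    apply: (@probability_le1 _ _ _ (normal_prob 0 1)).
    exact: measurable_xsection.
  apply: eq_integral => x _ /=.
  rewrite normal_prob_indic; last exact: measurable_xsection.
  rewrite -(@ge0_integral_affine _ s^-1 (- (c / s * x))) ?invr_gt0//; last 2 first.
  - apply/measurable_EFinP; apply: measurable_funM => //.
    exact/measurable_indic/measurable_xsection.
  - by move=> y; rewrite lee_fin mulr_ge0// indicE ler0n.
  rewrite muleC -ge0_integralZl//; last 3 first.
  - apply/measurable_EFinP; apply: measurable_funM => //.
      apply: (measurableT_comp (measurable_indic _)) => //.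
        exact: measurable_xsection.
      by apply: measurable_funD => //; exact: measurable_funM.
    apply: (measurableT_comp (mpdf _ _)) => //.
    by apply: measurable_funD => //; exact: measurable_funM.
  - by move=> y _; rewrite lee_fin mulr_ge0// indicE ler0n.
  - by rewrite lee_fin invr_ge0 ltW.
  rewrite -ge0_integralZl//; last 3 first.
  - apply: emeasurable_funM => //.
    apply/measurable_EFinP; apply: measurable_funM => //.
      apply: (measurableT_comp (measurable_indic _)) => //.
        exact: measurable_xsection.
      by apply: measurable_funD => //; exact: measurable_funM.
    apply: (measurableT_comp (mpdf _ _)) => //.
    by apply: measurable_funD => //; exact: measurable_funM.
  - move=> y _; rewrite mule_ge0 ?lee_fin ?invr_ge0 ?(ltW s0)//.
    by rewrite mulr_ge0// indicE ler0n.
  - by rewrite lee_fin.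
  apply: eq_integral => u _; rewrite /G/= -!EFinM; congr (_ * (_ * (_ * _)))%:E.
  by rewrite !indicE mem_xsection.
rewrite (@fubini_tonelli _ _ _ _ _ mu mu G)//.
have -> : (normal_prob 0 1 A * normal_prob 0 s B =
  \int[mu]_u ((\1_A u * normal_pdf 0 1 u)%:E * normal_prob 0%R s B))%E.
  rewrite ge0_integralZr//.
  - by rewrite normal_prob_indic.
  - exact: mind.
  - by move=> y _; rewrite lee_fin mulr_ge0// indicE ler0n.
apply: eq_integral => u _.
rewrite -(@ge0_integral_affine _ 1 (c * u))//; last first.
  by apply: (measurableT_comp mG); exact: measurable_fun_pair.
rewrite mul1e (normal_prob_indic 0 s mB) -ge0_integralZl//; last 3 first.
- exact: mind.
- by move=> y _; rewrite lee_fin mulr_ge0// indicE ler0n.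
- by rewrite lee_fin mulr_ge0// indicE ler0n.
apply: eq_integral => v _; rewrite /G /= mul1r -EFinM; congr EFin.
have hS : \1_S (v + c * u, s^-1 * u - c / s * (v + c * u)) = \1_A u * \1_B v :> R.
  have e1 : c * (v + c * u) + s * (s^-1 * u - c / s * (v + c * u)) = u.
    rewrite mulrBr mulrA mulfV ?gt_eqF// mul1r [c / s * _]mulrAC mulrC.
    by rewrite [s * (_ / s)]mulrC divfK ?gt_eqF//; ring.
  have Suv : S (v + c * u, s^-1 * u - c / s * (v + c * u)) <-> (A `*` B) (u, v).
    by rewrite /S/= e1 addrK.
  rewrite !indicE -natrM mulnb; congr (nat_of_bool _)%:R.
  have -> : (u \in A) && (v \in B) = ((u, v) \in A `*` B) by rewrite in_setX.
  by apply/idP/idP => /set_mem/Suv/mem_set.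
rewrite hS [RHS]mulrACA -(normal_pdf_rotation u v s0 cs1).
have gen (x y z t e : R) : x * (y * (z * t * e)) = z * t * (x * (y * e)) by ring.
exact: gen.
Qed.

End gaussian_rotation.

(** * Gaussian tails and interval masses *)

Section gaussian_tail.
Context {R : realType}.
Local Notation mu := (@lebesgue_measure R).
Local Notation phi := (@normal_pdf R 0 1).

Lemma std_normal_pdfE x : phi x = normal_peak 1 * expR (- x ^+ 2 / 2).
Proof. by rewrite normal_pdfE ?oner_eq0// /normal_fun subr0 expr1n. Qed.

Lemma le_std_normal_pdf x y : 0 <= x -> x <= y -> phi y <= phi x.
Proof.
move=> x0 xy; rewrite !std_normal_pdfE ler_pM2l ?normal_peak_gt0 ?oner_eq0//.
by rewrite ler_expR !mulNr lerN2 ler_pM2r ?invr_gt0// lerXn2r// nnegrE ?(le_trans x0).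
Qed.

Lemma is_derive_std_normal (x : R) :
  is_derive x 1 (fun y => - phi y) (x * phi x).
Proof.
have -> : (fun y => - phi y) =
    (fun y => (- normal_peak 1) * (expR \o (fun z => z ^+ 2 * (- 2^-1))) y).
  apply/funext => y; rewrite /= std_normal_pdfE !mulNr mulrN.
  by [].
apply: is_derive_eq.
have e : x ^+ 2 * - 2^-1 = - x ^+ 2 / 2 by rewrite mulrN mulNr.
by rewrite std_normal_pdfE scaler0 add0r e /GRing.scale/= mulr1; field.
Qed.

Lemma std_normal_pdf_cvg0 : - phi x @[x --> +oo%R] --> (0:R).
Proof.
rewrite -[X in _ --> X]oppr0; apply: cvgN.
apply: (@squeeze_cvgr _ _ _ _ (cst 0) (fun x => normal_peak 1 * x^-1)).
- near=> x; apply/andP; split; first exact: normal_pdf_ge0.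
  have x0 : 0 < x by near: x; apply: nbhs_pinfty_gt; rewrite num_real.
  rewrite std_normal_pdfE ler_pM2l ?normal_peak_gt0 ?oner_eq0//.
  rewrite mulNr expRN lef_pV2 ?posrE ?expR_gt0//.
  apply: le_trans (expR_ge1Dx _).
  rewrite -subr_ge0; have -> : 1 + x ^+ 2 / 2 - x = ((x - 1) ^+ 2 + 1) / 2 by field.
  by rewrite divr_ge0// addr_ge0// sqr_ge0.
- exact: cvg_cst.
- rewrite -(mulr0 (normal_peak 1)); apply: cvgMr; apply/gtr0_cvgV0.
    by near=> x; near: x; apply: nbhs_pinfty_gt; rewrite num_real.
  exact: cvg_id.
Unshelve. all: by end_near. Qed.

Lemma continuous_id_std_normal : continuous (fun x : R => x * phi x).
Proof.
move=> x; apply: cvgM; first exact: cvg_id.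
by apply: continuous_normal_pdf; rewrite oner_eq0.
Qed.

Lemma measurable_std_normal_pdf (E : set R) : measurable_fun E (fun x => (phi x)%:E).
Proof.
by apply/measurable_EFinP; apply: measurable_funTS; exact: measurable_normal_pdf.
Qed.

Lemma measurable_id_std_normal (E : set R) : measurable_fun E (fun x => (x * phi x)%:E).
Proof.
apply/measurable_EFinP; apply: measurable_funTS.
by apply: measurable_funM => //; exact: measurable_normal_pdf.
Qed.

(** Mills' bound: the factor [x / t] is at least 1 on the ray, and [x * phi x] has the
    antiderivative [- phi x]. *)
Lemma normal_prob_tail_le (t : R) : 0 < t ->
  (normal_prob 0%R 1%R `[t, +oo[%classic <= (phi t / t)%:E)%E.
Proof.
move=> t0.
have FTC : (\int[mu]_(x in `[t, +oo[) (x * phi x)%:E = (phi t)%:E)%E.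
  rewrite (@ge0_continuous_FTC2y _ _ (fun y => - phi y) t 0)//.
  - by rewrite -EFinB opprK add0r.
  - by move=> x tx; rewrite mulr_ge0 ?normal_pdf_ge0// (le_trans (ltW t0)).
  - by apply: continuous_subspaceT; exact: continuous_id_std_normal.
  - exact: std_normal_pdf_cvg0.
  - by move=> x _; have [] := is_derive_std_normal x.
  - apply: cvg_at_right_filter; apply: cvgN.
    by apply: continuous_normal_pdf; rewrite oner_eq0.
  - by move=> x _; rewrite derive1E; have [_ ->] := is_derive_std_normal x.
apply: (@le_trans _ _ (\int[mu]_(x in `[t, +oo[) ((t^-1)%:E * (x * phi x)%:E))%E).
  apply: ge0_le_integral => //.
  - by move=> x _; rewrite lee_fin normal_pdf_ge0.
  - exact: measurable_std_normal_pdf.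
  - apply: emeasurable_funM => //; exact: measurable_id_std_normal.
  - move=> x /=; rewrite in_itv/= andbT => tx; rewrite -EFinM lee_fin mulrA.
    by rewrite ler_peMl ?normal_pdf_ge0// mulrC ler_pdivlMr// mul1r.
rewrite ge0_integralZl//.
- by rewrite FTC -EFinM mulrC.
- exact: measurable_id_std_normal.
- move=> x /=; rewrite in_itv/= andbT => tx.
  by rewrite lee_fin mulr_ge0 ?normal_pdf_ge0// (le_trans (ltW t0)).
- by rewrite lee_fin invr_ge0 ltW.
Qed.

(** The same antiderivative, with the factor [x / u], which is at most 1 below the right
    endpoint. *)
Lemma normal_prob_itv_ge (t u : R) : 0 <= t -> t < u ->
  (((phi t - phi u) / u)%:E <= normal_prob 0%R 1%R `[t, u[%classic)%E.
Proof.
move=> t0 tu; have u0 : 0 < u := le_lt_trans t0 tu.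
have FTC : (\int[mu]_(x in `[t, u[) (x * phi x)%:E = (phi t - phi u)%:E)%E.
  rewrite integral_itv_bndo_bndc; last exact: measurable_id_std_normal.
  rewrite (@continuous_FTC2 _ _ (fun y => - phi y) t u)//.
  - by rewrite -EFinB opprK addrC.
  - by apply: continuous_subspaceT; exact: continuous_id_std_normal.
  - split.
    + by move=> x _; have [] := is_derive_std_normal x.
    + apply: cvg_at_right_filter; apply: cvgN.
      by apply: continuous_normal_pdf; rewrite oner_eq0.
    + apply: cvg_at_left_filter; apply: cvgN.
      by apply: continuous_normal_pdf; rewrite oner_eq0.
  - by move=> x _; rewrite derive1E; have [_ ->] := is_derive_std_normal x.
rewrite mulrC EFinM -FTC -ge0_integralZl//; last 3 first.
- exact: measurable_id_std_normal.
- move=> x /=; rewrite in_itv/= => /andP[tx _].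
  by rewrite lee_fin mulr_ge0 ?normal_pdf_ge0// (le_trans t0).
- by rewrite lee_fin invr_ge0 ltW.
apply: ge0_le_integral => //.
- move=> x /=; rewrite in_itv/= => /andP[tx _].
  by rewrite -EFinM lee_fin !mulr_ge0 ?normal_pdf_ge0// ?invr_ge0 ?(ltW u0)// (le_trans t0).
- apply: emeasurable_funM => //; exact: measurable_id_std_normal.
- exact: measurable_std_normal_pdf.
- move=> x /=; rewrite in_itv/= => /andP[_ tx]; rewrite -EFinM lee_fin mulrA.
  by rewrite ler_piMl ?normal_pdf_ge0// mulrC ler_pdivrMr// mul1r ltW.
Qed.

Lemma normal_prob_itv_le (m s a b : R) : s != 0 -> a <= b ->
  (normal_prob m s `[a, b]%classic <= (normal_peak s * (b - a))%:E)%E.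
Proof.
move=> s0 ab.
apply: (@le_trans _ _ (\int[mu]_(x in `[a, b]) (normal_peak s)%:E)%E).
  apply: ge0_le_integral => //.
  - by move=> x _; rewrite lee_fin normal_pdf_ge0.
  - by apply/measurable_EFinP; apply: measurable_funTS; exact: measurable_normal_pdf.
  - by move=> x _; rewrite lee_fin normal_pdf_ub.
rewrite integral_cst//= lebesgue_measure_itv/= lte_fin.
have [_|] := ltP a b; first by rewrite -EFinB -EFinM.
by rewrite mule0 lee_fin mulr_ge0 ?normal_peak_ge0// subr_ge0.
Qed.

(** Symmetry of the density. This one half is the origin of the rate [2^-1] when [a = p]. *)
Lemma normal_prob_neg (s : R) : s != 0 ->
  normal_prob 0 s `]-oo, 0[%classic = (2^-1)%:E :> \bar R.
Proof.
move=> s0.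
have h : (2%:E * normal_prob 0%R s `[(0:R)%R, +oo[%classic = 1 :> \bar R)%E.
  rewrite -(@integral_normal_pdf R 0 s) [RHS]ge0_symfun_integralT//.
  - congr (_ * normal_prob _ _ _)%E; apply/seteqP; split => x/=;
      by rewrite in_itv/= andbT.
  - by move=> x; exact: normal_pdf_ge0.
  - exact: continuous_normal_pdf.
  - by move=> x; rewrite normal_pdfE// /normal_fun/= !subr0 sqrrN.
have -> : `]-oo, (0:R)[%classic = ~` `[(0:R), +oo[%classic.
  by rewrite setCitvr.
rewrite (@probability_setC _ _ _ (normal_prob 0 s))//.
have f : (normal_prob 0 s `[(0:R), +oo[%classic : \bar R) \is a fin_num.
  exact: (@fin_num_measure _ _ _ (normal_prob 0 s)).
rewrite -(fineK f) -EFinM in h; case: h => h.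
transitivity (1 - (2^-1)%:E : \bar R)%E; last by rewrite -EFinB; congr EFin; lra.
congr (1 - _)%E; apply: etrans (esym (fineK f)) _; congr EFin; lra.
Qed.

End gaussian_tail.

(** * Independence of blocks *)

Lemma bigcap_seqE (I : eqType) (T : Type) (s : seq I) (F : I -> set T) :
  \bigcap_(i in [set` s]) F i = \big[setI/setT]_(i <- s) F i.
Proof.
elim: s => [|i s IH]; first by rewrite big_nil; apply/seteqP; split.
rewrite big_cons -IH; apply/seteqP; split => x /=.
  move=> h; split; first by apply: h; rewrite /= mem_head.
  by move=> j js; apply: h; rewrite /= inE js orbT.
by move=> [Fi h] j; rewrite /= inE => /predU1P[->//|]; exact: h.
Qed.

Section independence.
Context d (T : measurableType d) (R : realType) (P : probability T R).

(** Dynkin's argument: for fixed [B], the measurable sets that factorize with [B] form a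
    lambda-system, and it contains the pi-system [G]. *)
Lemma independent_g_sigma_algebra (G : set_system T) (B : set T) :
  setI_closed G -> measurable B -> G `<=` measurable ->
  (forall A, G A -> P (A `&` B) = P A * P B)%E ->
  forall A, <<s G >> A -> (P (A `&` B) = P A * P B)%E.
Proof.
move=> GI mB Gm GB A GA.
pose H := [set A | measurable A /\ (P (A `&` B) = P A * P B)%E].
suff /(_ A GA) [] : <<s G >> `<=` H by [].
have PB : P B \is a fin_num by exact: fin_num_measure.
apply: lambda_system_subset => //; last first.
  by move=> X GX; split; [exact: Gm|exact: GB].
- apply/dynkin_lambda_system; split.
  + by split; rewrite ?setTI ?probability_setT ?mul1e.
  + move=> X [mX hX]; split; first exact: measurableC.
    rewrite setIC -setDE measureD//; last by rewrite ltey_eq PB.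
    rewrite [B `&` X]setIC [X in (_ - X)%E]hX probability_setC// muleBl ?mul1e//.
  + move=> F tF HF; have mF n : measurable (F n) by have [] := HF n.
    split; first exact: bigcupT_measurable.
    rewrite setI_bigcupl measure_bigcup//; last 2 first.
    * by move=> n _; exact: measurableI.
    * exact: trivIset_setIr.
    rewrite measure_bigcup// muleC -(fineK PB) -nneseriesZl//.
    apply: eq_eseriesr => n _; have [_ hn] := HF n.
    by apply: (etrans hn); rewrite muleC fineK.
Qed.

Lemma independent_systems_g_sigma (I : eqType) (F : I -> set_system T) :
  (forall i, setI_closed (F i)) -> (forall i, F i `<=` measurable) ->
  independent_systems P F -> independent_systems P (fun i => <<s F i >>).
Proof.
move=> FI Fm indF.
have sFm i A : <<s F i >> A -> measurable A.
  move: A; have h : <<s F i >> `<=` measurable; last by move=> A /h.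
  by apply: smallest_sub => //; exact: sigma_algebra_measurable.
(* Generators are enlarged one index at a time: sets indexed by [s1] range over the generated
   sigma-algebras, those indexed by [s2] still over the generators. *)
suff H (s1 s2 : seq I) : uniq (s1 ++ s2) -> forall E : I -> set T,
    (forall i, i \in s1 -> <<s F i >> (E i)) -> (forall i, i \in s2 -> F i (E i)) ->
    (P (\big[setI/setT]_(i <- s1 ++ s2) E i) = \prod_(i <- s1 ++ s2) P (E i))%E.
  move=> s us E FE; rewrite bigcap_seqE.
  by have := H s [::]; rewrite cats0; apply.
elim: s1 s2 => [|i s1 IH] s2 us E h1 h2.
  by rewrite /= -bigcap_seqE; exact: indF.
rewrite cat_cons !big_cons.
have /andP[iNs us'] : (i \notin s1 ++ s2) && uniq (s1 ++ s2) by [].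
have mB : measurable (\big[setI/setT]_(j <- s1 ++ s2) E j).
  rewrite big_seq; apply: bigsetI_measurable => j; rewrite mem_cat => /orP[js|js].
    by apply: (sFm j); apply: h1; rewrite inE js orbT.
  by apply: (Fm j); exact: h2.
have PB : (P (\big[setI/setT]_(j <- s1 ++ s2) E j) = \prod_(j <- s1 ++ s2) P (E j))%E.
  by apply: IH => // j js; apply: h1; rewrite inE js orbT.
rewrite -PB; apply: (@independent_g_sigma_algebra (F i)) => //; last first.
  by apply: h1; rewrite mem_head.
(* Index [i] goes back to the generator side, with [A] in place of [E i], where the induction
   hypothesis applies. *)
move=> A FA; pose E' j := if j == i then A else E j.
have E'E j : j \in s1 ++ s2 -> E' j = E j.
  by rewrite /E'; case: eqP => // ->; rewrite (negbTE iNs).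
have pe : perm_eq (s1 ++ i :: s2) (i :: s1 ++ s2) by rewrite -cat1s perm_catCA.
have := IH (i :: s2); rewrite (perm_uniq pe) => /(_ us E').
have E'i : E' i = A by rewrite /E' eqxx.
rewrite !(perm_big _ pe)/= !big_cons E'i.
rewrite (eq_big_seq E E'E) (eq_big_seq (fun j => P (E j))) => [->|j /E'E -> //].
- by rewrite PB.
- by move=> j js; rewrite E'E ?mem_cat ?js//; apply: h1; rewrite inE js orbT.
- move=> j; rewrite inE => /predU1P[->|js]; first by rewrite /E' eqxx.
  by rewrite E'E ?mem_cat ?js ?orbT//; apply: h2.
Qed.

Section grouping.
Context (I : finType) (J : eqType) (g : I -> J) d' (U : measurableType d').
Variable X : I -> T -> U.

(** Intersections over the whole block, rather than single preimages, make this a pi-system. *)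
Definition block_system (j : J) : set_system T :=
  [set A | exists2 B : I -> set U, forall i, measurable (B i) &
     A = \big[setI/setT]_(i | g i == j) (X i @^-1` B i)].

Lemma block_system_setI j : setI_closed (block_system j).
Proof.
move=> _ _ [B1 mB1 ->] [B2 mB2 ->].
exists (fun i => B1 i `&` B2 i); first by move=> i; exact: measurableI.
by rewrite -big_split; apply: eq_bigr.
Qed.

Lemma block_system_preimage i A : measurable A -> block_system (g i) (X i @^-1` A).
Proof.
move=> mA; exists (fun k => if k == i then A else setT).
  by move=> k; case: ifP.
rewrite (bigD1 i)//= eqxx big1 ?setIT// => k /andP[_ /negbTE ->].
by rewrite preimage_setT.
Qed.

Hypothesis mX : forall i, measurable_fun setT (X i).

Let mXB i B : measurable B -> measurable (X i @^-1` B).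
Proof. by move=> mB; rewrite -[X in measurable X]setTI; exact: mX. Qed.

Lemma block_system_measurable j : block_system j `<=` measurable.
Proof. by move=> _ [B mB ->]; apply: bigsetI_measurable => i _; exact: mXB. Qed.

Lemma independent_blocks : independent_family P X ->
  independent_systems P (fun j => <<s block_system j >>).
Proof.
move=> indX; apply: independent_systems_g_sigma.
- exact: block_system_setI.
- exact: block_system_measurable.
have indP (Q : pred I) (B : I -> set U) : (forall i, measurable (B i)) ->
    (P (\big[setI/setT]_(i | Q i) (X i @^-1` B i)) =
     \prod_(i | Q i) P (X i @^-1` B i))%E.
  move=> mB; rewrite -big_filter -[RHS]big_filter -bigcap_seqE.
  apply: indX; first by rewrite filter_uniq// index_enum_uniq.
  by move=> i _; exists (B i) => //; rewrite setTI.
move=> s us E FE.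
have /choice [B BE] : forall j, exists B : I -> set U, j \in s ->
    (forall i, measurable (B i)) /\
    E j = \big[setI/setT]_(i | g i == j) (X i @^-1` B i).
  move=> j; have [js|_] := boolP (j \in s); last by exists (fun=> setT).
  by have [B mB EB] := FE j js; exists B.
(* One family of sets indexed by [I] encodes all the blocks of [s]; indices outside these blocks are
   left unconstrained. *)
pose C i := if g i \in s then B (g i) i else setT.
have mC i : measurable (C i) by rewrite /C; case: ifPn => // /BE[].
have EC j : j \in s -> E j = \big[setI/setT]_(i | g i == j) (X i @^-1` C i).
  move=> js; have [_ ->] := BE j js; apply: eq_bigr => i /eqP gij.
  by rewrite /C gij js.
rewrite bigcap_seqE (eq_big_seq _ EC).
have -> : (\prod_(j <- s) P (E j) =
    \prod_(j <- s) \prod_(i | g i == j) P (X i @^-1` C i))%E.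
  by apply: eq_big_seq => j js; rewrite EC// indP.
(* Regrouping by blocks, stated for any commutative law since it serves for the intersection of
   events and for the product of probabilities. *)
have part (V : Type) (idx : V) (op : Monoid.com_law idx) (h : I -> V) :
    \big[op/idx]_(j <- s) \big[op/idx]_(i | g i == j) h i =
    \big[op/idx]_(i | g i \in s) h i.
  rewrite (exchange_big_dep xpredT)//= [RHS]big_mkcond/=; apply: eq_bigr => i _.
  under eq_bigl do rewrite eq_sym.
  case: ifPn => gis; first by rewrite -big_filter filter_pred1_uniq// big_seq1.
  by rewrite big_seq_cond big1// => j /andP[js /eqP ji]; rewrite -ji js in gis.
by rewrite part indP// part.
Qed.

End grouping.

End independence.

(** * Joint laws and events of pairs of variables *)

Section gaussian_pairs.
Context d (T : measurableType d) (R : realType) (P : probability T R).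
Local Notation gauss := (@normal_prob R 0 1).

Lemma measurable_pair_preimage (X Y : T -> R) (C : set (R * R)) :
  measurable_fun setT X -> measurable_fun setT Y -> measurable C ->
  measurable [set w | C (X w, Y w)].
Proof.
move=> mX mY mC.
have h : measurable_fun setT (fun w => (X w, Y w)) by exact: measurable_fun_pair.
by have := h measurableT C mC; rewrite setTI.
Qed.

Lemma independent_pair_law (X Y : T -> R) (m1 m2 : probability (measurableTypeR R) R) :
  measurable_fun setT X -> measurable_fun setT Y ->
  (forall A B : set R, measurable A -> measurable B ->
    P (X @^-1` A `&` Y @^-1` B) = m1 A * m2 B)%E ->
  forall C : set (R * R), measurable C -> (P [set w | C (X w, Y w)] = (m1 \x m2) C)%E.
Proof.
move=> mX mY XY C mC.
have mXY : @measurable_fun _ _ T (measurableTypeR R * measurableTypeR R)%type setT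
  (fun w => (X w, Y w)) by exact: measurable_fun_pair.
pose f : {mfun T >-> (measurableTypeR R * measurableTypeR R)%type} :=
  MeasurableFun.Pack (MeasurableFun.Class (isMeasurableFun.Build _ _ _ _ _ mXY)).
by rewrite (@product_measure_unique _ _ _ _ _ m1 m2
  (distribution P f : {measure set (measurableTypeR R * measurableTypeR R) -> \bar R})).
Qed.

Lemma gauss_set1 (x : R) : gauss [set x] = 0%E.
Proof.
apply/eqP; rewrite eq_le; apply/andP; split; last first.
  exact: (@measure_ge0 _ _ _ (normal_prob 0 1)).
have := @normal_prob_itv_le R 0 1 x x (oner_neq0 _) (lexx _).
by rewrite subrr mulr0 set_itv1.
Qed.

(** The sections of the diagonal are singletons, which are null for the Gaussian law, so the
    diagonal is null for the product law. *)
Lemma independent_gauss_neq (X Y : T -> R) :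
  measurable_fun setT X -> measurable_fun setT Y ->
  (forall A B : set R, measurable A -> measurable B ->
    P (X @^-1` A `&` Y @^-1` B) = gauss A * gauss B)%E ->
  P [set w | X w = Y w] = 0%E.
Proof.
move=> mX mY XY.
pose C := [set z : R * R | z.1 = z.2].
have mC : measurable C.
  have -> : C = (fun z : R * R => z.1 - z.2) @^-1` [set 0].
    by apply/seteqP; split => z /=; [move=> ->; rewrite subrr|move/subr0_eq].
  rewrite -[X in measurable X]setTI.
  have m : measurable_fun setT (fun z : R * R => z.1 - z.2) by exact: measurable_funB.
  exact: m.
rewrite (@independent_pair_law X Y (normal_prob 0 1) (normal_prob 0 1) mX mY XY C mC).
rewrite /product_measure1 integral0_eq// => x _ /=.
rewrite (_ : xsection C x = [set x]) ?gauss_set1//.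
apply/seteqP; split => y; rewrite /xsection /= inE /C/=; exact: esym.
Qed.

Lemma rotated_pair_law (c s : R) (X Y : T -> R) (A B : set R) :
  0 < s -> c ^+ 2 + s ^+ 2 = 1 ->
  measurable_fun setT X -> measurable_fun setT Y ->
  (forall A B : set R, measurable A -> measurable B ->
    P (X @^-1` A `&` Y @^-1` B) = gauss A * gauss B)%E ->
  measurable A -> measurable B ->
  (P [set w | A (c * X w + s * Y w)%R /\ B (X w - c * (c * X w + s * Y w))%R] =
   gauss A * normal_prob 0%R s B)%E.
Proof.
move=> s0 cs1 mX mY XY mA mB.
rewrite -(gaussian_rotation (c := c))//.
have mxi : measurable_fun setT (fun z : R * R => c * z.1 + s * z.2).
  by apply: measurable_funD; apply: measurable_funM.
have mv : measurable_fun setT (fun z : R * R => z.1 - c * (c * z.1 + s * z.2)).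
  by apply: measurable_funB => //; apply: measurable_funM.
rewrite -(@independent_pair_law X Y (normal_prob 0 1) (normal_prob 0 1) mX mY XY)//.
have -> : [set z : R * R | A (c * z.1 + s * z.2) /\ B (z.1 - c * (c * z.1 + s * z.2))]
  = (fun z : R * R => c * z.1 + s * z.2) @^-1` A `&`
    (fun z : R * R => z.1 - c * (c * z.1 + s * z.2)) @^-1` B by [].
by apply: measurableI; rewrite -[X in measurable X]setTI; [exact: mxi|exact: mv].
Qed.

(** The planar sets whose preimage lies in the sigma-algebra form a sigma-algebra containing all
    rectangles. *)
Lemma g_sigma_pair (G : set_system T) (X Y : T -> R) :
  (forall A, measurable A -> G (X @^-1` A)) ->
  (forall A, measurable A -> G (Y @^-1` A)) ->
  forall C : set (R * R), measurable C -> <<s G >> [set w | C (X w, Y w)].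
Proof.
move=> GX GY C.
rewrite measurable_prod_measurableType => mC.
have /sigma_algebraP[//|_ _ _ sI] := @smallest_sigma_algebra _ setT G.
pose H := [set C : set (R * R) | <<s G >> [set w | C (X w, Y w)]].
suff h : <<s [set A `*` B | A in measurable & B in measurable] >> `<=` H by exact: h.
apply: smallest_sub.
  have [h0 hC hU] := @smallest_sigma_algebra _ setT G.
  split.
  - exact: h0.
  - by move=> A HA; have := hC _ HA; congr (<<s G >> _); apply/seteqP; split.
  - by move=> F HF; have := hU _ HF; congr (<<s G >> _); apply/seteqP; split.
move=> _ [A mA] [B mB] <-; rewrite /H/=.
apply: (sI (X @^-1` A) (Y @^-1` B)).
  by apply: sub_sigma_algebra; exact: GX.
by apply: sub_sigma_algebra; exact: GY.
Qed.

Lemma g_sigma_bigsetI (G : set_system T) (I : Type) (s : seq I) (Q : pred I) (F : I -> set T) :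
  (forall i, Q i -> <<s G >> (F i)) -> <<s G >> (\big[setI/setT]_(i <- s | Q i) F i).
Proof.
move=> GF; have /sigma_algebraP[//|gT _ _ sI] := @smallest_sigma_algebra _ setT G.
by elim/big_ind : _.
Qed.

End gaussian_pairs.

(** * Independence of the first-level blocks *)

Section grem_blocks.
Context d (T : measurableType d) (R : realType) (P : probability T R).
Context (S1 S2 : finType) (X1 : S1 -> T -> R) (X2 : S1 * S2 -> T -> R).
Local Notation gauss := (@normal_prob R 0 1).

(** Counterpart of [joint_family] for arbitrary finite index sets, convertible to it on spin
    configurations. *)
Definition grem_family (i : S1 + S1 * S2) : T -> R :=
  match i with inl s1 => X1 s1 | inr s => X2 s end.

Hypothesis mX1 : forall s1, measurable_fun setT (X1 s1).
Hypothesis mX2 : forall s, measurable_fun setT (X2 s).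
Hypothesis lX1 : forall s1 A, measurable A -> P (X1 s1 @^-1` A) = gauss A.
Hypothesis lX2 : forall s A, measurable A -> P (X2 s @^-1` A) = gauss A.
Hypothesis ind : independent_family P grem_family.

Let mfam i : measurable_fun setT (grem_family i).
Proof. by case: i. Qed.

Let lfam i A : measurable A -> P (grem_family i @^-1` A) = gauss A.
Proof. by case: i => i mA; rewrite /= ?lX1 ?lX2. Qed.

Lemma grem_family_pair i j (A B : set R) : i != j -> measurable A -> measurable B ->
  (P (grem_family i @^-1` A `&` grem_family j @^-1` B) = gauss A * gauss B)%E.
Proof.
move=> ij mA mB.
have := @ind [:: i; j]; rewrite /= inE ij => /(_ isT).
move=> /(_ (fun k => if k == i then grem_family i @^-1` A else grem_family j @^-1` B)).
rewrite bigcap_seqE !big_cons !big_nil eqxx eq_sym (negbTE ij) setIT mule1.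
rewrite !lfam//; apply => k.
rewrite !inE => /orP[|] /eqP ->; rewrite ?eqxx.
  by exists A => //; rewrite setTI.
by rewrite eq_sym (negbTE ij); exists B => //; rewrite setTI.
Qed.

Lemma X1_X2_pair s (A B : set R) : measurable A -> measurable B ->
  (P (X1 s.1 @^-1` A `&` X2 s @^-1` B) = gauss A * gauss B)%E.
Proof. exact: (@grem_family_pair (inl s.1) (inr s)). Qed.

Definition first_level (i : S1 + S1 * S2) : S1 :=
  match i with inl s1 => s1 | inr s => s.1 end.

Lemma block_pair s (C : set (R * R)) : measurable C ->
  <<s block_system first_level grem_family s.1 >> [set w | C (X1 s.1 w, X2 s w)].
Proof.
apply: g_sigma_pair => A mA.
  exact: (@block_system_preimage _ _ _ _ first_level _ _ grem_family (inl s.1)).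
exact: (@block_system_preimage _ _ _ _ first_level _ _ grem_family (inr s)).
Qed.

Lemma grem_blocks_prod (C : S1 -> S2 -> set (R * R)) :
  (forall s1 s2, measurable (C s1 s2)) ->
  (P (\big[setI/setT]_s1 \big[setI/setT]_s2 [set w | C s1 s2 (X1 s1 w, X2 (s1, s2) w)]) =
   \prod_s1 P (\big[setI/setT]_s2 [set w | C s1 s2 (X1 s1 w, X2 (s1, s2) w)]))%E.
Proof.
move=> mC; have := @independent_blocks _ _ _ P _ _ first_level _ _ _ mfam ind.
move=> /(_ (index_enum S1) (index_enum_uniq _)); rewrite -bigcap_seqE; apply => s1 _.
by apply: g_sigma_bigsetI => s2 _; exact: (@block_pair (s1, s2)).
Qed.

(** Grouping the variables by whether the index is [inr (s.1, s2)] isolates that variable in one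
    block; both coordinates of the pair fall in the other. *)
Lemma pair_indep_second s s2 (C : set (R * R)) (B : set R) : s2 != s.2 ->
  measurable C -> measurable B ->
  (P ([set w | C (X1 s.1 w, X2 s w)] `&` X2 (s.1, s2) @^-1` B) =
   P [set w | C (X1 s.1 w, X2 s w)] * gauss B)%E.
Proof.
move=> s2s mC mB; pose g (i : S1 + S1 * S2) := i == inr (s.1, s2).
have := @independent_blocks _ _ _ P _ _ g _ _ _ mfam ind.
move=> /(_ [:: false; true] isT
  (fun b => if b then X2 (s.1, s2) @^-1` B else [set w | C (X1 s.1 w, X2 s w)])).
rewrite bigcap_seqE !big_cons !big_nil setIT mule1 lX2//; apply => -[_|_].
  have <- : g (inr (s.1, s2)) = true by rewrite /g eqxx.
  apply: sub_sigma_algebra.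
  exact: (@block_system_preimage _ _ _ _ g _ _ grem_family (inr (s.1, s2))).
apply: g_sigma_pair => // A mA.
  exact: (@block_system_preimage _ _ _ _ g _ _ grem_family (inl s.1)).
have <- : g (inr s) = false.
  by apply/eqP; case=> /esym; case: (s) s2s => s1 s2' /= + [e]; rewrite e eqxx.
exact: (@block_system_preimage _ _ _ _ g _ _ grem_family (inr s)).
Qed.

Variables c s : R.
Hypotheses (c0 : 0 < c) (s0 : 0 < s) (cs1 : c ^+ 2 + s ^+ 2 = 1).

Definition energy (t : S1 * S2) (w : T) : R := c * X1 t.1 w + s * X2 t w.

Lemma measurable_energy t : measurable_fun setT (energy t).
Proof. by apply: measurable_funD; apply: measurable_funM. Qed.

Lemma energy_law t (A B : set R) : measurable A -> measurable B ->
  (P [set w | A (energy t w) /\ B (X1 t.1 w - c * energy t w)%R] =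
   gauss A * normal_prob 0%R s B)%E.
Proof. by move=> mA mB; apply: rotated_pair_law => // *; exact: X1_X2_pair. Qed.

Lemma energy_gauss t A : measurable A -> P (energy t @^-1` A) = gauss A.
Proof.
move=> mA; have := energy_law t mA measurableT.
rewrite (@probability_setT _ _ _ (normal_prob 0 s)) mule1 => <-.
by congr (P _); apply/seteqP; split => w //= -[].
Qed.

(** With a common first half the first-level term cancels and two second-level variables are
    compared; otherwise the energies live on independent blocks. *)
Lemma energy_neq t u : t != u -> P [set w | energy t w = energy u w] = 0%E.
Proof.
move=> tu; have [e1|n1] := eqVneq t.1 u.1.
  have -> : [set w | energy t w = energy u w] = [set w | X2 t w = X2 u w].
    apply/seteqP; split => w /=; rewrite /energy e1; last by move=> ->.
    by move/addrI/mulfI; apply; rewrite gt_eqF.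
  apply: independent_gauss_neq => // A B; exact: (@grem_family_pair (inr t) (inr u)).
apply: independent_gauss_neq; [exact: measurable_energy..|] => A B mA mB.
have := @independent_blocks _ _ _ P _ _ first_level _ _ _ mfam ind.
move=> /(_ [:: t.1; u.1]); rewrite /= inE n1 => /(_ isT).
move=> /(_ (fun k => if k == t.1 then energy t @^-1` A else energy u @^-1` B)).
rewrite bigcap_seqE !big_cons !big_nil eqxx eq_sym (negbTE n1) setIT mule1.
rewrite !energy_gauss//; apply => k.
have mC (D : set R) : measurable D -> measurable [set z : R * R | D (c * z.1 + s * z.2)].
  move=> mD; rewrite -[X in measurable X]setTI.
  have m : measurable_fun setT (fun z : R * R => c * z.1 + s * z.2).
    by apply: measurable_funD; apply: measurable_funM.
  exact: m.
rewrite !inE => /orP[|] /eqP ->; rewrite ?eqxx.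
  exact: (@block_pair t _ (mC A mA)).
by rewrite eq_sym (negbTE n1); exact: (@block_pair u _ (mC B mB)).
Qed.

End grem_blocks.

(** * The event describing the top configurations *)

(** The values of [t] followed by the remaining configurations in the order of [s] form a strictly
    sorted list with the same elements as [s], and such a list is unique. *)
Lemma top_of_sorted (R : realType) (C : finType) (x : C -> R) (s : seq C) (k : nat)
    (t : 'I_k -> C) (x0 : R) (c0 : C) :
  perm_eq s (enum C) -> sorted (fun u v => x v < x u) s ->
  (forall l m : 'I_k, (l < m)%N -> x (t m) < x (t l)) ->
  (forall l, x0 <= x (t l)) -> (forall u, u \notin codom t -> x u < x0) ->
  forall l : 'I_k, nth c0 s l = t l.
Proof.
move=> pe so tlt tx0 ux0.
pose r : rel C := fun u v => x v < x u.
have rtr : transitive r by move=> u v w vu uw; exact: lt_trans uw vu.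
have rirr : irreflexive r by move=> u; rewrite /r ltxx.
have sc : sorted r (codom t).
  rewrite codomE sorted_map.
  have : sorted (relpre val ltn) (enum 'I_k).
    by have := iota_ltn_sorted 0 k; rewrite -val_enum_ord sorted_map.
  apply: sub_sorted => l m /= lm; exact: tlt.
pose rest := [seq u <- s | u \notin codom t].
have sE : s = codom t ++ rest.
  apply: (irr_sorted_eq rtr rirr) => //.
    rewrite sorted_pairwise// pairwise_cat -!sorted_pairwise// sc sorted_filter//= andbT.
    apply/allrelP => u v /codomP[l ->]; rewrite mem_filter => /andP[vt _].
    exact: lt_le_trans (ux0 _ vt) (tx0 _).
  move=> u; rewrite mem_cat mem_filter (perm_mem pe) mem_enum inE andbT.
  by rewrite orbN.
move=> l; rewrite sE nth_cat size_codom card_ord ltn_ord codomE.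
by rewrite (nth_map l) ?size_enum_ord// nth_ord_enum.
Qed.

(** Sorting for the weak order gives existence: without ties the weak order is strict on distinct
    entries. Uniqueness holds because the strict order is irreflexive and transitive. *)
Lemma ranking_exists_unique (R : realType) (C : finType) (x : C -> R) : injective x ->
  exists! s : seq C, perm_eq s (enum C) && sorted (fun t v => x v < x t) s.
Proof.
move=> injx; pose r : rel C := fun u v => x v < x u.
have rtr : transitive r by move=> u v w vu uw; exact: lt_trans uw vu.
have rirr : irreflexive r by move=> u; rewrite /r ltxx.
pose e : rel C := fun u v => x v <= x u.
have etr : transitive e by move=> u v w vu uw; exact: le_trans uw vu.
have etot : total e by move=> u v; exact: le_total.
exists (sort e (enum C)); split.
  rewrite perm_sort perm_refl /=.
  have u : uniq (sort e (enum C)) by rewrite sort_uniq enum_uniq.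
  have := sort_sorted etot (enum C); rewrite !sorted_pairwise// => so.
  move: u; rewrite uniq_pairwise => u.
  have := conj so u => /andP; rewrite -pairwise_relI; apply: sub_pairwise => a b /=.
  by rewrite /e lt_neqAle => /andP[-> ab]; rewrite andbT (inj_eq injx) eq_sym.
move=> s /andP[pe so]; apply: (irr_sorted_eq rtr rirr) => //.
  have u : uniq (sort e (enum C)) by rewrite sort_uniq enum_uniq.
  have := sort_sorted etot (enum C); rewrite !sorted_pairwise// => so'.
  move: u; rewrite uniq_pairwise => u.
  have := conj so' u => /andP; rewrite -pairwise_relI; apply: sub_pairwise => a b /=.
  by rewrite /e /r lt_neqAle => /andP[-> ab]; rewrite andbT (inj_eq injx) eq_sym.
by move=> u; rewrite mem_sort (perm_mem pe).
Qed.

Lemma sumEFin_const (R : realType) (I : finType) (r : R) :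
  (\sum_(i : I) r%:E = (#|I|%:R * r)%:E)%E.
Proof. by rewrite sumEFin sumr_const mulr_natl. Qed.

Section finite_unions.
Context d (T : measurableType d) (R : realType) (P : {measure set T -> \bar R}).
Context (I : finType).

Lemma measure_bigsetU_le (A : I -> set T) (Q : pred I) :
  (forall i, measurable (A i)) ->
  (P (\big[setU/set0]_(i | Q i) A i) <= \sum_(i | Q i) P (A i))%E.
Proof.
move=> mA.
have H (s : seq I) : measurable (\big[setU/set0]_(i <- s | Q i) A i) /\
    (P (\big[setU/set0]_(i <- s | Q i) A i) <= \sum_(i <- s | Q i) P (A i))%E.
  elim: s => [|i s [mU IH]]; first by rewrite !big_nil measure0.
  rewrite !big_cons; case: ifPn => // _; split; first exact: measurableU.
  by apply: le_trans (measureU2 _ _ _) _ => //; exact: leeD.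
exact: (H _).2.
Qed.

Lemma measure_bigsetU_fin (A : I -> set T) (Q : pred I) :
  (forall i, measurable (A i)) ->
  (forall i j w, Q i -> Q j -> A i w -> A j w -> i = j) ->
  (P (\big[setU/set0]_(i | Q i) A i) = \sum_(i | Q i) P (A i))%E.
Proof.
move=> mA tA.
have H (s : seq I) : uniq s -> measurable (\big[setU/set0]_(i <- s | Q i) A i) /\
    (P (\big[setU/set0]_(i <- s | Q i) A i) = \sum_(i <- s | Q i) P (A i))%E.
  elim: s => [|i s IH /= /andP[is_ us]]; first by rewrite !big_nil measure0.
  have [mU {}IH] := IH us.
  rewrite !big_cons; case: ifPn => // Qi; split; first exact: measurableU.
  rewrite measureU//; first by congr (_ + _)%E.
  rewrite -subset0 => w [Aiw]; rewrite -bigcup_seq_cond => -[j /= /andP[js Qj] Ajw].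
  by move: is_; rewrite (tA i j w)// js.
exact: (H _ (index_enum_uniq _)).2.
Qed.

End finite_unions.

(** * Probability bounds within one block *)

Section block_events.
Context d (T : measurableType d) (R : realType) (P : probability T R).
Context (S1 S2 : finType) (X1 : S1 -> T -> R) (X2 : S1 * S2 -> T -> R).
Local Notation gauss := (@normal_prob R 0 1).
Hypothesis mX1 : forall s1, measurable_fun setT (X1 s1).
Hypothesis mX2 : forall s, measurable_fun setT (X2 s).
Hypothesis lX1 : forall s1 A, measurable A -> P (X1 s1 @^-1` A) = gauss A.
Hypothesis lX2 : forall s A, measurable A -> P (X2 s @^-1` A) = gauss A.
Hypothesis ind : independent_family P (grem_family X1 X2).
Variables c s : R.
Hypotheses (c0 : 0 < c) (s0 : 0 < s) (cs1 : c ^+ 2 + s ^+ 2 = 1).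
Local Notation energy := (energy X1 X2 c s).
Local Notation n1 := #|S1|.
Local Notation n2 := #|S2|.

Let menergy t : measurable_fun setT (energy t).
Proof. exact: measurable_energy. Qed.

Let menergyB t B : measurable B -> measurable (energy t @^-1` B).
Proof. by move=> mB; rewrite -[X in measurable X]setTI; exact: menergy. Qed.

Let mX1B t B : measurable B -> measurable (X1 t @^-1` B).
Proof. by move=> mB; rewrite -[X in measurable X]setTI; exact: mX1. Qed.

Let mX2B t B : measurable B -> measurable (X2 t @^-1` B).
Proof. by move=> mB; rewrite -[X in measurable X]setTI; exact: mX2. Qed.

(** Events are encoded as planar sets for the pair of first- and second-level variables, so that
    [block_pair] places them in the sigma-algebra of one block. *)
Definition low (x : R) : set (R * R) := [set z | c * z.1 + s * z.2 < x].

Definition box_pre (I J : set R) : set (R * R) :=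
  [set z | I (c * z.1 + s * z.2) /\ J z.1].

Lemma measurable_low x : measurable (low x).
Proof.
have m : measurable_fun setT (fun z : R * R => c * z.1 + s * z.2).
  by apply: measurable_funD; apply: measurable_funM.
rewrite /low; have -> : [set z : R * R | c * z.1 + s * z.2 < x] =
    (fun z : R * R => c * z.1 + s * z.2) @^-1` `]-oo, x[.
  by apply/seteqP; split => z; rewrite /= in_itv.
by rewrite -[X in measurable X]setTI; exact: m.
Qed.

Lemma measurable_box_pre I J : measurable I -> measurable J -> measurable (box_pre I J).
Proof.
have m : measurable_fun setT (fun z : R * R => c * z.1 + s * z.2).
  by apply: measurable_funD; apply: measurable_funM.
move=> mI mJ; have -> : box_pre I J =
    (fun z : R * R => c * z.1 + s * z.2) @^-1` I `&` (fun z : R * R => z.1) @^-1` J by [].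
apply: measurableI; rewrite -[X in measurable X]setTI; first exact: m.
by have m1 : measurable_fun setT (fun z : R * R => z.1); [exact: measurable_fst|exact: m1].
Qed.

(** Union bound: the block fails to be low only if its first-level variable leaves [Z], or stays in
    [Z] while one of the [n2] energies reaches [x]. *)
Lemma empty_block_ge (s1 : S1) (x : R) (Z : set R) (q0 q1 : R) : measurable Z ->
  (gauss (~` Z) <= q0%:E)%E ->
  (forall s2, P [set w | (x <= energy (s1, s2) w)%R /\ Z (X1 s1 w)] <= q1%:E)%E ->
  ((1 - (n2%:R * q1 + q0))%:E <=
   P (\big[setI/setT]_s2 [set w | low x (X1 s1 w, X2 (s1, s2) w)]))%E.
Proof.
move=> mZ hq0 hq1.
set B := \big[setI/setT]_s2 _.
have mlow s2 : measurable [set w | low x (X1 s1 w, X2 (s1, s2) w)].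
  by apply: measurable_pair_preimage => //; exact: measurable_low.
have mB : measurable B by exact: bigsetI_measurable.
pose A s2 := [set w | (x <= energy (s1, s2) w) /\ Z (X1 s1 w)].
have mA s2 : measurable (A s2).
  have -> : A s2 = energy (s1, s2) @^-1` `[x, +oo[ `&` X1 s1 @^-1` Z.
    by apply/seteqP; split => w /=; rewrite in_itv/= andbT.
  by apply: measurableI; [exact: menergyB|exact: mX1B].
have : (P (B `|` ((X1 s1 @^-1` ~` Z) `|` \big[setU/set0]_s2 A s2)) = 1)%E.
  rewrite -(@probability_setT _ _ _ P); congr (P _); apply/seteqP; split => // w _.
  have [Zw|nZw] := pselect (Z (X1 s1 w)); last by right; left.
  have [[s2 xs2]|h] := pselect (exists s2, x <= energy (s1, s2) w).
    by right; right; rewrite -bigcup_seq; exists s2 => //=; rewrite mem_index_enum.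
  left; rewrite /B -bigcap_seq => s2 _; rewrite /low/= ltNge; apply/negP => xs2.
  by apply: h; exists s2.
move=> h; have : (1%:E <= P B + (q0%:E + (n2%:R * q1)%:E))%E.
  rewrite -h; apply: le_trans (measureU2 _ _ _) _ => //.
    apply: measurableU; first by apply: mX1B; exact: measurableC.
    exact: bigsetU_measurable.
  rewrite leeD2l//; apply: le_trans (measureU2 _ _ _) _ => //.
  - by apply: mX1B; exact: measurableC.
  - exact: bigsetU_measurable.
  apply: leeD; first by apply: le_trans hq0; rewrite -(lX1 s1 (measurableC mZ)).
  apply: le_trans (measure_bigsetU_le _ _ _) _ => //.
  apply: (@le_trans _ _ (\sum_(s2 : S2) q1%:E)%E).
    by apply: lee_sum => s2 _; exact: hq1.
  by rewrite sumEFin_const.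
have PB : P B \is a fin_num by exact: fin_num_measure.
by rewrite -(fineK PB) -!EFinD !lee_fin => ?; lra.
Qed.

(** On the target event the first-level variable is below [de], so another energy of the block
    reaches [x] only if its second-level variable reaches [(x - c * de) / s]. That variable is
    independent of the target event, so the union bound is relative to it. The maximum with 0 keeps
    the bound nonnegative. *)
Lemma target_block_ge (t : S1 * S2) (x al al' ga de q pi : R) :
  x <= al -> (gauss `[((x - c * de) / s)%R, +oo[%classic <= q%:E)%E ->
  0 <= pi -> (pi%:E <= P [set w | `[al, al'[%classic (energy t w) /\
                          `[ga, de[%classic (X1 t.1 w)])%E ->
  ((pi * Num.max 0 (1 - n2%:R * q))%:E <=
   P (\big[setI/setT]_s2 [set w | (if s2 == t.2 then box_pre `[al, al'[ `[ga, de[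
       else low x) (X1 t.1 w, X2 (t.1, s2) w)]))%E.
Proof.
move=> xal hq pi0 hpi.
set B := \big[setI/setT]_s2 _.
have mbox : measurable (box_pre `[al, al'[ `[ga, de[) by exact: measurable_box_pre.
have mC s2 : measurable (if s2 == t.2 then box_pre `[al, al'[ `[ga, de[ else low x).
  by case: ifP => // _; exact: measurable_low.
have mB : measurable B.
  by apply: bigsetI_measurable => s2 _; exact: measurable_pair_preimage.
have [le0|gt0] := leP (1 - n2%:R * q) 0.
  by rewrite mulr0.
pose tgt := [set w | box_pre `[al, al'[ `[ga, de[ (X1 t.1 w, X2 t w)].
have mtgt : measurable tgt by exact: measurable_pair_preimage.
have {}hpi : (pi%:E <= P tgt)%E by exact: hpi.
pose A s2 := tgt `&` X2 (t.1, s2) @^-1` `[(x - c * de) / s, +oo[.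
have mA s2 : measurable (A s2) by apply: measurableI => //; exact: mX2B.
have sub : tgt `<=` B `|` \big[setU/set0]_(s2 | s2 != t.2) A s2.
  move=> w tw.
  have [[s2 /andP[s2t hs2]]|h] := pselect (exists s2, (s2 != t.2) && (x <= energy (t.1, s2) w)).
    right; rewrite -bigcup_seq_cond; exists s2; first by rewrite /= mem_index_enum.
    split=> //=; rewrite in_itv/= andbT.
    move: tw hs2; rewrite /tgt /box_pre /energy /= !in_itv/= => -[_ /andP[_ xde]] hs2.
    have : c * X1 t.1 w <= c * de by rewrite ler_pM2l// ltW.
    by rewrite ler_pdivrMr//; lra.
  left; rewrite /B -bigcap_seq => s2 _ /=; case: ifPn => [/eqP ->|s2t].
    by rewrite -surjective_pairing.
  rewrite /low/= ltNge; apply/negP => xs2.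
  by apply: h; exists s2; rewrite s2t.
have q0 : 0 <= q.
  by rewrite -lee_fin; apply: le_trans hq; exact: (@measure_ge0 _ _ _ (normal_prob 0 1)).
have Pt : P tgt \is a fin_num by exact: fin_num_measure.
have PB : P B \is a fin_num by exact: fin_num_measure.
have : (P tgt <= P B + (n2%:R * (fine (P tgt) * q))%:E)%E.
  apply: (@le_trans _ _ (P (B `|` \big[setU/set0]_(s2 | s2 != t.2) A s2))).
    by apply: le_measure => //; rewrite inE//; apply: measurableU => //;
      exact: bigsetU_measurable.
  apply: le_trans (measureU2 _ _ _) _ => //; first exact: bigsetU_measurable.
  rewrite leeD2l//; apply: le_trans (measure_bigsetU_le _ _ _) _ => //.
  apply: (@le_trans _ _ (\sum_(s2 | s2 != t.2) (fine (P tgt) * q)%:E)%E).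
    apply: lee_sum => s2 s2t.
    have e := pair_indep_second mX1 mX2 lX2 ind s2t mbox
      (measurable_itv `[((x - c * de) / s), +oo[).
    apply: (@le_trans _ _ (P tgt * gauss `[((x - c * de) / s)%R, +oo[%classic)%E).
      by rewrite -e /A /tgt.
    by rewrite EFinM fineK// lee_wpmul2l.
  rewrite big_mkcond/=; apply: (@le_trans _ _ (\sum_(s2 : S2) (fine (P tgt) * q)%:E)%E).
    apply: lee_sum => s2 _; case: ifPn => // _.
    by rewrite lee_fin mulr_ge0// fine_ge0.
  by rewrite sumEFin_const.
move: hpi; rewrite -(fineK Pt) -(fineK PB) -EFinD !lee_fin => h1 h2.
by apply: (@le_trans _ _ (fine (P tgt) * (1 - n2%:R * q))); [rewrite ler_pM2r|nra].
Qed.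

End block_events.

(** * Probability of the top event *)

Section top_event.
Context d (T : measurableType d) (R : realType) (P : probability T R).
Context (S1 S2 : finType) (X1 : S1 -> T -> R) (X2 : S1 * S2 -> T -> R).
Local Notation gauss := (@normal_prob R 0 1).
Hypothesis mX1 : forall s1, measurable_fun setT (X1 s1).
Hypothesis mX2 : forall s, measurable_fun setT (X2 s).
Hypothesis lX1 : forall s1 A, measurable A -> P (X1 s1 @^-1` A) = gauss A.
Hypothesis lX2 : forall s A, measurable A -> P (X2 s @^-1` A) = gauss A.
Hypothesis ind : independent_family P (grem_family X1 X2).
Variables c s : R.
Hypotheses (c0 : 0 < c) (s0 : 0 < s) (cs1 : c ^+ 2 + s ^+ 2 = 1).
Local Notation energy := (energy X1 X2 c s).
Local Notation n1 := #|S1|.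
Local Notation n2 := #|S2|.
Variables (k : nat) (x : R) (al al' ga de : 'I_k -> R).
Hypothesis xal : forall l, x <= al l.
Hypothesis alal : forall l m : 'I_k, (l < m)%N -> al' m <= al l.

Let Ft := ({ffun 'I_k -> S1} * {ffun 'I_k -> S2})%type.

Definition top_pre (f : Ft) (u : S1 * S2) : set (R * R) :=
  if [pick l | (f.1 l, f.2 l) == u] is Some l
  then box_pre c s `[al l, al' l[ `[ga l, de l[ else low c s x.

(* [f] selects [k] configurations with pairwise distinct first halves; the
   [l]-th one lies in the [l]-th cell and all other energies lie below [x].
   Top configurations sharing a first half are neglected: this makes the event
   a product over independent blocks, and costs nothing in the limit. *)
Definition top_event1 (f : Ft) : set T :=
  \big[setI/setT]_s1 \big[setI/setT]_s2
    [set w | top_pre f (s1, s2) (X1 s1 w, X2 (s1, s2) w)].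

Definition top_event : set T :=
  \big[setU/set0]_(f : Ft | injectiveb f.1) top_event1 f.

Lemma measurable_top_pre f u : measurable (top_pre f u).
Proof.
rewrite /top_pre; case: pickP => [l _|_]; last exact: measurable_low.
exact: measurable_box_pre.
Qed.

Lemma measurable_top_event1 f : measurable (top_event1 f).
Proof.
apply: bigsetI_measurable => s1 _; apply: bigsetI_measurable => s2 _.
by apply: measurable_pair_preimage => //; exact: measurable_top_pre.
Qed.

Lemma measurable_top_event : measurable top_event.
Proof. by apply: bigsetU_measurable => f _; exact: measurable_top_event1. Qed.

Lemma top_event1P (f : Ft) w : injective f.1 -> top_event1 f w ->
  (forall l, `[al l, al' l[%classic (energy (f.1 l, f.2 l) w) /\
             `[ga l, de l[%classic (X1 (f.1 l) w)) /\
  (forall u, u \notin codom (fun l => (f.1 l, f.2 l)) -> energy u w < x).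
Proof.
move=> injf; rewrite /top_event1 -bigcap_seq => h.
have {}h u : top_pre f u (X1 u.1 w, X2 u w).
  have := h u.1 (mem_index_enum _); rewrite -bigcap_seq => /(_ u.2 (mem_index_enum _)).
  by rewrite /= -surjective_pairing.
split=> [l|u uf].
  have := h (f.1 l, f.2 l); rewrite /top_pre; case: pickP => [m /eqP[ml _]|/(_ l)].
    by rewrite (injf _ _ ml).
  by rewrite eqxx.
have := h u; rewrite /top_pre; case: pickP => // l /eqP lu.
by move: uf; rewrite -lu => /negP[]; apply/codomP; exists l.
Qed.

(** Energies selected by [g] are at least [x], hence selected by [f] as well; the cells being
    disjoint, the energy determines the rank. This disjointness lets the probabilities in
    [top_event_ge] add up. *)
Lemma top_event1_inj (f g : Ft) w : injective f.1 -> injective g.1 ->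
  top_event1 f w -> top_event1 g w -> f = g.
Proof.
move=> fi gi /(top_event1P fi)[hf lf] /(top_event1P gi)[hg lg].
have key l : (f.1 l, f.2 l) = (g.1 l, g.2 l).
  have [gl _] := hg l.
  have xl : x <= energy (g.1 l, g.2 l) w.
    by move: gl; rewrite /= in_itv/= => /andP[+ _]; exact: le_trans.
  have [/codomP[m gm]|/lf] := boolP ((g.1 l, g.2 l) \in codom (fun l => (f.1 l, f.2 l))).
    have [fm _] := hf m.
    move: gl fm; rewrite gm /= !in_itv/= => /andP[a1 a2] /andP[b1 b2].
    case: (ltngtP l m) => [lm|ml|/val_inj -> //].
      by have := lt_le_trans b2 (le_trans (alal lm) a1); rewrite ltxx.
    by have := lt_le_trans a2 (le_trans (alal ml) b1); rewrite ltxx.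
  by rewrite ltNge xl.
by case: f g {hf lf hg lg fi gi} key => f1 f2 [g1 g2] /= key;
  congr pair; apply/ffunP => l; have [] := key l.
Qed.

Lemma top_eventP w : top_event w -> exists t : 'I_k -> S1 * S2,
  (forall l, `[al l, al' l[%classic (energy (t l) w) /\
             `[ga l, de l[%classic (X1 (t l).1 w)) /\
  (forall u, u \notin codom t -> energy u w < x).
Proof.
rewrite /top_event -bigcup_seq_cond => -[f /= /andP[_ /injectiveP fi]].
by move=> /(top_event1P fi) h; exists (fun l => (f.1 l, f.2 l)).
Qed.

Variables (q pi : 'I_k -> R) (Z : set R) (q0 q1 y : R).
Hypothesis hq : forall l, (gauss `[((x - c * de l) / s)%R, +oo[%classic <= (q l)%:E)%E.
Hypothesis pi0 : forall l, 0 <= pi l.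
Hypothesis hpi : forall l t,
  ((pi l)%:E <= P [set w | `[al l, al' l[%classic (energy t w) /\
                          `[ga l, de l[%classic (X1 t.1 w)])%E.
Hypothesis mZ : measurable Z.
Hypothesis hq0 : (gauss (~` Z) <= q0%:E)%E.
Hypothesis hq1 : forall t, (P [set w | (x <= energy t w)%R /\ Z (X1 t.1 w)] <= q1%:E)%E.
Hypotheses (yE : n2%:R * q1 + q0 <= y) (y0 : 0 <= y) (y1 : y <= 1).

Lemma top_event1_ge (f : Ft) : injective f.1 ->
  ((\prod_l (pi l * Num.max 0 (1 - n2%:R * q l)) * (1 - y) ^+ n1)%:E <= P (top_event1 f))%E.
Proof.
move=> fi; pose r l := pi l * Num.max 0 (1 - n2%:R * q l).
have r0 l : 0 <= r l by rewrite mulr_ge0// le_max lexx.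
pose blk s1 := \big[setI/setT]_s2 [set w | top_pre f (s1, s2) (X1 s1 w, X2 (s1, s2) w)].
(* The factor [1 - y] is also charged to the selected blocks; this only lowers the bound and makes
   the exponent [n1] instead of [n1 - k]. *)
pose g s1 := (if [pick l | f.1 l == s1] is Some l then r l else 1) * (1 - y).
have g0 s1 : 0 <= g s1.
  by rewrite /g mulr_ge0 ?subr_ge0//; case: pickP => // *; exact: r0.
have gP s1 : ((g s1)%:E <= P (blk s1))%E.
  rewrite /g; case: pickP => [l /eqP ls1|no].
    apply: (@le_trans _ _ (r l)%:E); first by rewrite lee_fin ler_piMr ?r0// gerBl.
    have := target_block_ge mX1 mX2 lX2 ind c0 s0 (xal l) (hq l) (pi0 l) (hpi l (f.1 l, f.2 l)).
    move=> /le_trans; apply; rewrite /blk -ls1 le_eqVlt; apply/orP; left; apply/eqP.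
    congr (P _); apply: eq_bigr => s2 _.
    have -> // : top_pre f (f.1 l, s2) = if s2 == (f.1 l, f.2 l).2
        then box_pre c s `[al l, al' l[ `[ga l, de l[ else low c s x.
    rewrite /top_pre /=; case: pickP => [m /eqP[/fi -> ->]|/(_ l)]; first by rewrite eqxx.
    by rewrite xpair_eqE eqxx/= eq_sym => ->.
  rewrite mul1r.
  have := @empty_block_ge _ _ _ P _ _ X1 X2 mX1 mX2 lX1 c s s1 x Z q0 q1 mZ hq0
    (fun s2 => hq1 (s1, s2)).
  have -> : blk s1 = \big[setI/setT]_s2 [set w | low c s x (X1 s1 w, X2 (s1, s2) w)].
    apply: eq_bigr => s2 _; rewrite /top_pre.
    by case: pickP => // l /eqP[ls1 _]; have := no l; rewrite ls1 eqxx.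
  by apply: le_trans; rewrite lee_fin lerD2l lerN2.
rewrite (grem_blocks_prod mX1 mX2 ind (C := fun s1 s2 => top_pre f (s1, s2))); last first.
  by move=> s1 s2; exact: measurable_top_pre.
have fP s1 : P (blk s1) = (fine (P (blk s1)))%:E.
  rewrite fineK// fin_num_measure//; apply: bigsetI_measurable => s2 _.
  by apply: measurable_pair_preimage => //; exact: measurable_top_pre.
rewrite (eq_bigr _ (fun s1 _ => fP s1)).
rewrite prodEFin lee_fin.
apply: (@le_trans _ _ (\prod_s1 g s1)); last first.
  by apply: ler_prod => s1 _; rewrite g0 -lee_fin -fP gP.
rewrite /g [leRHS]big_split/= prodr_const le_eqVlt; apply/orP; left; apply/eqP; congr (_ * _).
rewrite (partition_big f.1 xpredT)//=; apply: eq_bigr => s1 _.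
case: pickP => [l /eqP ls1|no]; last by rewrite big_pred0.
by rewrite (big_pred1 l)// => m; rewrite /= -ls1 (inj_eq fi).
Qed.

(** The prefactor counts the selections: an injective choice of [k] first halves and an arbitrary
    choice of [k] second halves. *)
Lemma top_event_ge :
  (((n1 ^_ k)%:R * n2%:R ^+ k *
    (\prod_l (pi l * Num.max 0 (1 - n2%:R * q l)) * (1 - y) ^+ n1))%:E <= P top_event)%E.
Proof.
rewrite /top_event measure_bigsetU_fin; last 2 first.
- exact: measurable_top_event1.
- by move=> f g w /injectiveP fi /injectiveP gi; exact: top_event1_inj.
set b := (X in (_ * X)%:E).
apply: (@le_trans _ _ (\sum_(f : Ft | injectiveb f.1) b%:E)%E); last first.
  by apply: lee_sum => f /injectiveP fi; exact: top_event1_ge.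
pose A : {set Ft} := finset.setX (finset (fun g : {ffun 'I_k -> S1} => injectiveb g))
  (finset.setTfor {ffun 'I_k -> S2}).
rewrite sumEFin lee_fin (eq_bigl (fun f => f \in A)); last first.
  by case=> f1 f2; rewrite finset.in_setX !inE andbT.
rewrite sumr_const cardsX cardsT card_inj_ffuns card_ffun card_ord.
by rewrite -natrX -natrM mulr_natl.
Qed.

End top_event.

(** * Asymptotics *)

Section scaling_asymptotics.
Context {R : realType}.
Local Notation phi := (@normal_pdf R 0 1).
Local Notation sq N := (Num.sqrt N%:R : R).

Definition beta_sqrt (N : nat) : R := beta_star R * sq N.
Local Notation s := beta_sqrt.

Definition u_shift (x : R) (N : nat) : R := (x - (ln N%:R + kappa R) / 2) / s N.

Lemma ln2_gt0 : 0 < ln 2 :> R.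
Proof. by rewrite ln_gt0// ltr1n. Qed.

Lemma beta_star_gt0 : 0 < beta_star R.
Proof. by rewrite sqrtr_gt0 mulr_gt0// ln2_gt0. Qed.

Lemma beta_sqrt_gt0 N : (0 < N)%N -> 0 < s N.
Proof. by move=> N0; rewrite mulr_gt0 ?beta_star_gt0// sqrtr_gt0 ltr0n. Qed.

Lemma sqr_beta_sqrt N : s N ^+ 2 = 2 * ln 2 * N%:R.
Proof.
by rewrite /s exprMn !sqr_sqrtr// mulr_ge0// ltW// ln2_gt0.
Qed.

Lemma sqrtn_cvgy : (sq N) @[N --> \oo] --> +oo.
Proof.
apply/cvgryPge => A; near=> N.
have A0 : 0 <= Num.max A 0 by rewrite le_max lexx orbT.
apply: (@le_trans _ _ (Num.max A 0)); first by rewrite le_max lexx.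
rewrite -(ler_pXn2r (n := 2))// ?nnegrE ?sqrtr_ge0// sqr_sqrtr//.
by near: N; exact: nbhs_infty_ger.
Unshelve. all: by end_near. Qed.

Lemma beta_sqrt_cvgy : s N @[N --> \oo] --> +oo.
Proof.
apply/cvgryPge => A; near=> N.
rewrite /s mulrC -ler_pdivrMr ?beta_star_gt0//.
by near: N; move/cvgryPge : sqrtn_cvgy; exact.
Unshelve. all: by end_near. Qed.

Lemma beta_sqrtV_cvg0 : (s N)^-1 @[N --> \oo] --> (0:R).
Proof.
apply/gtr0_cvgV0; last exact: beta_sqrt_cvgy.
by near=> N; apply: beta_sqrt_gt0; near: N; exact: nbhs_infty_gt.
Unshelve. all: by end_near. Qed.

Lemma u_N_shift x N : u_N N x = s N + u_shift x N.
Proof.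
rewrite /u_N /u_shift -/(s N) -mulrA -/(s N) [_ + s N]addrC -addrA; congr (_ + _).
by rewrite mulrBl -[in RHS]mulrA -invfM.
Qed.

(** With [r] the fourth root of [N], the logarithm is [4 * ln r], at most [4 * r], while [s N] is a
    multiple of [r ^+ 2]. *)
Lemma ln_div_beta_sqrt_cvg0 : ln N%:R / s N @[N --> \oo] --> (0:R).
Proof.
have h : 4 / beta_star R * (Num.sqrt (sq N))^-1 @[N --> \oo] --> (0:R).
  rewrite -(mulr0 (4 / beta_star R)); apply: cvgMr; apply/gtr0_cvgV0.
    by near=> N; rewrite !sqrtr_gt0 ltr0n; near: N; exact: nbhs_infty_gt.
  apply/cvgryPge => A; near=> N.
  have A0 : 0 <= Num.max A 0 by rewrite le_max lexx orbT.
  apply: (@le_trans _ _ (Num.max A 0)); first by rewrite le_max lexx.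
  rewrite -(ler_pXn2r (n := 2))// ?nnegrE ?sqrtr_ge0// sqr_sqrtr ?sqrtr_ge0//.
  by near: N; move/cvgryPge : sqrtn_cvgy; exact.
apply: squeeze_cvgr (cvg_cst 0) h; near=> N.
have N0 : (0 < N)%N by near: N; exact: nbhs_infty_gt.
have s0 := beta_sqrt_gt0 N0.
set r := Num.sqrt (sq N).
have r0 : 0 < r by rewrite !sqrtr_gt0 ltr0n.
have Nr : N%:R = r ^+ 4 by rewrite (exprM r 2 2) !sqr_sqrtr// sqrtr_ge0.
have sr : s N = beta_star R * r ^+ 2 by rewrite /s sqr_sqrtr// sqrtr_ge0.
rewrite divr_ge0 ?ln_ge0 ?ler1n ?(ltW s0)//= ler_pdivrMr// sr.
have -> : 4 / beta_star R * r^-1 * (beta_star R * r ^+ 2) = 4 * r.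
  by field; rewrite !gt_eqF// beta_star_gt0.
by rewrite Nr lnXn// -[ln r *+ 4]mulr_natl ler_pM2l// ltW// ln_sublinear.
Unshelve. all: by end_near. Qed.

Lemma u_shift_cvg0 x : u_shift x N @[N --> \oo] --> (0:R).
Proof.
have -> : (u_shift x) = (fun N => (x - kappa R / 2) * (s N)^-1 - 2^-1 * (ln N%:R / s N)).
  by apply/funext => N; rewrite /u_shift; lra.
rewrite -[X in _ --> X](_ : (x - kappa R / 2) * 0 - 2^-1 * 0 = 0); last by rewrite !mulr0 subrr.
by apply: cvgB; apply: cvgMr; [exact: beta_sqrtV_cvg0|exact: ln_div_beta_sqrt_cvg0].
Qed.

Lemma beta_sqrt_div_u_N_cvg1 x : s N / u_N N x @[N --> \oo] --> (1:R).
Proof.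
have h : (1 + u_shift x N / s N)^-1 @[N --> \oo] --> (1:R).
  rewrite -[X in _ --> X]invr1; apply: cvgV; first exact: oner_neq0.
  rewrite -[X in _ --> X]addr0; apply: cvgD; first exact: cvg_cst.
  rewrite -[X in _ --> X](mulr0 0); apply: cvgM; first exact: u_shift_cvg0.
  exact: beta_sqrtV_cvg0.
apply: cvg_trans h; apply: near_eq_cvg; near=> N.
have s0 : 0 < s N by apply: beta_sqrt_gt0; near: N; exact: nbhs_infty_gt.
have -> : 1 + u_shift x N / s N = u_N N x / s N.
  by rewrite u_N_shift mulrDl divff// gt_eqF.
by rewrite invfM invrK mulrC.
Unshelve. all: by end_near. Qed.

Lemma u_N_gt0 (x : R) : \forall N \near \oo, 0 < u_N N x.
Proof.
near=> N; rewrite u_N_shift.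
have h1 : 1 <= s N by near: N; move/cvgryPge : beta_sqrt_cvgy; exact.
have h2 : `|u_shift x N| <= 2^-1.
  by near: N; move/cvgr0Pnorm_le : (u_shift_cvg0 x); apply; rewrite invr_gt0.
by move: h2; rewrite ler_norml => /andP[h2 _]; lra.
Unshelve. all: by end_near. Qed.

Lemma expR_natln2 (N : nat) : expR (ln 2 * N%:R) = 2 ^+ N :> R.
Proof. by rewrite mulrC expRM_natl lnK// posrE. Qed.

(** An exact identity that explains the centering in [u_N]: half the square of [s N] cancels
    [2 ^+ N], the cross term yields [expR (- x)], and the logarithmic correction turns the Gaussian
    normalization into [s N]. *)
Lemma std_normal_pdf_u_N x N : (0 < N)%N ->
  2 ^+ N * phi (u_N N x) = expR (- x) * s N * expR (- u_shift x N ^+ 2 / 2).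
Proof.
move=> N0; have s0 := beta_sqrt_gt0 N0.
rewrite std_normal_pdfE u_N_shift.
have -> : - (s N + u_shift x N) ^+ 2 / 2 =
    - (ln 2 * N%:R) - x + (ln N%:R + kappa R) / 2 - u_shift x N ^+ 2 / 2.
  have e1 : s N * u_shift x N = x - (ln N%:R + kappa R) / 2.
    by rewrite /u_shift mulrC divfK// gt_eqF.
  have e2 := sqr_beta_sqrt N.
  have -> : - (s N + u_shift x N) ^+ 2 / 2 =
    - (s N ^+ 2) / 2 - s N * u_shift x N - u_shift x N ^+ 2 / 2 by field.
  by rewrite e1 e2; field.
(* Here [kappa] is used: after squaring, [4 * pi * ln 2 * N] divided by [2 * pi] is [s N ^+ 2]. *)
have key : normal_peak 1 * expR ((ln N%:R + kappa R) / 2) = s N.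
  apply/eqP; rewrite -(eqrXn2 (n := 2))//; last 2 first.
  - by rewrite mulr_ge0 ?normal_peak_ge0 ?expR_ge0.
  - exact: ltW.
  rewrite exprMn -expRM_natl mulrCA mulfV// mulr1.
  rewrite /normal_peak expr1n mul1r exprVn sqr_sqrtr; last by rewrite pmulrn_lge0// pi_ge0.
  have l2 := ln2_gt0.
  rewrite expRD lnK ?posrE ?ltr0n// /kappa expRD lnK ?posrE// lnK; last first.
    by rewrite posrE mulr_gt0// pi_gt0.
  rewrite sqr_beta_sqrt -mulr_natl; apply/eqP.
  by move: (pi : R) (@pi_gt0 R) => c c0; field; rewrite gt_eqF.
rewrite !expRD mulNr expRN expR_natln2 -key.
have := expR (- x); have := expR ((ln N%:R + kappa R) / 2); have := expR (- (u_shift x N ^+ 2 / 2)).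
have n0 : (2 ^+ N : R) != 0 by rewrite expf_neq0.
by move=> a b e; field.
Qed.

End scaling_asymptotics.

(** * Stability of Gaussian masses under shifts of endpoints *)

Section shifted_intervals.
Context {R : realType}.
Variables (s : R) (s0 : s != 0).
Local Notation nu := (@normal_prob R 0 s).

Lemma normal_prob_fin (A : set R) : measurable A -> (nu A : \bar R) \is a fin_num.
Proof. by move=> mA; exact: (@fin_num_measure _ _ _ (normal_prob 0 s)). Qed.

Let nu_sub (A B : set R) : measurable A -> measurable B -> A `<=` B -> (nu A <= nu B)%E.
Proof. by move=> mA mB AB; apply: (@le_measure _ _ _ (normal_prob 0 s)); rewrite ?inE. Qed.

Let nuU (A B : set R) : measurable A -> measurable B -> (nu (A `|` B) <= nu A + nu B)%E.
Proof. by move=> mA mB; exact: (@measureU2 _ _ _ (normal_prob 0 s)). Qed.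

Lemma normal_prob_between (a b : R) :
  (nu `[Num.min a b, Num.max a b]%classic <= (normal_peak s * `|a - b|)%:E)%E.
Proof.
apply: le_trans (normal_prob_itv_le _ s0 _) _; first by rewrite ge_min le_max lexx.
rewrite lee_fin ler_wpM2l ?normal_peak_ge0//.
have [ab|ba] := leP a b; first by rewrite distrC ler_norm.
by rewrite ler_norm.
Qed.

(** The first interval is covered by the second and the two segments swept by the endpoints, each of
    mass at most the peak density times its length. *)
Lemma normal_prob_itv_shift (a b a' b' : R) :
  (nu `[a, b[%classic <=
   nu `[a', b'[%classic + (normal_peak s * (`|a - a'| + `|b - b'|))%:E)%E.
Proof.
pose A := `[Num.min a a', Num.max a a']%classic : set R.
pose B := `[Num.min b b', Num.max b b']%classic : set R.
have mA : measurable A by exact: measurable_itv.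
have mB : measurable B by exact: measurable_itv.
apply: (@le_trans _ _ (nu (`[a', b'[ `|` (A `|` B)))).
  apply: nu_sub => //; first by do 2 (apply: measurableU => //).
  move=> x /=; rewrite in_itv/= => /andP[ax xb].
  have [a'x|xa'] := leP a' x; last first.
    by right; left; rewrite /A/= in_itv/= ge_min ax/= le_max (ltW xa') orbT.
  have [xb'|b'x] := ltP x b'; first by left; rewrite in_itv/= a'x.
  by right; right; rewrite /B/= in_itv/= ge_min b'x orbT/= le_max (ltW xb).
apply: le_trans (nuU _ _) _ => //; first exact: measurableU.
rewrite leeD2l// mulrDr EFinD; apply: le_trans (nuU _ _) _ => //.
by apply: leeD; exact: normal_prob_between.
Qed.

Lemma normal_prob_left_shift (b : R) :
  (nu `]-oo, b[%classic <= (2^-1 + normal_peak s * `|b|)%:E)%E.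
Proof.
pose B := `[Num.min 0 b, Num.max 0 b]%classic : set R.
have mB : measurable B by exact: measurable_itv.
apply: (@le_trans _ _ (nu (`]-oo, 0[ `|` B))).
  apply: nu_sub => //; first exact: measurableU.
  move=> x /=; rewrite !in_itv/= => xb.
  have [x0|x0] := ltP x 0; first by left.
  by right; rewrite /B/= in_itv/= ge_min x0/= le_max (ltW xb) orbT.
apply: le_trans (nuU _ _) _ => //.
rewrite EFinD normal_prob_neg//; apply: leeD => //.
by apply: le_trans (normal_prob_between _ _) _; rewrite sub0r normrN.
Qed.

End shifted_intervals.

Section energy_bounds.
Context d (T : measurableType d) (R : realType) (P : probability T R).
Context (S1 S2 : finType) (X1 : S1 -> T -> R) (X2 : S1 * S2 -> T -> R).
Local Notation gauss := (@normal_prob R 0 1).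
Local Notation phi := (@normal_pdf R 0 1).
Hypothesis mX1 : forall s1, measurable_fun setT (X1 s1).
Hypothesis mX2 : forall s, measurable_fun setT (X2 s).
Hypothesis lX1 : forall s1 A, measurable A -> P (X1 s1 @^-1` A) = gauss A.
Hypothesis lX2 : forall s A, measurable A -> P (X2 s @^-1` A) = gauss A.
Hypothesis ind : independent_family P (grem_family X1 X2).
Variables c s : R.
Hypotheses (c0 : 0 < c) (s0 : 0 < s) (cs1 : c ^+ 2 + s ^+ 2 = 1).
Local Notation energy := (energy X1 X2 c s).

Let menergy t B : measurable B -> measurable (energy t @^-1` B).
Proof.
by move=> mB; rewrite -[X in measurable X]setTI; exact: (measurable_energy mX1 mX2).
Qed.

Let mX1B t B : measurable B -> measurable (X1 t @^-1` B).
Proof. by move=> mB; rewrite -[X in measurable X]setTI; exact: mX1. Qed.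

Let mX1e t B : measurable B -> measurable [set w | B (X1 t.1 w - c * energy t w)].
Proof.
have m : measurable_fun setT (fun w => X1 t.1 w - c * energy t w).
  by apply: measurable_funB => //; apply: measurable_funM => //; exact: measurable_energy.
by move=> mB; rewrite -[X in measurable X]setTI; exact: m.
Qed.

(* On the event, [X1 t.1 - c * energy t] is an independent N(0, s^2) variable,
   and [energy t] stays within [m + e, m + e']. *)
Lemma energy_box_ge t (al al' m e e' a b : R) : 0 <= al -> al < al' ->
  al = m + e -> al' = m + e' ->
  (((phi al - phi al') / al' *
    Num.max 0 (fine (normal_prob 0 s `[a, b[%classic) -
               normal_peak s * (c * `|e| + c * `|e'|)))%:E <=
   P [set w | `[al, al'[%classic (energy t w) /\
              `[(a + c * m)%R, (b + c * m)%R[%classic (X1 t.1 w)])%E.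
Proof.
move=> al0 alal' ale ale'.
have [le0|gt0] := leP (fine (normal_prob 0 s `[a, b[%classic) -
               normal_peak s * (c * `|e| + c * `|e'|)) 0.
  by rewrite mulr0.
pose I := `[al, al'[%classic : set R.
(* The left end uses the lower bound [m + e] of the energy and the right end the upper bound
   [m + e'], so adding [c * energy] lands in the required cell. *)
pose J := `[a - c * e, b - c * e'[%classic : set R.
have mI : measurable I by exact: measurable_itv.
have mJ : measurable J by exact: measurable_itv.
apply: (@le_trans _ _ (P [set w | I (energy t w) /\ J (X1 t.1 w - c * energy t w)])).
  rewrite (energy_law mX1 mX2 lX1 lX2 ind s0 cs1)// EFinM; apply: lee_pmul.
  - rewrite lee_fin divr_ge0 ?subr_ge0 ?le_std_normal_pdf// ?ltW//.
    exact: le_lt_trans alal'.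
  - by rewrite lee_fin ltW.
  - exact: normal_prob_itv_ge.
  - have sn0 : s != 0 by rewrite gt_eqF.
    have := normal_prob_itv_shift sn0 a b (a - c * e) (b - c * e').
    rewrite !subKr !normrM (gtr0_norm c0).
    have fab := normal_prob_fin s (measurable_itv `[a, b[).
    have fJ : (normal_prob 0 s J : \bar R) \is a fin_num.
      exact: normal_prob_fin.
    by rewrite -(fineK fab) -(fineK fJ) -EFinD !lee_fin lerBlDr.
apply: le_measure; rewrite ?inE.
- have -> : [set w | I (energy t w) /\ J (X1 t.1 w - c * energy t w)] =
    energy t @^-1` I `&` [set w | J (X1 t.1 w - c * energy t w)] by [].
  by apply: measurableI; [exact: menergy|exact: mX1e].
- have -> : [set w | `[al, al'[%classic (energy t w) /\
      `[(a + c * m)%R, (b + c * m)%R[%classic (X1 t.1 w)] =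
    energy t @^-1` I `&` X1 t.1 @^-1` `[(a + c * m), (b + c * m)[ by [].
  by apply: measurableI; [exact: menergy|exact: mX1B].
move=> w /= [Iw Jw]; split => //; move: Iw Jw; rewrite /J/=.
rewrite /I/= !in_itv/= => /andP[h1 h2] /andP[h3 h4].
have g1 : c * al <= c * energy t w by rewrite ler_pM2l.
have g2 : c * energy t w < c * al' by rewrite ltr_pM2l.
rewrite ale mulrDr in g1; rewrite ale' [c * (m + e')]mulrDr in g2.
by apply/andP; split; lra.
Qed.

Lemma energy_tail_le t (x : R) : 0 < x ->
  (P [set w | (x <= energy t w)%R /\ setT (X1 t.1 w)] <= (phi x / x)%:E)%E.
Proof.
move=> x0.
have -> : [set w | (x <= energy t w)%R /\ setT (X1 t.1 w)] = energy t @^-1` `[x, +oo[.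
  by apply/seteqP; split => w /=; rewrite in_itv/= andbT => // -[].
rewrite (energy_gauss mX1 mX2 lX1 lX2 ind s0 cs1)//; exact: normal_prob_tail_le.
Qed.

(** An energy above [m + e] with first-level variable below [c * m] forces the independent remainder
    below [- (c * e)], an event of probability close to one half when [e] is small. *)
Lemma energy_left_tail_le t (x m e : R) : 0 < x -> x = m + e ->
  (P [set w | (x <= energy t w)%R /\ `]-oo, (c * m)%R[%classic (X1 t.1 w)] <=
   (phi x / x * (2^-1 + normal_peak s * (c * `|e|)))%:E)%E.
Proof.
move=> x0 xe.
pose I := `[x, +oo[%classic : set R.
pose J := `]-oo, - (c * e)[%classic : set R.
have mI : measurable I by exact: measurable_itv.
have mJ : measurable J by exact: measurable_itv.
apply: (@le_trans _ _ (P [set w | I (energy t w) /\ J (X1 t.1 w - c * energy t w)])).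
  apply: le_measure; rewrite ?inE.
  - have -> : [set w | (x <= energy t w)%R /\ `]-oo, (c * m)%R[%classic (X1 t.1 w)] =
      energy t @^-1` I `&` X1 t.1 @^-1` `]-oo, (c * m)[.
      by apply/seteqP; split => w /=; rewrite /I/= !in_itv/= ?andbT.
    by apply: measurableI; [exact: menergy|exact: mX1B].
  - have -> : [set w | I (energy t w) /\ J (X1 t.1 w - c * energy t w)] =
      energy t @^-1` I `&` [set w | J (X1 t.1 w - c * energy t w)] by [].
    by apply: measurableI; [exact: menergy|exact: mX1e].
  move=> w /= [xw]; rewrite /I/J/= !in_itv/= andbT => h; split => //.
  have g1 : c * x <= c * energy t w by rewrite ler_pM2l.
  by rewrite xe mulrDr in g1; lra.
rewrite (energy_law mX1 mX2 lX1 lX2 ind s0 cs1)// EFinM; apply: lee_pmul.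
- exact: (@measure_ge0 _ _ _ (normal_prob 0 1)).
- exact: (@measure_ge0 _ _ _ (normal_prob 0 s)).
- exact: normal_prob_tail_le.
- have sn0 : s != 0 by rewrite gt_eqF.
  apply: le_trans (normal_prob_left_shift sn0 _) _.
  by rewrite normrN normrM (gtr0_norm c0).
Qed.

End energy_bounds.

(** * Growth rates at the level [u_N] *)

Section level_asymptotics.
Context {R : realType}.
Local Notation phi := (@normal_pdf R 0 1).
Local Notation s := (@beta_sqrt R).

(** Two levels appear because [normal_prob_itv_ge] divides both densities by the right endpoint of
    the interval. *)
Lemma std_normal_pdf_u_N_cvg (x x' : R) :
  2 ^+ N * (phi (u_N N x) / u_N N x') @[N --> \oo] --> expR (- x).
Proof.
have h : expR (- x) * (s N / u_N N x') * expR (- u_shift x N ^+ 2 / 2) @[N --> \oo]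
    --> expR (- x).
  rewrite -[X in _ --> X]mulr1; apply: cvgM.
    rewrite -[X in _ --> X]mulr1; apply: cvgMr; exact: beta_sqrt_div_u_N_cvg1.
  rewrite -[X in _ --> X]expR0; apply: continuous_cvg; first exact: continuous_expR.
  have -> : (fun N => - u_shift x N ^+ 2 / 2) =
      (fun N => (- 2^-1) * (u_shift x N * u_shift x N)).
    by apply/funext => N; rewrite expr2; field.
  rewrite -[X in _ --> X](mulr0 (- 2^-1)); apply: cvgMr.
  by rewrite -[X in _ --> X](mulr0 0); apply: cvgM; exact: u_shift_cvg0.
apply: cvg_trans h; apply: near_eq_cvg; near=> N.
have N0 : (0 < N)%N by near: N; exact: nbhs_infty_gt.
by rewrite [RHS]mulrA std_normal_pdf_u_N// mulrA mulrAC.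
Unshelve. all: by end_near. Qed.

Lemma max0_cvg (f : nat -> R) (l : R) : 0 <= l ->
  f N @[N --> \oo] --> l -> Num.max 0 (f N) @[N --> \oo] --> l.
Proof.
move=> l0 fl; apply/cvgrPdist_le => e e0.
move/cvgrPdist_le : fl => /(_ _ e0); apply: filterS => N.
have [f0|f0] := leP (f N) 0; last by [].
rewrite subr0 (ger0_norm l0) ger0_norm ?subr_ge0 ?(le_trans f0)//.
by apply: le_trans; rewrite lerDl oppr_ge0.
Qed.

(** Asking for distinct first halves is asymptotically free: each new choice excludes only [k] out
    of [n N]. *)
Lemma ffact_ratio_cvg1 (k : nat) (n : nat -> nat) :
  ((n N)%:R : R) @[N --> \oo] --> +oo ->
  ((n N) ^_ k)%:R / (n N)%:R ^+ k @[N --> \oo] --> (1:R).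
Proof.
move=> ny; elim: k => [|k IH].
  by under eq_fun do rewrite ffactn0 expr0 divr1; exact: cvg_cst.
have nV : ((n N)%:R : R)^-1 @[N --> \oo] --> (0:R).
  apply/gtr0_cvgV0; last exact: ny.
  by move/cvgryPgt : ny; exact.
have h : ((n N) ^_ k)%:R / (n N)%:R ^+ k * (1 - k%:R * (n N)%:R^-1) @[N --> \oo] --> (1:R).
  rewrite -[X in _ --> X]mulr1; apply: cvgM => //.
  rewrite -[X in _ --> X]subr0; apply: cvgB; first exact: cvg_cst.
  by rewrite -[X in _ --> X](mulr0 k%:R); apply: cvgMr.
apply: cvg_trans h; apply: near_eq_cvg; near=> N.
have kn : (k < n N)%N.
  rewrite -(ltr_nat R); near: N; move/cvgryPgt : ny; exact.
have n0 : (n N)%:R != 0 :> R by rewrite pnatr_eq0 -lt0n (leq_ltn_trans _ kn).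
rewrite ffactnSr natrM natrB; last exact: ltnW.
by rewrite exprSr; field; rewrite n0 expf_neq0.
Unshelve. all: by end_near. Qed.

Variables (p a : R).
Hypotheses (hp : 0 < p < 1) (ha : 0 < a < 1) (hap : a <= p).
Local Notation c := (Num.sqrt a).
Local Notation t := (Num.sqrt (1 - a)).

Lemma N1_le N : (N1 p N)%:R <= p * N%:R :> R.
Proof. by rewrite truncn_le mulr_ge0//; case/andP: hp => /ltW. Qed.

Lemma N1_gt N : p * N%:R - 1 < (N1 p N)%:R :> R.
Proof.
have pN : 0 <= p * N%:R by rewrite mulr_ge0//; case/andP: hp => /ltW.
by have /andP[_] := truncn_itv pN; rewrite -natr1 /N1; lra.
Qed.

Lemma N1_leN N : (N1 p N <= N)%N.
Proof.
rewrite -(ler_nat R); apply: le_trans (N1_le N) _.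
by rewrite ler_piMl//; case/andP: hp => _ /ltW.
Qed.

Lemma expn_N1_cvgy : ((2 ^ N1 p N)%:R : R) @[N --> \oo] --> +oo.
Proof.
apply/cvgryPge => A; near=> N.
have h : (A + 1) / p <= N%:R by near: N; exact: nbhs_infty_ger.
move: h; rewrite ler_pdivrMr; last by case/andP: hp.
have := N1_gt N; have : (N1 p N)%:R <= (2 ^ N1 p N)%:R :> R.
  by rewrite ler_nat ltnW// ltn_expl.
by rewrite mulrC; lra.
Unshelve. all: by end_near. Qed.

(** The level at which a second-level variable lifts the energy to [u_N N x] when the first-level
    one sits at [d + c * s N]. *)
Definition second_level_threshold (x d : R) (N : nat) : R :=
  (u_N N x - c * (d + c * s N)) / t.

Lemma normal_prob_tail_expR (y : R) : 1 <= y ->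
  (normal_prob 0%R 1%R `[y, +oo[%classic <= (expR (- y ^+ 2 / 2))%:E)%E.
Proof.
move=> y1; have y0 : 0 < y by exact: lt_le_trans y1.
apply: le_trans (normal_prob_tail_le y0) _; rewrite lee_fin.
rewrite ler_pdivrMr// std_normal_pdfE mulrC ler_wpM2l ?expR_ge0//.
apply: le_trans y1; rewrite /normal_peak expr1n mul1r invf_le1; last first.
  by rewrite sqrtr_gt0 pmulrn_lgt0// pi_gt0.
rewrite -[leLHS]sqrtr1 ler_wsqrtr// -mulr_natr.
by have := @pi_ge2 R; move: (pi : R) => ? ?; lra.
Qed.

Lemma sqr_t : t ^+ 2 = 1 - a.
Proof. by rewrite sqr_sqrtr// subr_ge0; case/andP: ha => _ /ltW. Qed.

Lemma sqr_c : c ^+ 2 = a.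
Proof. by rewrite sqr_sqrtr//; case/andP: ha => /ltW. Qed.

Lemma t_gt0 : 0 < t.
Proof. by rewrite sqrtr_gt0 subr_gt0; case/andP: ha. Qed.

Lemma c_gt0 : 0 < c.
Proof. by rewrite sqrtr_gt0; case/andP: ha. Qed.

Lemma second_level_thresholdE x d N :
  second_level_threshold x d N = t * s N + (u_shift x N - c * d) / t.
Proof.
rewrite /second_level_threshold u_N_shift.
have -> : s N + u_shift x N - c * (d + c * s N) =
  (1 - c ^+ 2) * s N + (u_shift x N - c * d) by ring.
have -> : 1 - c ^+ 2 = t ^+ 2 by rewrite sqr_c sqr_t.
rewrite mulrDl expr2; congr (_ + _).
by rewrite -[t * t * _]mulrA mulrC mulKf// gt_eqF// t_gt0.
Qed.

Lemma second_level_threshold_ge1 x d :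
  \forall N \near \oo, 1 <= second_level_threshold x d N.
Proof.
near=> N; rewrite second_level_thresholdE.
have h2 : `|u_shift x N| <= 1.
  by near: N; move/cvgr0Pnorm_le : (u_shift_cvg0 x); apply.
have h1 : (1 + (1 + c * d) / t) / t <= s N.
  by near: N; move/cvgryPge : (@beta_sqrt_cvgy R); exact.
have t0 := t_gt0.
move: h1; rewrite ler_pdivrMr// [s N * t]mulrC => h1.
apply: le_trans (lerD h1 (lexx _)); rewrite -addrA -mulrDl lerDl divr_ge0 ?(ltW t0)//.
by move: h2; rewrite ler_norml => /andP[h2 _]; lra.
Unshelve. all: by end_near. Qed.

(** Expanding the square, the exponent is at most [ln 2 - s N * ((p - a) * s N / 2 + u_shift x N - c
    * d)]. For [a < p] the bracket grows with [s N]; for [a = p] it tends to [- (c * d)], whence the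
    sign condition. *)
Lemma second_level_cvg0 x d : (a < p) || (d < 0) ->
  2 ^+ N2 p N * expR (- second_level_threshold x d N ^+ 2 / 2) @[N --> \oo] --> (0:R).
Proof.
move=> good.
have [eta [eta0 heta]] : exists eta : R, 0 < eta /\
    \forall N \near \oo, eta <= (p - a) * s N / 2 + u_shift x N - c * d.
  case: (boolP (a < p)) good => [ap _|nap /= d0].
    exists 1; split => //; near=> N.
    have h2 : `|u_shift x N| <= 1.
      by near: N; move/cvgr0Pnorm_le : (u_shift_cvg0 x); apply.
    have h1 : 2 * (2 + c * d) / (p - a) <= s N.
      by near: N; move/cvgryPge : (@beta_sqrt_cvgy R); exact.
    move: h1; rewrite ler_pdivrMr ?subr_gt0// mulrC => h1.
    by move: h2; rewrite ler_norml => /andP[h2 _]; lra.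
  have pa : p - a = 0 by apply/eqP; rewrite subr_eq0 eq_le hap andbT leNgt.
  have cd : 0 < - (c * d) by rewrite oppr_gt0 pmulr_rlt0// c_gt0.
  exists (- (c * d) / 2); split; first by rewrite divr_gt0.
  near=> N; rewrite pa !mul0r add0r.
  have h2 : `|u_shift x N| <= - (c * d) / 2.
    by near: N; move/cvgr0Pnorm_le : (u_shift_cvg0 x); apply; rewrite divr_gt0.
  by move: h2; rewrite ler_norml => /andP[h2 _]; lra.
(* The factor 2 pays for rounding: [N2 p N] exceeds [(1 - p) * N] by at most 1. Polynomial decay is
   enough, from [expR z >= z]. *)
have h : 2 * (eta^-1 * (s N)^-1) @[N --> \oo] --> (0:R).
  rewrite -[X in _ --> X](mulr0 2); apply: cvgMr.
  rewrite -[X in _ --> X](mulr0 eta^-1); apply: cvgMr; exact: beta_sqrtV_cvg0.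
apply: squeeze_cvgr (cvg_cst 0) h; near=> N.
have N0 : (0 < N)%N by near: N; exact: nbhs_infty_gt.
have s0 := @beta_sqrt_gt0 R _ N0.
rewrite mulr_ge0 ?exprn_ge0 ?expR_ge0//=.
have he : eta <= (p - a) * s N / 2 + u_shift x N - c * d by near: N.
have t0 := t_gt0.
have l2 := @ln2_gt0 R.
apply: (@le_trans _ _ (2 * expR (- (s N * eta)))); last first.
  have se0 : 0 < s N * eta by exact: mulr_gt0.
  rewrite ler_pM2l// expRN -invfM [eta * _]mulrC lef_pV2 ?posrE ?expR_gt0//.
  by apply: le_trans (expR_ge1Dx _); rewrite lerDr.
rewrite -expR_natln2 -{3}[2](@lnK R) ?posrE// -!expRD ler_expR.
have eN2 : (N2 p N)%:R = N%:R - (N1 p N)%:R :> R by rewrite /N2 natrB// N1_leN.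
have hN1 := N1_gt N.
have sq := @sqr_beta_sqrt R N.
have tE : second_level_threshold x d N ^+ 2 =
    (1 - a) * s N ^+ 2 + 2 * s N * (u_shift x N - c * d) + ((u_shift x N - c * d) / t) ^+ 2.
  have -> : (1 - a) * s N ^+ 2 = t ^+ 2 * s N ^+ 2 by rewrite sqr_t.
  by rewrite second_level_thresholdE; move: t t0 => r r0; field; rewrite gt_eqF.
have q0 := sqr_ge0 ((u_shift x N - c * d) / t).
have h1 : ln 2 * (N2 p N)%:R <= ln 2 * (N%:R - p * N%:R + 1).
  by rewrite ler_pM2l// eN2; lra.
have h2 : s N * eta <= s N * ((p - a) * s N / 2 + u_shift x N - c * d).
  by rewrite ler_pM2l.
apply: le_trans (lerD h1 (lexx _)) _.
have -> : ln 2 * (N%:R - p * N%:R + 1) = (1 - p) * s N ^+ 2 / 2 + ln 2.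
  by rewrite sq; field.
rewrite tE; lra.
Unshelve. all: by end_near. Qed.

(** At [a = p] the Gaussian exponent at [c * s N] is [p * N * ln 2], which cancels [2 ^+ N1 p N];
    the decay comes from the Mills factor alone. *)
Lemma first_level_cvg0 : a = p ->
  2 ^+ N1 p N * (phi (c * s N) / (c * s N)) @[N --> \oo] --> (0:R).
Proof.
move=> ap.
have h : c^-1 * (s N)^-1 @[N --> \oo] --> (0:R).
  rewrite -[X in _ --> X](mulr0 c^-1); apply: cvgMr; exact: beta_sqrtV_cvg0.
apply: squeeze_cvgr (cvg_cst 0) h; near=> N.
have N0 : (0 < N)%N by near: N; exact: nbhs_infty_gt.
have s0 := @beta_sqrt_gt0 R _ N0.
have cs0 : 0 < c * s N by rewrite mulr_gt0// c_gt0.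
rewrite mulr_ge0 ?exprn_ge0 ?divr_ge0 ?normal_pdf_ge0 ?(ltW cs0)//=.
rewrite -invfM mulrA -[leRHS]mul1r ler_pM2r ?invr_gt0//.
rewrite std_normal_pdfE mulrCA.
have -> : - (c * s N) ^+ 2 / 2 = - (ln 2 * (p * N%:R)).
  by rewrite exprMn sqr_c sqr_beta_sqrt ap; field.
rewrite -expR_natln2 -expRD; apply: (@le_trans _ _ (1 * 1)); last by rewrite mulr1.
apply: ler_pM; rewrite ?normal_peak_ge0 ?expR_ge0//.
  rewrite /normal_peak expr1n mul1r invf_le1; last first.
    by rewrite sqrtr_gt0 pmulrn_lgt0// pi_gt0.
  rewrite -[leLHS]sqrtr1 ler_wsqrtr// -mulr_natr.
  by have := @pi_ge2 R; move: (pi : R) => ? ?; lra.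
rewrite -[leRHS]expR0 ler_expR subr_le0 ler_pM2l ?ln2_gt0//; exact: N1_le.
Unshelve. all: by end_near. Qed.

End level_asymptotics.

Lemma cvg_prodr (R : realType) (I : Type) (r : seq I) (f : I -> nat -> R) (g : I -> R) :
  (forall i, f i N @[N --> \oo] --> g i) ->
  \prod_(i <- r) f i N @[N --> \oo] --> \prod_(i <- r) g i.
Proof.
move=> fg; elim: r => [|i r IH].
  by under eq_fun do rewrite big_nil; rewrite big_nil; exact: cvg_cst.
by under eq_fun do rewrite big_cons; rewrite big_cons; exact: cvgM.
Qed.

(** Take powers of [(1 - y)^-1 = 1 + y / (1 - y) <= expR (y / (1 - y))]. *)
Lemma exprn_1B_ge (R : realType) (n : nat) (L : R) : (0 < n)%N -> L / n%:R < 1 ->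
  expR (- (L / (1 - L / n%:R))) <= (1 - L / n%:R) ^+ n.
Proof.
move=> n0 y1; set y := L / n%:R in y1 *.
have y2 : 0 < 1 - y by rewrite subr_gt0.
have -> : L / (1 - y) = n%:R * (y / (1 - y)).
  by rewrite mulrA; congr (_ / _); rewrite /y mulrC divfK// pnatr_eq0 -lt0n.
rewrite -mulrN expRM_natl lerXn2r// ?nnegrE ?expR_ge0 ?(ltW y2)//.
rewrite expRN -[leRHS]invrK lef_pV2 ?posrE ?expR_gt0 ?invr_gt0//.
have e : (1 - y)^-1 = 1 + y / (1 - y) by field; rewrite gt_eqF.
by rewrite [leLHS]e expR_ge1Dx.
Qed.

Lemma u_N_mono (R : realType) (N : nat) (x y : R) : (0 < N)%N -> x < y -> u_N N x < u_N N y.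
Proof.
move=> N0 xy; rewrite /u_N ltrD2r ltrD2r ltr_pM2r// invr_gt0.
exact: (@beta_sqrt_gt0 R).
Qed.

Lemma u_N_inv_mono (R : realType) (N : nat) (x y : R) : (0 < N)%N ->
  (x <= u_N_inv N y) = (u_N N x <= y).
Proof.
move=> N0; apply/idP/idP => [|h].
  rewrite le_eqVlt => /predU1P[->|]; first by rewrite u_N_invK.
  by move/(u_N_mono N0); rewrite u_N_invK// => /ltW.
rewrite leNgt; apply/negP => /(u_N_mono N0).
by rewrite u_N_invK// ltNge h.
Qed.

(** * Limits of the box bounds *)

Section box_asymptotics.
Context (R : realType) (p a : R).
Hypotheses (hp : 0 < p < 1) (ha : 0 < a < 1) (hap : a <= p).
Local Notation phi := (@normal_pdf R 0 1).
Local Notation s := (@beta_sqrt R).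
Local Notation c := (Num.sqrt a).
Local Notation t := (Num.sqrt (1 - a)).
Local Notation n1 N := (2 ^ N1 p N)%N.
Local Notation n2 N := (2 ^ N2 p N)%N.

Definition limit_rate : R := if a < p then 1 else 2^-1.

Lemma card_spins n : #|spins n| = (2 ^ n)%N.
Proof. by rewrite card_ffun card_bool card_ord. Qed.

Lemma n1n2E N : (n1 N)%:R * (n2 N)%:R = 2 ^+ N :> R.
Proof. by rewrite -natrM -expnD /N2 subnKC ?N1_leN// natrX. Qed.

(* For [a = p] a first-level value above [c * s N] would create many large
   energies in one block. Such values have vanishing probability, and the cut
   keeps only half of the Gaussian tail of the energy, whence the rate 1/2. *)
Definition first_cut N : set R := if a < p then setT else `]-oo, c * s N[%classic.
Definition first_cut_tail N : R := if a < p then 0 else phi (c * s N) / (c * s N).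
Definition cut_tail x N : R := phi (u_N N x) / u_N N x *
  (if a < p then 1 else 2^-1 + normal_peak t * (c * `|u_shift x N|)).
(** This is [n1] times the failure bound [n2 * q1 + q0] of an empty block. *)
Definition void_mass x N : R :=
  2 ^+ N * cut_tail x N + (n1 N)%:R * first_cut_tail N.

Lemma void_mass_cvg x : void_mass x N @[N --> \oo] --> limit_rate * expR (- x).
Proof.
rewrite /void_mass /limit_rate /cut_tail /first_cut_tail; case: ifPn => ap.
  under eq_fun do rewrite mulr1 mulr0 addr0.
  rewrite mul1r; exact: std_normal_pdf_u_N_cvg.
have {ap}ap : a = p by apply/eqP; rewrite eq_le hap leNgt.
rewrite -[X in _ --> X]addr0; apply: cvgD; last first.
  under eq_fun do rewrite natrX; exact: first_level_cvg0.
under eq_fun do rewrite mulrA.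
rewrite mulrC; apply: cvgM; first exact: std_normal_pdf_u_N_cvg.
rewrite -[X in _ --> X]addr0; apply: cvgD; first exact: cvg_cst.
rewrite -[X in _ --> X](mulr0 (normal_peak t)); apply: cvgMr.
rewrite -[X in _ --> X](mulr0 c); apply: cvgMr.
by rewrite -[X in _ --> X](normr0 R); apply: cvg_norm; exact: u_shift_cvg0.
Qed.

Lemma void_mass_div_cvg0 x : void_mass x N / (n1 N)%:R @[N --> \oo] --> (0:R).
Proof.
rewrite -[X in _ --> X](mulr0 (limit_rate * expR (- x))); apply: cvgM.
  exact: void_mass_cvg.
apply/gtr0_cvgV0; last exact: expn_N1_cvgy.
by apply: nearW => N; rewrite ltr0n expn_gt0.
Qed.

Definition cell_mass (x x' b b' : R) N : R :=
  (phi (u_N N x) - phi (u_N N x')) / u_N N x' *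
  Num.max 0 (fine (normal_prob 0 t `[b, b'[%classic) -
             normal_peak t * (c * `|u_shift x N| + c * `|u_shift x' N|)).

Definition cell_limit (x x' b b' : R) : R :=
  (expR (- x) - expR (- x')) * fine (normal_prob 0 t `[b, b'[%classic).

Lemma cell_mass_cvg x x' b b' :
  2 ^+ N * cell_mass x x' b b' N @[N --> \oo] --> cell_limit x x' b b'.
Proof.
rewrite /cell_mass; under eq_fun do rewrite mulrA.
apply: cvgM.
  under eq_fun do rewrite mulrBl mulrBr.
  by apply: cvgB; exact: std_normal_pdf_u_N_cvg.
apply: max0_cvg; first by rewrite fine_ge0//; exact: (@measure_ge0 _ _ _ (normal_prob 0 t)).
rewrite -[X in _ --> X]subr0; apply: cvgB; first exact: cvg_cst.
rewrite -[X in _ --> X](mulr0 (normal_peak t)); apply: cvgMr.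
have h z : c * `|u_shift z N| @[N --> \oo] --> (0:R).
  rewrite -[X in _ --> X](mulr0 c); apply: cvgMr.
  by rewrite -[X in _ --> X](normr0 R); apply: cvg_norm; exact: u_shift_cvg0.
by rewrite -[X in _ --> X]addr0; apply: cvgD.
Qed.

Variables (k : nat) (x x' b b' : 'I_k.+1 -> R).
Hypothesis xx' : forall l, x l < x' l.
Hypothesis x'x : forall l m : 'I_k.+1, (l < m)%N -> x' m <= x l.
Hypothesis good : forall l, (a < p) || (b' l < 0).
Local Notation x0 := (x ord_max).

Definition block_ratio N (l : 'I_k.+1) : R :=
  Num.max 0 (1 - (n2 N)%:R * expR (- second_level_threshold a x0 (b' l) N ^+ 2 / 2)).

(** The bound of [top_event_ge] arranged into convergent factors: the [2 ^+ N] in each cell is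
    [n1 * n2], and the power of [1 - y] is replaced by the exponential of [exprn_1B_ge]. *)
Definition box_bound N : R :=
  (n1 N ^_ k.+1)%:R / (n1 N)%:R ^+ k.+1 *
  \prod_l (2 ^+ N * cell_mass (x l) (x' l) (b l) (b' l) N * block_ratio N l) *
  expR (- (void_mass x0 N / (1 - void_mass x0 N / (n1 N)%:R))).

Definition box_limit : R :=
  \prod_l cell_limit (x l) (x' l) (b l) (b' l) * expR (- (limit_rate * expR (- x0))).

Lemma box_bound_cvg : box_bound N @[N --> \oo] --> box_limit.
Proof.
apply: cvgM; last first.
  apply: continuous_cvg; first exact: continuous_expR.
  apply: cvgN; rewrite -[X in _ --> X]divr1; apply: cvgM; first exact: void_mass_cvg.
  apply: cvgV; first exact: oner_neq0.
  rewrite -[X in _ --> X]subr0; apply: cvgB; first exact: cvg_cst.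
  exact: void_mass_div_cvg0.
rewrite -[X in _ --> X]mul1r; apply: cvgM.
  by apply: ffact_ratio_cvg1; exact: expn_N1_cvgy.
apply: cvg_prodr => l; rewrite -[X in _ --> X]mulr1; apply: cvgM.
  exact: cell_mass_cvg.
apply: max0_cvg => //; rewrite -[X in _ --> X]subr0; apply: cvgB; first exact: cvg_cst.
by under eq_fun do rewrite natrX; exact: second_level_cvg0.
Qed.

End box_asymptotics.

Section box_lower_bound.
Context (R : realType) (p a : R).
Hypotheses (hp : 0 < p < 1) (ha : 0 < a < 1) (hap : a <= p).
Context (d : nat -> measure_display) (T : forall N : nat, measurableType (d N))
  (P : forall N : nat, probability (T N) R)
  (X1 : forall N : nat, spins (N1 p N) -> {RV (P N) >-> R})
  (X2 : forall N : nat, config p N -> {RV (P N) >-> R}).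
Arguments X1 : clear implicits.
Arguments X2 : clear implicits.
Hypotheses (hX1 : forall (N : nat) (s1 : spins (N1 p N)),
    has_law (X1 N s1) (normal_prob 0 1))
  (hX2 : forall (N : nat) (s : config p N),
    has_law (X2 N s) (normal_prob 0 1))
  (hindep : forall N : nat,
    independent_family (P N) (joint_family (X1 N) (X2 N))).
Local Notation s := (@beta_sqrt R).
Local Notation c := (Num.sqrt a).
Local Notation t := (Num.sqrt (1 - a)).
Variables (k : nat) (x x' b b' : 'I_k.+1 -> R).
Hypothesis xx' : forall l, x l < x' l.
Hypothesis x'x : forall l m : 'I_k.+1, (l < m)%N -> x' m <= x l.
Hypothesis good : forall l, (a < p) || (b' l < 0).
Local Notation x0 := (x ord_max).

(** The witness [U] is a [top_event], built from the Gaussian variables alone. On it [top_of_sorted]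
    forces the first entries of any ranking, so nothing is asked of how a ranking depends on the
    sample point. *)
Lemma box_bound_le : \forall N \near \oo, exists U : set (T N),
  [/\ measurable U, ((box_bound p a x x' b b' N)%:E <= P N U)%E &
    forall w sq, U w -> is_ranking (Xi a (X1 N) (X2 N) ^~ w) sq ->
    forall l : 'I_k.+1, let v := nth (config0 p N) sq l in
      x l <= u_N_inv N (Xi a (X1 N) (X2 N) v w) < x' l /\
      b l <= X1 N v.1 w - Num.sqrt (a * N%:R) * beta_star R < b' l].
Proof.
have a0 : 0 < a by case/andP: ha.
have c0 := c_gt0 ha; have t0 := t_gt0 ha.
have ct1 : c ^+ 2 + t ^+ 2 = 1 by rewrite (sqr_c ha) (sqr_t ha); ring.
have xmin l : x0 <= x l.
  have [->//|lm] := eqVneq l ord_max.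
  have lm' : (l < (ord_max : 'I_k.+1))%N by rewrite ltn_neqAle lm leq_ord.
  exact: le_trans (ltW (xx' _)) (x'x lm').
near=> N.
have N0 : (0 < N)%N by near: N; exact: nbhs_infty_gt.
pose Y1 (s1 : spins (N1 p N)) : T N -> R := X1 N s1.
pose Y2 (v : spins (N1 p N) * spins (N2 p N)) : T N -> R := X2 N v.
have mY1 s1 : measurable_fun setT (Y1 s1) by exact: measurable_funPT.
have mY2 v : measurable_fun setT (Y2 v) by exact: measurable_funPT.
have lY1 s1 A : measurable A -> P N (Y1 s1 @^-1` A) = normal_prob 0 1 A.
  exact: hX1.
have lY2 v A : measurable A -> P N (Y2 v @^-1` A) = normal_prob 0 1 A.
  exact: hX2.
have iY : independent_family (P N) (grem_family Y1 Y2) by exact: hindep.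
pose al l := u_N N (x l); pose al' l := u_N N (x' l).
pose ga l := b l + c * s N; pose de l := b' l + c * s N.
have alal' l : al l < al' l by exact: u_N_mono.
have al0 : 0 < u_N N x0 by near: N; exact: u_N_gt0.
have xal l : u_N N x0 <= al l.
  by rewrite /al; have := xmin l; rewrite le_eqVlt => /predU1P[->//|/(u_N_mono N0)/ltW].
have al'al (l m : 'I_k.+1) : (l < m)%N -> al' m <= al l.
  move=> /x'x; rewrite /al /al' le_eqVlt => /predU1P[->//|/(u_N_mono N0)/ltW //].
exists (top_event Y1 Y2 c t (u_N N x0) al al' ga de); split.
- exact: measurable_top_event.
- pose q l := expR (- second_level_threshold a x0 (b' l) N ^+ 2 / 2) : R.
  pose pi l := cell_mass a (x l) (x' l) (b l) (b' l) N.
  have hq l : (normal_prob 0%R 1%R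
      `[((u_N N x0 - c * de l) / t)%R, +oo[%classic <= (q l)%:E)%E.
    apply: normal_prob_tail_expR.
    have : forall l, 1 <= second_level_threshold a x0 (b' l) N.
      near: N; apply: filter_forall => m; exact: second_level_threshold_ge1.
    exact.
  have pi0 l : 0 <= pi l.
    rewrite /pi /cell_mass mulr_ge0 ?le_max ?lexx// divr_ge0//.
      by rewrite subr_ge0 le_std_normal_pdf// ?(le_trans (ltW al0)) ?xal// ltW// alal'.
    by apply: le_trans (ltW (alal' l)); exact: le_trans (ltW al0) (xal l).
  have hpi l v : ((pi l)%:E <= P N [set w | `[al l, al' l[%classic (energy Y1 Y2 c t v w) /\
                          `[ga l, de l[%classic (Y1 v.1 w)])%E.
    have := energy_box_ge mY1 mY2 lY1 lY2 iY c0 t0 ct1 v (b l) (b' l)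
      (le_trans (ltW al0) (xal l)) (alal' l) (u_N_shift (x l) N) (u_N_shift (x' l) N).
    exact.
  pose Z := first_cut p a N; pose q0 := first_cut_tail p a N; pose q1 := cut_tail p a x0 N.
  have mZ : measurable Z by rewrite /Z /first_cut; case: ifP.
  have hq0 : (normal_prob 0%R 1%R (~` Z) <= q0%:E)%E.
    rewrite /Z /q0 /first_cut /first_cut_tail; case: ifP => _.
      by rewrite setCT (@measure0 _ _ _ (normal_prob 0 1)).
    have -> : ~` `]-oo, c * s N[%classic = `[c * s N, +oo[%classic by rewrite setCitvl.
    by apply: normal_prob_tail_le; rewrite mulr_gt0// beta_sqrt_gt0.
  have hq1 v : (P N [set w | (u_N N x0 <= energy Y1 Y2 c t v w)%R /\ Z (Y1 v.1 w)] <= q1%:E)%E.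
    rewrite /Z /q1 /first_cut /cut_tail; case: ifP => _.
      by rewrite mulr1; exact: (energy_tail_le mY1 mY2 lY1 lY2 iY t0 ct1).
    exact: (energy_left_tail_le mY1 mY2 lY1 lY2 iY c0 t0 ct1 v al0 (u_N_shift x0 N)).
  have n1_gt0 : 0 < (2 ^ N1 p N)%:R :> R by rewrite ltr0n expn_gt0.
  have n1n2 := n1n2E hp N.
  pose y := void_mass p a x0 N / (2 ^ N1 p N)%:R.
  have q00 : 0 <= q0.
    rewrite -lee_fin; apply: le_trans hq0.
    exact: (@measure_ge0 _ _ _ (normal_prob 0 1)).
  have q10 : 0 <= q1.
    rewrite -lee_fin; apply: le_trans (hq1 (config0 p N)); exact: measure_ge0.
  have yE : #|spins (N2 p N)|%:R * q1 + q0 <= y.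
    have e : void_mass p a x0 N = (2 ^ N1 p N)%:R * ((2 ^ N2 p N)%:R * q1 + q0).
      by rewrite /void_mass -n1n2 -/q1 -/q0 mulrDr mulrA.
    by rewrite card_spins /y e [leRHS]mulrC mulKf// gt_eqF.
  have y0 : 0 <= y.
    by apply: le_trans yE; rewrite addr_ge0// mulr_ge0.
  have y1 : y < 1.
    have : `|y| <= 2^-1.
      rewrite /y; near: N; move/cvgr0Pnorm_le : (void_mass_div_cvg0 hp ha hap x0); apply.
      by rewrite invr_gt0.
    by rewrite ger0_norm// => y2; apply: le_lt_trans y2 _; rewrite invf_lt1 ?ltr1n.
  have := top_event_ge mY1 mY2 lY1 lY2 iY c0 t0 xal al'al hq pi0 hpi mZ hq0 hq1 yE y0 (ltW y1).
  apply: le_trans; rewrite lee_fin !card_spins mulrA.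
  apply: (@le_trans _ _ (((2 ^ N1 p N) ^_ k.+1)%:R / (2 ^ N1 p N)%:R ^+ k.+1 *
    \prod_l (2 ^+ N * cell_mass a (x l) (x' l) (b l) (b' l) N * block_ratio p a x b' N l) *
    (1 - y) ^+ (2 ^ N1 p N))).
    rewrite /box_bound ler_wpM2l//; last by apply: exprn_1B_ge => //; rewrite expn_gt0.
    rewrite mulr_ge0 ?divr_ge0 ?exprn_ge0//; apply: prodr_ge0 => l _.
    apply: mulr_ge0; last by rewrite /block_ratio le_max lexx.
    by apply: mulr_ge0; [exact: exprn_ge0|exact: pi0].
  rewrite le_eqVlt; apply/orP; left; apply/eqP; congr (_ * _).
  have -> : \prod_l (2 ^+ N * cell_mass a (x l) (x' l) (b l) (b' l) N *
      block_ratio p a x b' N l) = ((2 ^ N1 p N)%:R * (2 ^ N2 p N)%:R) ^+ k.+1 *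
      \prod_l (pi l * Num.max 0 (1 - (2 ^ N2 p N)%:R * q l)).
    rewrite n1n2; under eq_bigr do rewrite -mulrA.
    by rewrite big_split/= prodr_const card_ord.
  rewrite exprMn -!mulrA; congr (_ * _); rewrite mulKf// expf_neq0// gt_eqF//.
move=> w sq /top_eventP [v [hv hlow]] /andP[pe so] l /=.
have vl : nth (config0 p N) sq l = v l.
  apply: (top_of_sorted (x := Xi a (X1 N) (X2 N) ^~ w) (x0 := u_N N x0)) => //.
  - move=> i j ij; have [vi _] := hv i; have [vj _] := hv j.
    move: vi vj; rewrite /= !in_itv/= => /andP[vi _] /andP[_ vj].
    exact: lt_le_trans vj (le_trans (al'al _ _ ij) vi).
  - move=> i; have [vi _] := hv i; move: vi; rewrite /= in_itv/= => /andP[vi _].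
    exact: le_trans (xal i) vi.
rewrite vl; have [] := hv l; rewrite /= !in_itv/= => /andP[h1 h2] /andP[h3 h4].
split.
  rewrite u_N_inv_mono// h1/= ltNge u_N_inv_mono// -ltNge; exact: h2.
have -> : Num.sqrt (a * N%:R) * beta_star R = c * s N.
  by rewrite /beta_sqrt sqrtrM ?(ltW a0)// -mulrA [_ * beta_star R]mulrC.
by rewrite lerBrDr h3/= ltrBlDr.
Unshelve. all: by end_near. Qed.

End box_lower_bound.

(** * Poisson voids and marked points *)

Section exp_intensity.
Context {R : realType} (K : R) (K0 : 0 <= K).
Local Notation mu := (@lebesgue_measure R).

Lemma continuous_exp_density : continuous (fun x : R => K * expR (- x)).
Proof.
move=> x; apply: cvgMr; apply: (@continuous_comp _ _ _ -%R expR).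
  exact: opp_continuous.
exact: continuous_expR.
Qed.

Lemma measurable_exp_density (A : set R) :
  measurable_fun A (fun x => (K * expR (- x))%:E).
Proof.
apply/measurable_EFinP; apply: measurable_funTS; apply: continuous_measurable_fun.
exact: continuous_exp_density.
Qed.

Lemma exp_density_ge0 (x : R) : (0%R <= (K * expR (- x))%:E)%E.
Proof. by rewrite lee_fin mulr_ge0// expR_ge0. Qed.

Lemma exp_intensity_ray (x : R) : exp_intensity K `[x, +oo[%classic = (K * expR (- x))%:E.
Proof.
have dF (y : R) : is_derive y 1 (fun y => - (K * expR (- y))) (K * expR (- y)).
  have -> : (fun y => - (K * expR (- y))) = (fun y => (- K) * (expR \o -%R) y).
    by apply/funext => z; rewrite mulNr.
  by apply: is_derive_eq; rewrite /GRing.scale/=; ring.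
rewrite /exp_intensity (@ge0_continuous_FTC2y _ _ (fun y => - (K * expR (- y))) x 0)//.
- by rewrite -EFinB opprK add0r.
- by move=> y _; rewrite mulr_ge0// expR_ge0.
- by apply: continuous_subspaceT; exact: continuous_exp_density.
- rewrite -[X in _ --> X]oppr0; apply: cvgN.
  by rewrite -[X in _ --> X](mulr0 K); apply: cvgMr; exact: cvgr_expR.
- by apply: cvg_at_right_filter; apply: cvgN; exact: continuous_exp_density.
- by move=> y _; rewrite derive1E; have [_ ->] := dF y.
Qed.

Lemma exp_intensityU (A B : set R) : measurable A -> measurable B -> A `&` B = set0 ->
  (exp_intensity K (A `|` B) = exp_intensity K A + exp_intensity K B)%E.
Proof.
move=> mA mB AB; rewrite /exp_intensity ge0_integral_setU//.
- exact: measurable_exp_density.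
- by move=> x _; exact: exp_density_ge0.
- exact/eqP.
Qed.

Lemma exp_intensity_itv (x y : R) : x <= y ->
  exp_intensity K `[x, y[%classic = (K * (expR (- x) - expR (- y)))%:E.
Proof.
move=> xy; have := @exp_intensityU `[x, y[ `[y, +oo[.
rewrite -itv_bndbnd_setU ?bnd_simp// !exp_intensity_ray => h.
have : (exp_intensity K `[x, y[%classic + (K * expR (- y))%:E = (K * expR (- x))%:E)%E.
  rewrite h//; apply/seteqP; split => // z /=.
  by rewrite !in_itv/= andbT => -[/andP[_ zy]]; rewrite leNgt zy.
case: (exp_intensity K _) => // r; rewrite -EFinD => -[e].
by congr EFin; rewrite mulrBr; lra.
Qed.

Lemma exp_intensity_bigsetU (k : nat) (I : 'I_k -> set R) :
  (forall l, measurable (I l)) -> trivIset setT I ->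
  (exp_intensity K (\big[setU/set0]_l I l) = \sum_l exp_intensity K (I l))%E.
Proof.
move=> mI tI; rewrite /exp_intensity ge0_integral_bigsetU//.
- exact: index_enum_uniq.
- exact: sub_trivIset tI.
- exact: measurable_exp_density.
- by move=> x _; exact: exp_density_ge0.
Qed.

End exp_intensity.

Lemma trivIset_decreasing (R : realType) (k : nat) (x x' : 'I_k -> R) :
  (forall l m : 'I_k, (l < m)%N -> x' m <= x l) ->
  trivIset setT (fun l => `[x l, x' l[%classic).
Proof.
move=> x'x; apply/trivIsetP => l m _ _ lm; apply/seteqP; split => // z /=.
rewrite !in_itv/= => -[/andP[a1 a2] /andP[b1 b2]].
case: (ltngtP l m) => [lm'|ml'|/val_inj e]; last by rewrite e eqxx in lm.
  by have := lt_le_trans b2 (le_trans (x'x _ _ lm') a1); rewrite ltxx.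
by have := lt_le_trans a2 (le_trans (x'x _ _ ml') b1); rewrite ltxx.
Qed.

Section poisson_voids.
Context d (T : measurableType d) (R : realType) (Q : probability T R).
Context (xi : nat -> {RV Q >-> R}) (K : R) (K0 : 0 <= K).
Hypothesis hxi : ranked_poisson_process (exp_intensity K) xi.

Definition void (A : set R) : set T := \bigcap_i (xi i @^-1` ~` A).

Lemma measurable_void A : measurable A -> measurable (void A).
Proof.
move=> mA; apply: bigcapT_measurable => i; rewrite -[X in measurable X]setTI.
by apply: measurable_funPT => //; exact: measurableC.
Qed.

Lemma point_count_eq0 A : [set w | point_count (fun i => xi i : T -> R) A w = 0%E] = void A.
Proof.
apply/seteqP; split => w /=; rewrite /point_count /counting.
  case: asboolP => // fin [/eqP]; rewrite pnatr_eq0 finmap.cardfs_eq0 => /eqP e i _ Ai.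
  have : [set i | A (xi i w)] i by [].
  by rewrite -(fset_setK fin) e /= finmap.in_fset0.
move=> h; have -> : [set i | A (xi i w)] = set0.
  by apply/seteqP; split => // i Ai; exact: (h i).
by case: asboolP => [_|[]//]; rewrite fset_set0 finmap.cardfs0.
Qed.

Lemma void_prob (A : set R) (r : R) : measurable A -> exp_intensity K A = r%:E ->
  Q (void A) = (expR (- r))%:E.
Proof.
move=> mA Ar; have [_ [hc _ _]] := hxi.
have r0 : 0 <= r.
  rewrite -lee_fin -Ar; apply: integral_ge0 => x _.
  by rewrite lee_fin mulr_ge0// expR_ge0.
have := hc A 0%N mA; rewrite Ar => /(_ isT); rewrite point_count_eq0 => ->.
rewrite /poisson_prob /=; case: ifPn => r1.
  by rewrite esum_set1 /poisson_pmf ?r1 ?expr0 ?fact0 ?invr1 ?mul1r// lee_fin expR_ge0.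
have -> : r = 0 by apply/eqP; rewrite eq_le r0 leNgt r1.
by rewrite oppr0 expR0 diracE mem_set.
Qed.

Lemma voids_independent (m : nat) (A : 'I_m -> set R) (b : 'I_m -> bool) :
  (forall j, measurable (A j)) -> trivIset setT A ->
  (Q (\big[setI/setT]_j (if b j then void (A j) else ~` void (A j))) =
   \prod_j Q (if b j then void (A j) else ~` void (A j)))%E.
Proof.
move=> mA tA; have [_ [_ _ hind]] := hxi.
have := hind m A mA tA (index_enum 'I_m) (index_enum_uniq _).
rewrite -bigcap_seqE; apply => j _.
exists (if b j then [set 0%E] else ~` [set 0%E]).
  by case: (b j) => //; exact: measurableC.
rewrite setTI -point_count_eq0; by case: (b j).
Qed.

(** A cell of intensity [lam] is hit with probability [1 - expR (- lam)], bounded by [lam]; the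
    exponential is the void probability of the ray outside the cells. *)
Lemma top_points_le (k : nat) (x x' : 'I_k.+1 -> R) :
  (forall l, x l < x' l) -> (forall l m : 'I_k.+1, (l < m)%N -> x' m <= x l) ->
  (Q [set w | forall l : 'I_k.+1, (x l <= xi l w < x' l)%R] <=
   (\prod_l (K * (expR (- x l) - expR (- x' l))) *
    expR (- (K * expR (- x ord_max) -
             \sum_l K * (expR (- x l) - expR (- x' l)))))%:E)%E.
Proof.
move=> xx' x'x.
pose I (l : 'I_k.+1) := `[x l, x' l[%classic : set R.
have mI l : measurable (I l) by exact: measurable_itv.
have tI : trivIset setT I by exact: trivIset_decreasing.
pose lam (l : 'I_k.+1) := K * (expR (- x l) - expR (- x' l)).
have lamE l : exp_intensity K (I l) = (lam l)%:E.
  by rewrite exp_intensity_itv// ltW.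
pose U := \big[setU/set0]_l I l.
have mU : measurable U by exact: bigsetU_measurable.
pose D := `[x ord_max, +oo[%classic `\` U : set R.
have mD : measurable D by exact: measurableD.
have xmin l : x ord_max <= x l.
  have [->//|lm] := eqVneq l ord_max.
  have lm' : (l < (ord_max : 'I_k.+1))%N by rewrite ltn_neqAle lm leq_ord.
  exact: le_trans (ltW (xx' _)) (x'x _ _ lm').
have UD : D `|` U = `[x ord_max, +oo[%classic.
  rewrite setUC /D setDUK// /U -bigcup_seq => z [l _]; rewrite /I/= !in_itv/= andbT => /andP[+ _].
  exact: le_trans.
have DE : exp_intensity K D = (K * expR (- x ord_max) - \sum_l lam l)%:E.
  have := @exp_intensityU _ K K0 D U mD mU.
  rewrite UD exp_intensity_ray// exp_intensity_bigsetU// => h.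
  have : ((K * expR (- x ord_max))%:E = exp_intensity K D + (\sum_l lam l)%:E)%E.
    rewrite h; last by rewrite /D setDE -setIA setICl setI0.
    by rewrite -sumEFin; congr (_ + _)%E; apply: eq_bigr => l _; exact: lamE.
  by case: (exp_intensity K D) => // r; rewrite -EFinD => -[->]; rewrite addrK.
(* Index 0 carries the part of the ray outside the cells, the others the cells; [b] below asks for a
   void at index 0 only. *)
pose A (j : 'I_k.+2) := if unlift ord0 j is Some l then I l else D.
have mA j : measurable (A j) by rewrite /A; case: unlift.
have tA : trivIset setT A.
  apply/trivIsetP => i j _ _ ij; rewrite /A.
  have DI l : D `&` I l = set0.
    apply/seteqP; split => // z [[_ nU] Iz]; apply: nU.
    by rewrite /U -bigcup_seq; exists l => //=; rewrite mem_index_enum.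
  case: unliftP ij => [l ->|->]; case: unliftP => [m ->|->]; rewrite ?eqxx//.
  - rewrite (inj_eq lift_inj) => lm; move/trivIsetP : tI; exact.
  - by move=> _; rewrite setIC.
pose b (j : 'I_k.+2) := ~~ unlift ord0 j.
have := voids_independent b mA tA; rewrite big_ord_recl [X in _ = X -> _]big_ord_recl.
rewrite /b /A unlift_none/= => h.
have [[M [mM M0 subM]] _] := hxi.
apply: (@le_trans _ _ (Q (void D `&` \big[setI/setT]_l ~` void (I l)))).
  set V := void D `&` _.
  have mV : measurable V.
    apply: measurableI; first exact: measurable_void.
    by apply: bigsetI_measurable => l _; apply: measurableC; exact: measurable_void.
  have mS : measurable [set w | forall l : 'I_k.+1, x l <= xi l w < x' l].
    have -> : [set w | forall l : 'I_k.+1, x l <= xi l w < x' l] =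
        \big[setI/setT]_(l : 'I_k.+1) (xi l @^-1` I l).
      rewrite -bigcap_seqE; apply/seteqP; split => w /= hw l; first by move=> _; exact: hw.
      exact: hw (mem_index_enum l).
    apply: bigsetI_measurable => l _; rewrite -[X in measurable X]setTI.
    exact: measurable_funPT.
  apply: (@le_trans _ _ (Q (V `|` M))); last first.
    by rewrite measureU0.
  apply: le_measure; rewrite ?inE//; first exact: measurableU.
  move=> w hw; have [Mw|nMw] := pselect (M w); [by right|left].
  have dec : forall i, xi i.+1 w < xi i w.
    by apply: contrapT => nd; apply: nMw; exact: subM.
  split; last first.
    rewrite -bigcap_seqE => l _ vl; apply: (vl l) => //.
    by rewrite /I/= in_itv/=; exact: hw.
  move=> i _ [xD nU]; apply: nU.
  rewrite /U -bigcup_seq.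
  have [ik|ki] := ltnP i k.+1.
    exists (Ordinal ik); first by rewrite /= mem_index_enum.
    by rewrite /I/= in_itv/=; exact: (hw (Ordinal ik)).
  (* A later point that is still in the ray lies below [xi ord_max], hence in the last cell. *)
  exists ord_max; first by rewrite /= mem_index_enum.
  rewrite /I/= in_itv/=; move: xD; rewrite /= in_itv/= andbT => ->/=.
  have /andP[_] := hw ord_max; apply: le_lt_trans.
  have dec2 j n : xi (j + n)%N w <= xi j w.
    by elim: n => [|n IH]; rewrite ?addn0// addnS (le_trans (ltW (dec _))).
  by rewrite -(subnKC (ltnW ki)) /=; exact: dec2.
have -> : (Q (void D `&` \big[setI/setT]_l ~` void (I l)) =
    Q (void D) * \prod_l Q (~` void (I l)))%E.
  move: h; under eq_bigr do rewrite liftK/=.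
  by under [in RHS]eq_bigr do rewrite liftK/=.
rewrite (void_prob mD DE).
have vI l : (Q (~` void (I l)) = (1 - expR (- lam l))%:E)%E.
  by rewrite probability_setC ?(void_prob (mI l) (lamE l))//; exact: measurable_void.
rewrite (eq_bigr _ (fun l _ => vI l)) prodEFin -EFinM lee_fin mulrC.
rewrite ler_wpM2r ?expR_ge0//; apply: ler_prod => l _.
have lam0 : 0 <= lam l.
  by rewrite mulr_ge0// subr_ge0 ler_expR lerN2 ltW.
rewrite subr_ge0 -[leRHS]expR0 ler_expR oppr_le0 lam0/=.
by rewrite lerBlDr -lerBlDl; apply: le_trans (expR_ge1Dx _).
Qed.

End poisson_voids.

Section marked_points.
Context d (T : measurableType d) (R : realType) (Q : probability T R).
Context (k : nat) (xi : nat -> {RV Q >-> R}) (W : 'I_k.+1 -> {RV Q >-> R}).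
Hypothesis hind : independent_marks Q (fun i => xi i) (fun j => W j).
Context (p a : R).
Local Notation K := (limit_rate p a).
Local Notation nu := (normal_prob 0 (Num.sqrt (1 - a))).

Lemma limit_rate_ge0 : 0 <= K.
Proof. by rewrite /limit_rate; case: ifP => _; rewrite ?invr_ge0. Qed.

Hypothesis hxi : ranked_poisson_process (exp_intensity K) xi.
Variables (x x' b b' : 'I_k.+1 -> R).
Hypothesis xx' : forall l, x l < x' l.
Hypothesis x'x : forall l m : 'I_k.+1, (l < m)%N -> x' m <= x l.
Hypothesis hW : forall l,
  K * fine (Q (W l @^-1` `[b l, b' l[)) = fine (nu `[b l, b' l[%classic).

Definition marked_box : set T :=
  [set w | forall l : 'I_k.+1, x l <= xi l w < x' l /\ b l <= W l w < b' l].

Let S := [set w | forall l : 'I_k.+1, x l <= xi l w < x' l].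

Let top_box_bigsetI : S = \big[setI/setT]_(l : 'I_k.+1) (xi l @^-1` `[x l, x' l[%classic).
Proof.
rewrite -bigcap_seqE; apply/seteqP; split => w /= hw l.
  by move=> _; rewrite /= in_itv/=; exact: hw.
by have := hw l (mem_index_enum l); rewrite /= in_itv.
Qed.

Lemma marked_box_prob : (Q marked_box = Q S * \prod_l Q (W l @^-1` `[b l, b' l[))%E.
Proof.
pose s : seq (option 'I_k.+1) := None :: map Some (index_enum 'I_k.+1).
have us : uniq s.
  rewrite /s /= map_inj_uniq ?index_enum_uniq ?andbT; last by move=> ? ? [].
  by apply/negP => /mapP[].
have := hind us (E := fun o => if o is Some l then W l @^-1` `[b l, b' l[ else S).
rewrite bigcap_seqE /s !big_cons !big_map => <-; last first.
  case=> [l|] _; first by exists `[b l, b' l[%classic => //; rewrite setTI.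
  rewrite top_box_bigsetI.
  apply: g_sigma_bigsetI => l _; apply: sub_sigma_algebra; exists (nat_of_ord l) => //.
  by exists `[x l, x' l[%classic => //; rewrite setTI.
congr (Q _); apply/seteqP; split => w /=.
  move=> h; split; first by move=> l; have [] := h l.
  by rewrite -bigcap_seqE => l _; rewrite /= in_itv/=; have [] := h l.
by move=> [h1]; rewrite -bigcap_seqE => h2 l; split; [exact: h1|];
  have := h2 l (mem_index_enum l); rewrite /= in_itv.
Qed.

(** By [hW], the factor [K] of each cell and the law of its mark combine into the Gaussian mass of
    [cell_limit]; the exponential prefactor removes the surplus left by [top_points_le]. *)
Lemma marked_box_le :
  expR (- \sum_l K * (expR (- x l) - expR (- x' l))) * fine (Q marked_box) <=
  box_limit p a x x' b b'.
Proof.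
have K0 := limit_rate_ge0.
rewrite marked_box_prob.
have fW l : Q (W l @^-1` `[b l, b' l[) \is a fin_num.
  apply: fin_num_measure; rewrite -[X in measurable X]setTI; exact: measurable_funPT.
have S_le := top_points_le K0 hxi xx' x'x.
have mS : measurable S.
  rewrite top_box_bigsetI.
  apply: bigsetI_measurable => l _; rewrite -[X in measurable X]setTI.
  exact: measurable_funPT.
have fS : Q S \is a fin_num by exact: fin_num_measure.
have prodW : (\prod_l Q (W l @^-1` `[b l, b' l[) =
    (\prod_l fine (Q (W l @^-1` `[b l, b' l[)))%:E)%E.
  by rewrite -prodEFin; apply: eq_bigr => l _; rewrite fineK.
rewrite prodW -(fineK fS) -EFinM /=.
have {}S_le : fine (Q S) <= \prod_l (K * (expR (- x l) - expR (- x' l))) *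
    expR (- (K * expR (- x ord_max) - \sum_l K * (expR (- x l) - expR (- x' l)))).
  by rewrite -lee_fin fineK.
have W0 : 0 <= \prod_l fine (Q (W l @^-1` `[b l, b' l[)).
  by apply: prodr_ge0 => l _; exact: fine_ge0.
apply: (@le_trans _ _ (expR (- \sum_l K * (expR (- x l) - expR (- x' l))) *
  ((\prod_l (K * (expR (- x l) - expR (- x' l))) *
    expR (- (K * expR (- x ord_max) - \sum_l K * (expR (- x l) - expR (- x' l))))) *
   \prod_l fine (Q (W l @^-1` `[b l, b' l[))))).
  by rewrite ler_pM2l ?expR_gt0// ler_wpM2r.
rewrite le_eqVlt; apply/orP; left; apply/eqP.
rewrite /box_limit /cell_limit.
have -> : \prod_l ((expR (- x l) - expR (- x' l)) * fine (nu `[b l, b' l[%classic)) =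
    \prod_l (K * (expR (- x l) - expR (- x' l))) *
    \prod_l fine (Q (W l @^-1` `[b l, b' l[)).
  by rewrite -big_split/=; apply: eq_bigr => l _; rewrite -hW mulrCA mulrA.
set A := \prod_l _; set B := \prod_l _; set L := \sum_l _.
have -> : expR (- (K * expR (- x ord_max))) =
    expR (- L) * expR (- (K * expR (- x ord_max) - L)).
  by rewrite -expRD; congr expR; ring.
ring.
Qed.

End marked_points.

(* Measurability is not assumed: as [sigma] is arbitrary, a continuous function
   of [top_vector] need not be measurable. *)
Lemma monotone_integral d (T : measurableType d) (R : realType)
    (mu : {measure set T -> \bar R}) (f g : T -> \bar R) :
  (forall w, f w <= g w)%E -> (\int[mu]_w f w <= \int[mu]_w g w)%E.
Proof.
move=> fg; rewrite /integral; apply: leeB; apply: ereal_sup_le => _ [h hf <-].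
  exists h => // w; apply: le_trans (hf w) _.
  by rewrite !patch_setT; apply: (@funepos_le _ _ setT); rewrite ?in_setT.
exists h => // w; apply: le_trans (hf w) _.
by rewrite !patch_setT; apply: (@funeneg_le _ _ setT); rewrite ?in_setT.
Qed.

Lemma indic_sum_le (T : Type) (R : realType) (I : finType) (c : I -> R)
    (A : I -> set T) (y : R) (w : T) :
  0 <= y -> (forall i j, A i w -> A j w -> i = j) -> (forall i, A i w -> c i <= y) ->
  \sum_i c i * \1_(A i) w <= y.
Proof.
move=> y0 dA cy; have [[i Ai]|nA] := pselect (exists i, A i w).
  rewrite (bigD1 i)//= big1 ?addr0 ?indicE ?mem_set ?mulr1//; first exact: cy.
  move=> j ji; rewrite indicE memNset ?mulr0// => Aj.
  by move/eqP : ji; apply; exact: dA.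
by rewrite big1// => i _; rewrite indicE memNset ?mulr0// => Ai; apply: nA; exists i.
Qed.

Lemma conull_setI d (T : measurableType d) (R : realType) (P : probability T R)
    (A M : set T) : measurable A -> measurable M -> P M = 1%E -> P (A `&` M) = P A.
Proof.
move=> mA mM PM; have PMc : P (~` M) = 0%E by rewrite probability_setC// PM subee.
rewrite -[in RHS](setUIDK A M) measureU//.
- rewrite [X in (_ + X)%E](_ : _ = 0%E) ?adde0//.
  apply: (@subset_measure0 _ _ _ P (A `\` M) (~` M)) => //.
  + exact: measurableD.
  + exact: measurableC.
- exact: measurableI.
- exact: measurableD.
- by apply/seteqP; split => // w [[_ Mw] [_ nMw]].
Qed.

Section indicator_sums.
Context d (T : measurableType d) (R : realType) (P : probability T R).
Context (I : finType) (c : I -> R) (U : I -> set T).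
Hypothesis mU : forall i, measurable (U i).

Let integrable_summand i : P.-integrable setT (fun w => (c i * \1_(U i) w)%:E).
Proof.
under eq_fun do rewrite EFinM.
by apply: integrableZl => //; exact: integrable_indic.
Qed.

Lemma integrable_indic_sum :
  P.-integrable setT (EFin \o (fun w => \sum_i c i * \1_(U i) w)).
Proof.
have -> : EFin \o (fun w => \sum_i c i * \1_(U i) w) =
    (fun w => \sum_i (c i * \1_(U i) w)%:E)%E.
  by apply/funext => w; rewrite /= sumEFin.
exact: integrable_sum.
Qed.

Lemma integral_indic_sum :
  (\int[P]_w (\sum_i (c i * \1_(U i) w)%R)%:E = (\sum_i c i * fine (P (U i)))%:E)%E.
Proof.
under eq_integral do rewrite -sumEFin.
rewrite integral_sum// -sumEFin; apply: eq_bigr => i _.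
under eq_integral do rewrite EFinM.
rewrite integralZl//; last exact: integrable_indic.
by rewrite integral_indic// setIT EFinM fineK// fin_num_measure.
Qed.

End indicator_sums.

Section expectation_bounds.
Context d (T : measurableType d) (R : realType) (P : probability T R).
Context (I : finType) (c : I -> R) (U : I -> set T) (M : set T).
Hypothesis mU : forall i, measurable (U i).
Hypothesis mM : measurable M.
Hypothesis PM : P M = 1%E.

Let step (w : T) : R := \sum_i c i * \1_(U i `&` M) w.

Let mUM i : measurable (U i `&` M).
Proof. exact: measurableI. Qed.

Let integrable_step : P.-integrable setT (EFin \o step).
Proof. exact: integrable_indic_sum. Qed.

Let integral_step : (\int[P]_w (step w)%:E = (\sum_i c i * fine (P (U i)))%:E)%E.
Proof.
rewrite integral_indic_sum//; congr EFin; apply: eq_bigr => i _.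
by rewrite (conull_setI (mU i) mM PM).
Qed.

Let integral_constant (C : R) : (\int[P]_w C%:E = C%:E)%E.
Proof.
rewrite integral_cst// [X in (_ * X)%E](_ : _ = 1%E) ?mule1//.
exact: probability_setT.
Qed.

Lemma expectation_ge (h : T -> R) (C : R) : (forall w, step w <= h w + C) ->
  ((\sum_i c i * fine (P (U i)) - C)%:E <= \int[P]_w (h w)%:E)%E.
Proof.
move=> hh; apply: (@le_trans _ _ (\int[P]_w ((step w)%:E - C%:E))%E).
  rewrite integralB//; last exact: finite_measure_integrable_cst.
  by rewrite integral_step integral_constant EFinB.
by apply: monotone_integral => w; rewrite -EFinB lee_fin lerBlDr.
Qed.

Lemma expectation_le (h : T -> R) (C : R) : (forall w, step w <= C - h w) ->
  (\int[P]_w (h w)%:E <= (C - \sum_i c i * fine (P (U i)))%:E)%E.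
Proof.
move=> hh; apply: (@le_trans _ _ (\int[P]_w (C%:E - (step w)%:E))%E); last first.
  rewrite integralB//; last exact: finite_measure_integrable_cst.
  by rewrite integral_step integral_constant EFinB.
by apply: monotone_integral => w; rewrite -EFinB lee_fin lerBrDr -lerBrDl.
Qed.

End expectation_bounds.

(** * Convergence in distribution from lower bounds on boxes *)

Section grid.
Context {R : realType} {q r : nat}.

Definition mesh (n : nat) : R := n.+1%:R^-1.

Definition corner (n : nat) (j : nat) : R := j%:R * mesh n - n.+1%:R.

(** Cells of side [1 / n.+1] cover each coordinate from [- n.+1] to [n.+1], hence [2 * n.+1 ^ 2] of
    them: the mesh shrinks while the window grows. *)
Definition grid (n : nat) := 'M['I_(2 * n.+1 ^ 2)]_(q, r).

Definition grid_box (n : nat) (B : grid n) : set 'M[R]_(q, r) :=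
  [set A | forall i j, corner n (B i j) <= A i j < corner n (B i j) + mesh n].

Lemma mesh_gt0 n : 0 < mesh n.
Proof. by rewrite invr_gt0. Qed.

Lemma corner_succ n j : corner n j + mesh n = corner n j.+1.
Proof. by rewrite /corner -[in RHS]natr1; ring. Qed.

Lemma corner_lt n i j : (corner n i < corner n j) = (i < j)%N.
Proof. by rewrite /corner ltrD2r ltr_pM2r ?mesh_gt0// ltr_nat. Qed.

Lemma corner_uniq n i j y : corner n i <= y < corner n i + mesh n ->
  corner n j <= y < corner n j + mesh n -> i = j.
Proof.
rewrite !corner_succ => /andP[h1 h2] /andP[h3 h4]; apply/eqP; rewrite eqn_leq.
have := le_lt_trans h1 h4; have := le_lt_trans h3 h2.
by rewrite !corner_lt !ltnS => -> ->.
Qed.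

Lemma grid_box_uniq n (B B' : grid n) A : grid_box B A -> grid_box B' A -> B = B'.
Proof.
move=> h h'; apply/matrixP => i j; apply/val_inj => /=.
exact: corner_uniq (h i j) (h' i j).
Qed.

Lemma corner_ex n (y : R) : `|y| < n.+1%:R ->
  exists2 j, (j < 2 * n.+1 ^ 2)%N & corner n j <= y < corner n j + mesh n.
Proof.
rewrite ltr_norml => /andP[y1 y2].
have n0 : 0 < n.+1%:R :> R by [].
have e0 : 0 <= (y + n.+1%:R) * n.+1%:R by apply: mulr_ge0 => //; lra.
exists (Num.truncn ((y + n.+1%:R) * n.+1%:R)).
  rewrite truncn_lt_nat//.
  have -> : (2 * n.+1 ^ 2)%:R = (n.+1%:R + n.+1%:R) * n.+1%:R :> R.
    by rewrite natrM natrX; ring.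
  by rewrite ltr_pM2r// ltrD2r.
have /andP[h1 h2] := truncn_itv e0.
rewrite corner_succ /corner /mesh lerBlDr ler_pdivrMr// h1 ltrBrDr.
by rewrite ltr_pdivlMr// h2.
Qed.

Lemma near_grid_box (A : 'M[R]_(q, r)) :
  \forall n \near \oo, exists B : grid n, grid_box B A.
Proof.
have : \forall n \near \oo, forall i : 'I_q * 'I_r, `|A i.1 i.2| < n.+1%:R.
  apply: filter_forall => i.
  near=> n; apply: (@lt_le_trans _ _ n%:R); last by rewrite ler_nat.
  near: n; exact: nbhs_infty_gtr.
apply: filterS => n h.
have hc (i : 'I_q * 'I_r) : exists j : 'I_(2 * n.+1 ^ 2),
    corner n j <= A i.1 i.2 < corner n j + mesh n.
  by have [j lj hj] := corner_ex (h i); exists (Ordinal lj).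
have [c hc'] := choice hc.
by exists (\matrix_(i, j) c (i, j)) => i j; rewrite mxE; exact: hc' (i, j).
Unshelve. all: by end_near. Qed.

Variable g : 'M[R]_(q, r) -> R.
Hypothesis g0 : forall A, 0 <= g A.
Hypothesis gc : continuous g.

Definition box_inf n (B : grid n) : R := inf (g @` grid_box B).

Lemma box_inf_le n (B : grid n) A : grid_box B A -> box_inf B <= g A.
Proof.
move=> BA; apply: ge_inf; last by exists A.
by exists 0 => _ [A' _ <-].
Qed.

Lemma box_inf_ge0 n (B : grid n) : 0 <= box_inf B.
Proof.
have [[A BA]|nB] := pselect (exists A, grid_box B A).
  by apply: lb_le_inf; [exists (g A); exists A|move=> _ [A' _ <-]].
rewrite /box_inf (_ : g @` _ = set0) ?inf0//.
by apply/seteqP; split => // y [A BA _]; apply: nB; exists A.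
Qed.

Lemma mesh_cvg0 : mesh n @[n --> \oo] --> 0.
Proof. exact: cvg_harmonic. Qed.

Lemma near_mesh_lt (e : R) : 0 < e -> \forall n \near \oo, mesh n < e.
Proof. by move=> e0; move/cvgr_lt : mesh_cvg0; exact. Qed.

Lemma near_box_inf_ge (A : 'M[R]_(q, r)) (e : R) : 0 < e ->
  \forall n \near \oo, forall B : grid n, grid_box B A -> g A - e <= box_inf B.
Proof.
move=> e0; have /cvgrPdist_le/(_ _ e0)/= := @gc A.
move=> /nbhs_ballP[dl /= dl0 hdl].
near=> n => B BA.
apply: lb_le_inf; first by exists (g A); exists A.
move=> _ [A' BA' <-].
have : ball A dl A'.
  split => // i j; have := BA i j; have := BA' i j => /andP[h1 h2] /andP[h3 h4].
  rewrite /ball/= (@lt_trans _ _ (mesh n))//; last by near: n; exact: near_mesh_lt.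
  by rewrite ltr_norml; apply/andP; split; lra.
move/hdl => /=; rewrite ler_norml => /andP[_]; lra.
Unshelve. all: by end_near. Qed.

(** For large [n] exactly one box contains [A]; its infimum tends to [g A] by continuity and its
    weight to 1. *)
Lemma grid_sum_cvg (v : forall n, grid n -> R) (A : 'M[R]_(q, r)) :
  (forall n (B : grid n), v n B <= 1) ->
  (forall e, 0 < e -> \forall n \near \oo, forall B : grid n, grid_box B A ->
     1 - e <= v n B) ->
  \sum_(B : grid n) box_inf B * v n B * \1_(grid_box B) A @[n --> \oo] --> g A.
Proof.
move=> v1 hv; apply/cvgrPdist_le => e e0.
have e1 : 0 < e / 2 by rewrite divr_gt0.
have e2 : 0 < e / 2 / (g A + 1) by rewrite divr_gt0// ltr_wpDl.
near=> n.
have [B BA] : exists B : grid n, grid_box B A by near: n; exact: near_grid_box.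
rewrite (bigD1 B)//= big1 ?addr0; last first.
  move=> B' B'B; rewrite indicE memNset ?mulr0// => BA'.
  by rewrite (grid_box_uniq BA BA') eqxx in B'B.
rewrite indicE mem_set// mulr1.
have h1 : g A - e / 2 <= box_inf B.
  by apply: (near (near_box_inf_ge A e1)) => //; near: n.
have h2 : 1 - e / 2 / (g A + 1) <= v n B.
  by apply: (near (hv _ e2)) => //; near: n.
have h3 := box_inf_le BA; have h4 := v1 n B; have h5 := box_inf_ge0 B.
have h6 := g0 A.
have h7 : box_inf B * v n B <= box_inf B by rewrite ler_piMr.
have h8 : box_inf B * (1 - v n B) <= e / 2.
  apply: (@le_trans _ _ ((g A + 1) * (e / 2 / (g A + 1)))).
    by apply: ler_pM => //; [lra|lra|lra].
  by rewrite mulrC divfK// gt_eqF// ltr_wpDl.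
rewrite ger0_norm; last by lra.
have -> : box_inf B * v n B = box_inf B - box_inf B * (1 - v n B) by ring.
lra.
Unshelve. all: by end_near. Qed.

End grid.

Section grid_expectation.
Context d (T : measurableType d) (R : realType) (Q : probability T R).
Context {q r : nat} (Y : T -> 'M[R]_(q, r)).
Hypothesis mY : forall i j, measurable_fun setT (fun w => Y w i j).

Lemma measurable_grid_box n (B : @grid q r n) : measurable (Y @^-1` grid_box B).
Proof.
pose S (ij : 'I_q * 'I_r) := (fun w => Y w ij.1 ij.2) @^-1`
  `[@corner R n (B ij.1 ij.2), corner n (B ij.1 ij.2) + mesh n[%classic.
have -> : Y @^-1` grid_box B = \big[setI/setT]_ij S ij.
  rewrite -bigcap_seqE; apply/seteqP; split => w /= h.
    by move=> ij _; rewrite /S/= in_itv/=; exact: h.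
  by move=> i j; have := h (i, j) (mem_index_enum _); rewrite /S/= in_itv.
apply: bigsetI_measurable => ij _; rewrite -[X in measurable X]setTI.
exact: mY.
Qed.

Variable g : 'M[R]_(q, r) -> R.
Hypothesis g0 : forall A, 0 <= g A.
Hypothesis gc : continuous g.

Let grid_fun (v : forall n, @grid q r n -> R) n w : R :=
  \sum_(B : grid n) box_inf g B * v n B * \1_(grid_box B) (Y w).

Let measurable_grid_fun v n : measurable_fun setT (grid_fun v n).
Proof.
apply: measurable_sum => B; apply: measurable_funM => //.
exact: (measurable_indic (measurable_grid_box B)).
Qed.

(** Only the coordinates of [Y] are known to be measurable; [g \o Y] is the pointwise limit of step
    functions on the grids, with all weights equal to 1. *)
Lemma measurable_continuous_mx : measurable_fun setT (g \o Y).
Proof.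
apply/measurable_EFinP.
apply: (@emeasurable_fun_cvg _ _ _ _ (fun n w => (grid_fun (fun _ _ => 1) n w)%:E)).
  by move=> n; apply/measurable_EFinP.
move=> w _; apply/cvg_EFin; first exact: nearW.
by apply: grid_sum_cvg => // e e0; apply: nearW => n B _; rewrite gerBl ltW.
Qed.

Lemma grid_expectation_cvg (v : forall n, @grid q r n -> R) (C : R) :
  (forall A, g A <= C) -> (forall n (B : grid n), 0 <= v n B <= 1) ->
  {ae Q, forall w, forall e, 0 < e ->
     \forall n \near \oo, forall B : grid n, grid_box B (Y w) -> 1 - e <= v n B} ->
  ((\sum_(B : grid n) box_inf g B * v n B * fine (Q (Y @^-1` grid_box B)))%:E
     @[n --> \oo] --> \int[Q]_w (g (Y w))%:E)%E.
Proof.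
move=> gC v01 hv.
have C0 : 0 <= C by exact: le_trans (g0 0) (gC 0).
have E n : ((\sum_(B : grid n) box_inf g B * v n B * fine (Q (Y @^-1` grid_box B)))%:E
    = \int[Q]_w (grid_fun v n w)%:E)%E.
  by rewrite -integral_indic_sum// => B; exact: measurable_grid_box.
under eq_fun do rewrite E.
have [//|||||_ _] := @dominated_convergence _ _ _ Q setT measurableT
  (fun n w => (grid_fun v n w)%:E) (fun w => (g (Y w))%:E) (cst C%:E).
- by move=> n; apply/measurable_EFinP.
- by apply/measurable_EFinP; exact: measurable_continuous_mx.
- move: hv; apply: filterS => w hw _; apply/cvg_EFin; first exact: nearW.
  apply: grid_sum_cvg => // n B.
  by have /andP[] := v01 n B.
- exact: finite_measure_integrable_cst.
- apply/aeW => w n _ /=; rewrite lee_fin ger0_norm; last first.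
    apply: sumr_ge0 => B _; have /andP[v0 _] := v01 n B.
    by rewrite !mulr_ge0// box_inf_ge0.
  apply: (indic_sum_le (A := fun B : grid n => grid_box B)) => //.
    by move=> B B'; exact: grid_box_uniq.
  move=> B BY; apply: le_trans (gC (Y w)); apply: le_trans (box_inf_le g0 BY).
  by have /andP[v0 v1] := v01 n B; rewrite ler_piMr// box_inf_ge0.
by [].
Qed.

End grid_expectation.

Section portmanteau.
Context (R : realType) (q r : nat).
Context (d : nat -> measure_display) (T : forall N, measurableType (d N)).
Context (P : forall N, probability (T N) R) (X : forall N, T N -> 'M[R]_(q, r)).
Context (d' : measure_display) (T' : measurableType d') (Q : probability T' R).
Context (Y : T' -> 'M[R]_(q, r)) (v : forall n, @grid q r n -> R).
Context (M : forall N, set (T N)).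
Arguments M : clear implicits.
Hypothesis mY : forall i j, measurable_fun setT (fun w => Y w i j).
Hypothesis v01 : forall n (B : grid n), 0 <= v B <= 1.
Hypothesis hv : {ae Q, forall w, forall e : R, 0 < e ->
  \forall n \near \oo, forall B : grid n, grid_box B (Y w) -> 1 - e <= v B}.
Hypothesis mM : forall N, measurable (M N).
Hypothesis PM : forall N, P N (M N) = 1%E.
(* [U] is an inner approximation of the event that [X N] is in the box, which
   need not be measurable. *)
Hypothesis hX : forall n (B : grid n) (e : R), 0 < e -> \forall N \near \oo,
  exists U : set (T N), [/\ measurable U,
    v B * fine (Q (Y @^-1` grid_box B)) - e <= fine (P N U) &
    forall w, M N w -> U w -> grid_box B (X w)].

(** Fix a grid whose weighted step function recovers the expectation of [g] at [Y] up to [e / 2].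
    Its boxes are finitely many, so for large [N] each can lose at most [e / 2 / (W + 1)], where [W]
    is the sum of the infima. *)
Let lower_step (g : 'M[R]_(q, r) -> R) (C e : R) :
  continuous g -> 0 < e -> (forall A, 0 <= g A) -> (forall A, g A <= C) ->
  \forall N \near \oo, exists n (c : @grid q r n -> R) (U : @grid q r n -> set (T N)),
    [/\ forall B, measurable (U B),
        forall w, \sum_(B : grid n) c B * \1_(U B `&` M N) w <= g (X w) &
        (\int[Q]_w (g (Y w))%:E <= (\sum_(B : grid n) c B * fine (P N (U B)) + e)%:E)%E].
Proof.
move=> gc e0 g0 gC.
have C0 : 0 <= C by exact: le_trans (g0 0) (gC 0).
have ig : (0 <= \int[Q]_w (g (Y w))%:E <= C%:E)%E.
  apply/andP; split; first by apply: integral_ge0 => w _; rewrite lee_fin.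
  apply: (@le_trans _ _ (\int[Q]_w C%:E)%E).
    by apply: monotone_integral => w; rewrite lee_fin.
  by rewrite integral_cst// [X in (_ * X)%E]probability_setT mule1.
have fg : (\int[Q]_w (g (Y w))%:E)%E \is a fin_num.
  rewrite fin_numElt; case/andP: ig => h1 h2.
  by rewrite (lt_le_trans _ h1) ?ltNyr// (le_lt_trans h2) ?ltry.
have e2 : 0 < e / 2 by rewrite divr_gt0.
have := grid_expectation_cvg mY g0 gc gC v01 hv.
rewrite -(fineK fg) => /fine_cvg/cvgrPdist_le/(_ _ e2)[n _ /(_ n (leqnn n))/=].
set S := \sum_(B : grid n) _ => hS.
pose W := \sum_(B : grid n) box_inf g B.
have W0 : 0 <= W by apply: sumr_ge0 => B _; exact: box_inf_ge0.
have e3 : 0 < e / 2 / (W + 1) by rewrite divr_gt0// ltr_wpDl.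
have := @filter_forall _ _ _ _ eventually_filter (fun B : grid n => hX B e3).
apply: filterS => N /choice[U hU].
exists n, (fun B => box_inf g B), U; split.
- by move=> B; have [] := hU B.
- move=> w; apply: indic_sum_le => //.
    move=> B B' [UB Mw] [UB' _].
    have [_ _ h1] := hU B; have [_ _ h2] := hU B'.
    exact: grid_box_uniq (h1 w Mw UB) (h2 w Mw UB').
  move=> B [UB Mw]; have [_ _ h1] := hU B.
  exact: box_inf_le (h1 w Mw UB).
- rewrite -(fineK fg) lee_fin.
  have : S - W * (e / 2 / (W + 1)) <= \sum_(B : grid n) box_inf g B * fine (P N (U B)).
    rewrite /W mulr_suml -sumrB; apply: ler_sum => B _.
    by rewrite -mulrA -mulrBr ler_wpM2l ?box_inf_ge0//; have [] := hU B.
  have : W * (e / 2 / (W + 1)) <= e / 2.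
    by rewrite mulrA ler_pdivrMr ?ltr_wpDl// mulrC ler_pM2l// lerDl.
  by move: hS; rewrite ler_norml => /andP[_]; lra.
Qed.

Lemma cvg_in_distribution_boxes : cvg_in_distribution P X Q Y.
Proof.
move=> f fc [C0 [C0r hC0]].
(* Boundedness only provides a bound for every real strictly above [C0]. *)
pose C := `|C0| + 1.
have fC A : `|f A| <= C by apply: hC0 => //; rewrite /C (le_lt_trans (ler_norm C0))// ltrDl.
have fC2 A : - C <= f A <= C by rewrite -ler_norml.
have C0' : 0 <= C by exact: le_trans (fC 0).
have mf : measurable_fun setT (f \o Y).
  have -> : f \o Y = (fun w => (f \+ cst C) (Y w) - C).
    by apply/funext => w /=; rewrite addrK.
  apply: measurable_funB => //; apply: measurable_continuous_mx => //.
  - by move=> A /=; have /andP[] := fC2 A; lra.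
  - by move=> A; exact: (cvgD (@fc A) (cvg_cst _)).
have jf : Q.-integrable setT (EFin \o (f \o Y)).
  apply: (@le_integrable _ _ _ Q setT measurableT _ (cst C%:E)) => //.
  - exact/measurable_EFinP.
  - by move=> w _ /=; rewrite lee_fin (ger0_norm C0').
  - exact: finite_measure_integrable_cst.
have jC : Q.-integrable setT (cst C%:E) by exact: finite_measure_integrable_cst.
rewrite expectation.unlock.
have QC : (\int[Q]_w C%:E = C%:E)%E.
  by rewrite integral_cst// [X in (_ * X)%E]probability_setT mule1.
set E := (\int[Q]_w _)%E.
have fE : E \is a fin_num by exact: integrable_fin_num.
have EC : (\int[Q]_w (f (Y w) + C)%:E = E + C%:E)%E.
  by under eq_integral do rewrite EFinD; rewrite integralD// QC.
have CE : (\int[Q]_w (C - f (Y w))%:E = C%:E - E)%E.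
  by under eq_integral do rewrite EFinB; rewrite integralB// QC.
suff H : forall e, 0 < e -> \forall N \near \oo,
    ((fine E - e)%:E <= \int[P N]_w (f (X w))%:E <= (fine E + e)%:E)%E.
  rewrite -(fineK fE); apply/fine_cvgP; split.
    apply: filterS (H 1 ltr01) => N /andP[h1 h2].
    by rewrite fin_numElt (lt_le_trans _ h1) ?ltNyr// (le_lt_trans h2) ?ltry.
  apply/cvgrPdist_le => e e0; apply: filterS (H e e0) => N /andP[h1 h2].
  have fN : (\int[P N]_w (f (X w))%:E)%E \is a fin_num.
    by rewrite fin_numElt (lt_le_trans _ h1) ?ltNyr// (le_lt_trans h2) ?ltry.
  move: h1 h2; rewrite /= -(fineK fN) !lee_fin => h1 h2.
  by rewrite ler_norml; apply/andP; split; lra.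
move=> e e0.
have lo : \forall N \near \oo, ((fine E - e)%:E <= \int[P N]_w (f (X w))%:E)%E.
  have : continuous (fun A => f A + C) by move=> A; exact: (cvgD (@fc A) (cvg_cst _)).
  move=> /lower_step/(_ e0) step; apply: filterS (step (C + C) _ _).
  - move=> N [n [c [U [mU hU]]]]; rewrite EC -(fineK fE) -EFinD lee_fin => hE.
    apply: le_trans (expectation_ge mU (mM N) (PM N) hU).
    by rewrite lee_fin; lra.
  - by move=> A; have /andP[] := fC2 A; lra.
  - by move=> A; have /andP[] := fC2 A; lra.
have hi : \forall N \near \oo, (\int[P N]_w (f (X w))%:E <= (fine E + e)%:E)%E.
  have : continuous (fun A => C - f A) by move=> A; exact: (cvgB (cvg_cst _) (@fc A)).
  move=> /lower_step/(_ e0) step; apply: filterS (step (C + C) _ _).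
  - move=> N [n [c [U [mU hU]]]]; rewrite CE -(fineK fE) -EFinB lee_fin => hE.
    apply: le_trans (expectation_le mU (mM N) (PM N) hU) _.
    by rewrite lee_fin; lra.
  - by move=> A; have /andP[] := fC2 A; lra.
  - by move=> A; have /andP[] := fC2 A; lra.
by apply: filterS2 lo hi => N ? ?; apply/andP.
Qed.

End portmanteau.

(** * The limit theorem *)

Section box_weight.
Context (R : realType) (p a : R) (k : nat).
Local Notation K := (limit_rate p a).

Definition box_x n (B : @grid k.+1 2 n) (l : 'I_k.+1) : R := corner n (B l ord0).
Definition box_b n (B : @grid k.+1 2 n) (l : 'I_k.+1) : R := corner n (B l ord_max).

(** These are the boxes for which a lower bound is proved; the others get weight 0. Strict ranking
    of the points and the sign of the marks put almost every limit point in such a box once the mesh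
    is small. *)
Definition ordered_box n (B : @grid k.+1 2 n) : bool :=
  [forall l : 'I_k.+1, [forall m : 'I_k.+1,
     (l < m)%N ==> (box_x B m + mesh n <= box_x B l)]] &&
  [forall l, (a < p) || (box_b B l + mesh n < 0)].

(* The exponential is the loss in [marked_box_le], where "exactly one point in
   each cell" is bounded by "at least one"; it tends to 1 with the mesh. *)
Definition box_weight n (B : @grid k.+1 2 n) : R :=
  if ordered_box B then
    expR (- \sum_l K * (expR (- box_x B l) - expR (- (box_x B l + mesh n))))
  else 0.

Let cell_mass_ge0 n (x : R) : 0 <= K * (expR (- x) - expR (- (x + mesh n))).
Proof.
rewrite mulr_ge0 ?limit_rate_ge0// subr_ge0 ler_expR lerN2 lerDl.
by rewrite ltW// mesh_gt0.
Qed.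

Lemma box_weight_bounds n (B : @grid k.+1 2 n) : 0 <= box_weight B <= 1.
Proof.
rewrite /box_weight; case: ifP => _; last by rewrite lexx ler01.
rewrite expR_ge0/= -[leRHS]expR0 ler_expR oppr_le0.
by apply: sumr_ge0 => l _; exact: cell_mass_ge0.
Qed.

Lemma grid_box_pairs n (B : @grid k.+1 2 n) (x b : 'I_k.+1 -> R) :
  grid_box B (pairs_mx x b) <-> forall l, box_x B l <= x l < box_x B l + mesh n /\
    box_b B l <= b l < box_b B l + mesh n.
Proof.
split=> [h l|h l j].
  by have := h l ord0; have := h l ord_max; rewrite !mxE.
rewrite mxE; case: (h l) => h1 h2; case: ifPn => [/eqP ->//|j0].
by have -> : j = ord_max by case: j j0 => -[|[|]]// ? ?; exact/val_inj.
Qed.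

Lemma near_box_weight (x b : 'I_k.+1 -> R) (e : R) :
  (forall l m : 'I_k.+1, (l < m)%N -> x m < x l) ->
  (forall l, (a < p) || (b l < 0)) -> 0 < e ->
  \forall n \near \oo, forall B : grid n,
    grid_box B (pairs_mx x b) -> 1 - e <= box_weight B.
Proof.
move=> xdec bneg e0.
(* The left end of the cell of [x l] is at least [x l - mesh n], hence at least [x l - 1]. *)
pose A := \sum_l K * expR (1 - x l).
have A0 : 0 <= A.
  by apply: sumr_ge0 => l _; rewrite mulr_ge0 ?limit_rate_ge0// expR_ge0.
(* Each of the two cells may extend by a mesh into the gap, so the gap must exceed twice the
   mesh. *)
have near_gap : \forall n \near \oo, forall lm : 'I_k.+1 * 'I_k.+1,
    (lm.1 < lm.2)%N -> mesh n < (x lm.1 - x lm.2) / 2.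
  apply: filter_forall => -[l m] /=; case: (ltnP l m) => [lm|_]; last exact: nearW.
  have gap : 0 < (x l - x m) / 2 by rewrite divr_gt0// subr_gt0 xdec.
  by apply: filterS (near_mesh_lt gap) => n.
have near_neg : \forall n \near \oo, forall l, (a < p) || (mesh n < - b l).
  apply: filter_forall => l; have /orP[->|bl] := bneg l; first exact: nearW.
  have bl' : 0 < - b l by rewrite oppr_gt0.
  by apply: filterS (near_mesh_lt bl') => n ->; rewrite orbT.
have e1 : 0 < e / (A + 1) by rewrite divr_gt0// ltr_wpDl.
near=> n => B /grid_box_pairs hB.
have hneg : forall l, (a < p) || (mesh n < - b l) by near: n.
have mesh1 : mesh n <= 1 :> R by rewrite /mesh invf_le1// ler1n.
have mesh0 : 0 < mesh n :> R by exact: mesh_gt0.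
rewrite /box_weight ifT; last first.
  apply/andP; split.
    apply/forallP => l; apply/forallP => m; apply/implyP => lm.
    have : mesh n < (x l - x m) / 2.
      by apply: (near near_gap n _ (l, m)) => //; near: n.
    have [/andP[h1 h2] _] := hB l; have [/andP[h3 h4] _] := hB m; lra.
  apply/forallP => l; have /orP[->//|bl] := hneg l.
  by have [_ /andP[h1 h2]] := hB l; apply/orP; right; lra.
apply: le_trans (expR_ge1Dx _); rewrite lerD2l lerN2.
apply: (@le_trans _ _ (A * mesh n)).
  rewrite /A mulr_suml; apply: ler_sum => l _; rewrite -mulrA ler_wpM2l ?limit_rate_ge0//.
  have [/andP[h1 h2] _] := hB l; move: (box_x B l) h1 h2 => y h1 h2.
  have -> : expR (- y) - expR (- (y + mesh n)) = expR (- y) * (1 - expR (- mesh n)).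
    by rewrite opprD expRD; ring.
  apply: ler_pM; rewrite ?expR_ge0 ?subr_ge0 ?ler_expR//.
  - by rewrite -expR0 ler_expR oppr_le0 ltW.
  - lra.
  - by rewrite lerBlDr -lerBlDl; exact: expR_ge1Dx.
apply: (@le_trans _ _ (A * (e / (A + 1)))).
  by rewrite ler_wpM2l// ltW//; near: n; exact: near_mesh_lt.
by rewrite mulrA ler_pdivrMr ?ltr_wpDl// mulrC ler_pM2l// lerDl.
Unshelve. all: by end_near. Qed.

End box_weight.

Section unique_ranking.
Context d (T : measurableType d) (R : realType) (P : probability T R).
Context (p a : R) (ha : 0 < a < 1) (N : nat).
Context (X1 : spins (N1 p N) -> {RV P >-> R}) (X2 : config p N -> {RV P >-> R}).
Hypothesis hX1 : forall s1, has_law (X1 s1) (normal_prob 0 1).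
Hypothesis hX2 : forall s, has_law (X2 s) (normal_prob 0 1).
Hypothesis hindep : independent_family P (joint_family X1 X2).

Lemma ae_ranking_unique :
  {ae P, forall w, exists! s, is_ranking (Xi a X1 X2 ^~ w) s}.
Proof.
pose Y1 (s1 : spins (N1 p N)) : T -> R := X1 s1.
pose Y2 (v : spins (N1 p N) * spins (N2 p N)) : T -> R := X2 v.
have mY1 s1 : measurable_fun setT (Y1 s1) by exact: measurable_funPT.
have mY2 v : measurable_fun setT (Y2 v) by exact: measurable_funPT.
have lY1 s1 A : measurable A -> P (Y1 s1 @^-1` A) = normal_prob 0 1 A.
  exact: hX1.
have lY2 v A : measurable A -> P (Y2 v @^-1` A) = normal_prob 0 1 A.
  exact: hX2.
have iY : independent_family P (grem_family Y1 Y2) by exact: hindep.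
have ct1 : Num.sqrt a ^+ 2 + Num.sqrt (1 - a) ^+ 2 = 1.
  by rewrite (sqr_c ha) (sqr_t ha); ring.
have neq : forall tu : config p N * config p N,
    {ae P, forall w, tu.1 != tu.2 -> Xi a X1 X2 tu.1 w != Xi a X1 X2 tu.2 w}.
  move=> [t u] /=; have [->|tu] := eqVneq t u; first exact: aeW.
  have := energy_neq mY1 mY2 lY1 lY2 iY (t_gt0 ha) ct1 tu.
  move=> P0; exists [set w | Xi a X1 X2 t w = Xi a X1 X2 u w]; split => //.
    have -> : [set w | Xi a X1 X2 t w = Xi a X1 X2 u w] =
      [set w | energy Y1 Y2 (Num.sqrt a) (Num.sqrt (1 - a)) t w =
               energy Y1 Y2 (Num.sqrt a) (Num.sqrt (1 - a)) u w] by [].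
    have -> : [set w | energy Y1 Y2 (Num.sqrt a) (Num.sqrt (1 - a)) t w =
               energy Y1 Y2 (Num.sqrt a) (Num.sqrt (1 - a)) u w] =
        (energy Y1 Y2 (Num.sqrt a) (Num.sqrt (1 - a)) t \-
         energy Y1 Y2 (Num.sqrt a) (Num.sqrt (1 - a)) u) @^-1` [set 0].
      by apply/seteqP; split => w /=; [move=> ->; rewrite subrr|move/subr0_eq].
    rewrite -[X in measurable X]setTI.
    by apply: measurable_funB => //; exact: measurable_energy.
  by move=> w /= /not_implyP[_ /negP]; rewrite negbK => /eqP.
have := @filter_forall _ _ _ _ (ae_filter_ringOfSetsType P) neq.
apply: filterS => w hw; apply: ranking_exists_unique => t u.
by apply: contra_eq => tu; exact: (hw (t, u)).
Qed.

End unique_ranking.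

Section convergence.
Context (R : realType) (p a : R).
Hypotheses (hp : 0 < p < 1) (ha : 0 < a < 1) (hap : a <= p).
Context (d : nat -> measure_display) (T : forall N : nat, measurableType (d N))
  (P : forall N : nat, probability (T N) R)
  (X1 : forall N : nat, spins (N1 p N) -> {RV (P N) >-> R})
  (X2 : forall N : nat, config p N -> {RV (P N) >-> R}).
Arguments X1 : clear implicits.
Arguments X2 : clear implicits.
Hypotheses (hX1 : forall (N : nat) (s1 : spins (N1 p N)),
    has_law (X1 N s1) (normal_prob 0 1))
  (hX2 : forall (N : nat) (s : config p N),
    has_law (X2 N s) (normal_prob 0 1))
  (hindep : forall N : nat,
    independent_family (P N) (joint_family (X1 N) (X2 N))).
Context (sigma : forall N : nat, T N -> seq (config p N)).
Hypothesis hsigma : forall N : nat, {ae P N, forall w,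
  is_ranking (Xi a (X1 N) (X2 N) ^~ w) (sigma w)}.
Context (k : nat) (d' : measure_display) (T' : measurableType d')
  (Q : probability T' R) (xi : nat -> {RV Q >-> R}) (W : 'I_k.+1 -> {RV Q >-> R}).
Hypothesis hind : independent_marks Q (fun i => xi i) (fun j => W j).
Local Notation K := (limit_rate p a).
Local Notation nu := (normal_prob 0 (Num.sqrt (1 - a))).
Hypothesis hxi : ranked_poisson_process (exp_intensity K) xi.
Hypothesis hW : forall l (b b' : R), (a < p) || (b' < 0) ->
  K * fine (Q (W l @^-1` `[b, b'[)) = fine (nu `[b, b'[%classic).
Hypothesis Wneg : forall l, {ae Q, forall w, (a < p) || (W l w < 0)}.

Let Y w : 'M[R]_(k.+1, 2) := pairs_mx (fun i : 'I_k.+1 => xi i w) (fun i => W i w).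

Lemma top_vector_cvg :
  cvg_in_distribution P (fun N => top_vector a k.+1 (X1 N) (X2 N) (@sigma N)) Q Y.
Proof.
(* The complement of a null set outside which [sigma] is a ranking. *)
pose M N := ~` sval (cid (hsigma N)).
have mA N : measurable (sval (cid (hsigma N))) by case: cid => A [].
apply: (@cvg_in_distribution_boxes _ _ _ _ _ _ _ _ _ _ _ (@box_weight R p a k) M).
- move=> i j; rewrite (_ : (fun w => Y w i j) = if j == ord0 then xi i else W i).
    by case: ifP => _; exact: measurable_funPT.
  by apply/funext => w; rewrite mxE; case: ifP.
- by move=> n B; exact: box_weight_bounds.
- have [xdec _] := hxi.
  have Wneg' := @filter_forall _ _ _ _ (ae_filter_ringOfSetsType Q) Wneg.
  apply: filterS2 xdec Wneg' => w xdec bneg e e0; apply: near_box_weight => // l m lm.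
  have dec j n : xi (j + n.+1)%N w < xi j w.
    elim: n => [|n IH]; first by rewrite addn1.
    by rewrite addnS; exact: lt_trans (xdec _) IH.
  by have := dec l (m - l).-1; rewrite prednK ?subn_gt0// subnKC ?(ltnW lm).
- by move=> N; exact: measurableC.
- move=> N; rewrite probability_setC//.
  by rewrite (_ : P N _ = 0%E) ?sube0//; case: cid => A [].
move=> n B e e0.
have [oB|nB] := boolP (ordered_box p a B); last first.
  (* The weight of such a box is 0, so the empty event suffices. *)
  apply: nearW => N; exists set0; split => //.
  by rewrite /box_weight (negbTE nB) mul0r sub0r measure0 /= oppr_le0 ltW.
have /andP[/forallP oB1 /forallP oB2] := oB.
pose x := @box_x R k n B; pose x' l := x l + mesh n.
pose b := @box_b R k n B; pose b' l := b l + mesh n.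
have mesh0 : 0 < mesh n :> R by exact: mesh_gt0.
have xx' l : x l < x' l by rewrite ltrDl.
have x'x (l m : 'I_k.+1) : (l < m)%N -> x' m <= x l.
  by move=> lm; have /forallP/(_ m)/implyP := oB1 l; exact.
have good l : (a < p) || (b' l < 0) by exact: oB2.
have YB : Y @^-1` grid_box B = marked_box xi W x x' b b'.
  by apply/seteqP; split => w; rewrite /preimage/= grid_box_pairs.
have lim := box_bound_cvg hp ha hap (x := x) (x' := x') (b := b) good.
have lower : box_weight p a B * fine (Q (Y @^-1` grid_box B)) <= box_limit p a x x' b b'.
  rewrite /box_weight oB YB; apply: marked_box_le => // l; exact: hW.
move/cvgrPdist_le : lim => /(_ _ e0) near_lim.
have near_U := box_bound_le hp ha hap hX1 hX2 hindep b b' xx' x'x.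
apply: filterS2 near_lim near_U => N lim [U [mU PU hU]].
exists U; split => //.
  have : box_bound p a x x' b b' N <= fine (P N U).
    by rewrite -lee_fin fineK// fin_num_measure.
  by move: lim; rewrite ler_norml => /andP[_]; lra.
move=> w Mw Uw; have rk : is_ranking (Xi a (X1 N) (X2 N) ^~ w) (sigma w).
  by move: Mw; rewrite /M /=; case: cid => A [_ _ sA] /= nA; apply: contrapT => /sA.
by apply/grid_box_pairs => l; exact: hU w _ Uw rk l.
Qed.

End convergence.

Section mark_laws.
Context d (T : measurableType d) (R : realType) (Q : probability T R).
Context (p a : R) (ha : 0 < a < 1) (W : {RV Q >-> R}).
Local Notation K := (limit_rate p a).
Local Notation nu := (normal_prob 0 (Num.sqrt (1 - a))).

Lemma gauss_mark (b b' : R) : a < p -> has_law W nu ->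
  K * fine (Q (W @^-1` `[b, b'[)) = fine (nu `[b, b'[%classic).
Proof. by rewrite /limit_rate => -> hW; rewrite mul1r -hW. Qed.

Let nu_neg : nu `]-oo, 0[%classic = (2^-1)%:E.
Proof. by apply: normal_prob_neg; rewrite gt_eqF// t_gt0. Qed.

(** Conditioning divides by the mass one half of the negative half-line, and [K = 1/2] compensates
    exactly. *)
Lemma conditioned_mark (b b' : R) : a = p -> b' < 0 ->
  has_law W (conditioned nu `]-oo, 0[) ->
  K * fine (Q (W @^-1` `[b, b'[)) = fine (nu `[b, b'[%classic).
Proof.
rewrite /limit_rate => <- b'0 hW; rewrite ltxx.
have -> : Q (W @^-1` `[b, b'[) = (nu `[b, b'[%classic / (2^-1)%:E)%E.
  rewrite -nu_neg -[LHS]/(distribution Q W `[b, b'[) hW// /conditioned.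
  rewrite setIidl// => z /=; rewrite !in_itv/= => /andP[_ /lt_trans]; exact.
have f : nu `[b, b'[%classic \is a fin_num by exact: fin_num_measure.
by rewrite inver invr_eq0 pnatr_eq0/= -(fineK f) -EFinM/= invrK mulrC mulfK.
Qed.

Lemma conditioned_mark_neg : has_law W (conditioned nu `]-oo, 0[) ->
  {ae Q, forall w, W w < 0}.
Proof.
move=> hW; exists (W @^-1` `[0, +oo[); split.
- by rewrite -[X in measurable X]setTI; exact: measurable_funPT.
- rewrite -[LHS]/(distribution Q W `[0, +oo[) hW// /conditioned.
  rewrite (_ : _ `&` _ = set0) ?measure0 ?mul0e//.
  apply/seteqP; split => // z /=; rewrite !in_itv/= andbT => -[/le_lt_trans/[apply]].
  by rewrite ltxx.
- by move=> w /= /negP; rewrite -leNgt in_itv/= andbT.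
Qed.

End mark_laws.

Theorem theorem1p2 (R : realType) (p a : R)
  (hp : 0 < p < 1) (ha : 0 < a < 1) (hap : a <= p)
  (d : nat -> measure_display) (T : forall N : nat, measurableType (d N))
  (P : forall N : nat, probability (T N) R)
  (X1 : forall N : nat, spins (N1 p N) -> {RV (P N) >-> R})
  (X2 : forall N : nat, config p N -> {RV (P N) >-> R})
  (hX1 : forall (N : nat) (s1 : spins (N1 p N)),
    has_law (X1 N s1) (normal_prob 0 1))
  (hX2 : forall (N : nat) (s : config p N),
    has_law (X2 N s) (normal_prob 0 1))
  (hindep : forall N : nat,
    independent_family (P N) (joint_family (X1 N) (X2 N))) :
  (forall N : nat, {ae P N, forall w,
     exists! s : seq (config p N), is_ranking (Xi a (X1 N) (X2 N) ^~ w) s}) /\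
  (forall (sigma : forall N : nat, T N -> seq (config p N))
     (hsigma : forall N : nat, {ae P N, forall w,
       is_ranking (Xi a (X1 N) (X2 N) ^~ w) (sigma N w)})
     (k : nat) (hk : (0 < k)%N)
     (d' : measure_display) (T' : measurableType d') (Q : probability T' R)
     (xi : nat -> {RV Q >-> R}) (W : 'I_k -> {RV Q >-> R}),
     independent_marks Q (fun i => xi i) (fun j => W j) ->
     (a < p ->
      ranked_poisson_process (exp_intensity 1) xi ->
      (forall j : 'I_k, has_law (W j) (normal_prob 0 (Num.sqrt (1 - a)))) ->
      cvg_in_distribution P
        (fun N => top_vector a k (X1 N) (X2 N) (sigma N))
        Q (fun w => pairs_mx (fun i : 'I_k => xi i w) (fun i => W i w))) /\
     (a = p ->
      ranked_poisson_process (exp_intensity 2^-1) xi ->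
      (forall j : 'I_k, has_law (W j)
        (conditioned (normal_prob 0 (Num.sqrt (1 - a))) `]-oo, 0[)) ->
      cvg_in_distribution P
        (fun N => top_vector a k (X1 N) (X2 N) (sigma N))
        Q (fun w => pairs_mx (fun i : 'I_k => xi i w) (fun i => W i w)))).
Proof.
split; first by move=> N; exact: ae_ranking_unique (hX1 N) (hX2 N) (hindep N).
(* The box estimates single out a lowest rank [ord_max], so [k] is taken as a successor. *)
move=> sigma hsigma [//|k] _ d' T' Q xi W hind; split => [ap|ap] hxi hW.
- apply: (top_vector_cvg hp ha hap hX1 hX2 hindep hsigma hind).
  + by rewrite /limit_rate ap.
  + by move=> l b b' _; exact: gauss_mark.
  + by move=> l; apply: aeW => w; rewrite ap.
- apply: (top_vector_cvg hp ha hap hX1 hX2 hindep hsigma hind).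
  + by rewrite /limit_rate ap ltxx.
  + by move=> l b b'; rewrite {1}ap ltxx => b0; exact: conditioned_mark.
  + move=> l; apply: filterS (conditioned_mark_neg (hW l)) => w ->; exact: orbT.
Qed.
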